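(* The Borodin–Olshanski series $$ {}_2\widehat F_1(a,b;c;x;\alpha)=\sum_{\lambda\in\mathcal P_n}\frac{(a;\alpha)_\lambda(b;\alpha)_\lambda}{(c)_{|\lambda|}}\,\alpha^{|\lambda|}\,\frac{J_\lambda(x)}{j_\lambda}$$ is the unique element $F(x)$ of $\mathscr F^{(x)}$ satisfying $$\bigl(\widehat{\mathcal L}^{(n)}(c)-\mathcal M^{(n)}(a,b)\bigr)(F(x))=0,\qquad F(\mathbf 0_n)=1,$$ subject to the stability condition that for each $1\le m\le n-1$, $$\bigl(\widehat{\mathcal L}^{(m)}(c)-\mathcal M^{(m)}(a,b)\bigr)\bigl(F(x_1,\dots,x_m,0,\dots,0)\bigr)=0 .$$
   Context: Fix $n\ge 1$, let $\alpha$ be an indeterminate over $\mathbb Q$ and $a,b,c$ further indeterminates; $x=(x_1,\dots,x_n)$, $\mathbf 0_n=(0,\dots,0)$. $\mathcal P_n$ is the set of partitions $\lambda=(\lambda_1\ge\dots\ge\lambda_n\ge0)$ of length at most $n$; $|\lambda|=\sum_i\lambda_i$; $\lambda$ is identified with its Young diagram $\{(i,j):1\le j\le\lambda_i\}$; $\lambda'$ is the conjugate partition. Jack polynomials: on the ring of symmetric functions over $\mathbb Q(\alpha)$ let $\langle p_\lambda,p_\mu\rangle_\alpha=\delta_{\lambda\mu}z_\lambda\alpha^{\ell(\lambda)}$, where $p_\lambda$ are power sums, $z_\lambda=\prod_r r^{m_r}m_r!$ and $m_r$ is the multiplicity of $r$ in $\lambda$. The integral form Jack functions $J_\lambda=J_\lambda(\cdot;\alpha)$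 are the unique pairwise orthogonal family such that $J_\lambda$ is a linear combination of monomial symmetric functions $m_\mu$ with $\mu\le\lambda$ in dominance order and the coefficient of $m_{(1^{|\lambda|})}$ in $J_\lambda$ is $|\lambda|!$. $J_\lambda(x)$ denotes the restriction to $n$ variables. Put $j_\lambda=\prod_{(i,j)\in\lambda}\bigl((\lambda_i-j)\alpha+\lambda_j'-i+1\bigr)\bigl((\lambda_i-j+1)\alpha+\lambda_j'-i\bigr)$. $(a;\alpha)_\lambda=\prod_{(i,j)\in\lambda}\bigl(a+(j-1)-\tfrac{i-1}{\alpha}\bigr)$, and $(c)_k=c(c+1)\cdots(c+k-1)$ is the ordinary Pochhammer symbol. Let $K=\mathbb Q(\alpha)(a,b,c)$. $\mathscr F^{(x)}$ is the space of formal power series $F(x)=\sum_{\lambda\in\mathcal P_n}C_\lambda\,\alpha^{|\lambda|}J_\lambda(x)/j_\lambda$ with $C_\lambda\in K$. For $1\le m\le n$, with $\partial_i=\partial/\partial x_i$ and acting term-wise on symmetric formal power series in $x_1,\dots,x_m$: $$\widehat{\mathcal L}^{(m)}(c)=\Bigl(c+\sum_{i=1}^m x_i\partial_i\Bigr)\sum_{i=1}^m\partial_i,$$ $$\mathcal M^{(m)}(a,b)=\sum_{i=1}^m\bigl(x_i^2\partial_i^2+(a+b+1)x_i\partial_i+ab\bigr)+\frac1\alpha\sum_{1\le i\ne j\le m}\frac{x_i+x_j}{x_i-x_j}\,x_i\partial_i .$$ *)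

(* Defs.v *)
(* Mathematical Components, with the multinomials library. *)
From HB Require Import structures.
From mathcomp Require Import all_boot all_order all_algebra.
From mathcomp Require Import mpoly.

Set Implicit Arguments.
Unset Strict Implicit.
Unset Printing Implicit Defensive.

Import GRing.Theory.
Local Open Scope ring_scope.

Notation "x %:F" := (tofrac x) : ring_scope.

(* -------------------------------------------------------------------- *)
(* Integer partitions, without trailing zeros.                          *)

Definition is_intpart (s : seq nat) : bool := sorted geq s && (0 \notin s)%N.

Record intpart := IntPart { pseq :> seq nat; _ : is_intpart pseq }.

HB.instance Definition _ := [isSub for pseq].
HB.instance Definition _ := [Countable of intpart by <:].

Implicit Types (la mu rho : intpart).

Definition psize la : nat := sumn la.
Definition plength la : nat := size la.

(* la_i, with 1-based i as in the formulas below. *)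
Definition ppart la (i : nat) : nat := nth 0%N la i.-1.

(* la'_j, the number of i with la_i >= j. *)
Definition pconj la (j : nat) : nat := count (fun k => (j <= k)%N) la.

Definition pmult la (r : nat) : nat := count_mem r la.

(* The column (1^d). *)
Lemma is_intpart_col (d : nat) : is_intpart (nseq d 1%N).
Proof.
rewrite /is_intpart mem_nseq andbF andbT.
by case: d => //= d; elim: d => //= d ->.
Qed.

Definition pcol (d : nat) : intpart := IntPart (is_intpart_col d).

Definition dominated mu la : Prop :=
  psize mu = psize la /\
  forall k : nat, (sumn (take k mu) <= sumn (take k la))%N.

(* The partitions of d of length at most n, obtained from the weakly     *)
(* decreasing n-tuples of sum d by erasing their zeros.                  *)
Definition parts (n d : nat) : seq intpart :=
  pmap insub [seq [seq k <- map val t | (0 < k)%N]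
             | t : n.-tuple 'I_d.+1
             <- enum {: n.-tuple 'I_d.+1}
             & sorted geq (map val t) && (sumn (map val t) == d)].

(* All partitions of d. *)
Definition partitions_of (d : nat) : seq intpart := parts d d.

Lemma geq_trans : transitive geq.
Proof. by move=> y x z /= h1 h2; apply: leq_trans h2 h1. Qed.

Lemma sumn_filter_pos (s : seq nat) : sumn [seq k <- s | (0 < k)%N] = sumn s.
Proof. by elim: s => //= -[|x] s IH /=; rewrite IH. Qed.

Lemma sorted_geq_filter_pos (s : seq nat) : sorted geq s ->
  s = [seq k <- s | (0 < k)%N] ++ nseq (size s - count (ltn 0) s) 0%N.
Proof.
elim: s => //= x s IH pxs; have ss := path_sorted pxs.
case: x pxs => [|x] pxs /=; last by rewrite add1n subSS -IH.
have z : all (pred1 0%N) s.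
  have := order_path_min geq_trans pxs.
  by apply: sub_all => k /=; rewrite leqn0.
have -> : [seq k <- s | (0 < k)%N] = [::].
  by rewrite (all_pred1P _ _ z); elim: (size s).
have -> : count (ltn 0) s = 0%N.
  by rewrite (all_pred1P _ _ z) count_nseq.
by rewrite add0n subn0 /= {1}(all_pred1P _ _ z).
Qed.

Lemma mem_parts n d la :
  (la \in parts n d) = (plength la <= n)%N && (psize la == d).
Proof.
rewrite /parts mem_pmap_sub; apply/mapP/andP => [[t]|[le_n /eqP eq_d]].
  rewrite mem_filter => /andP[/andP[_ /eqP sd] _] /= E; split.
    by rewrite /plength E size_filter (leq_trans (count_size _ _)) // size_map size_tuple.
  by rewrite /psize E sumn_filter_pos sd.
have /andP[srt n0] := valP la.
pose s := (la : seq nat) ++ nseq (n - size la) 0%N.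
have szs : size s = n by rewrite size_cat size_nseq subnKC.
have sms : sumn s = d by rewrite sumn_cat sumn_nseq mul0n addn0.
have lts x : x \in s -> (x < d.+1)%N.
  by move=> xs; rewrite ltnS -sms (perm_sumn (perm_to_rem xs)) leq_addr.
pose t := map_tuple (inord : nat -> 'I_d.+1) (tcast szs (in_tuple s)).
have tE : map val t = s.
  rewrite /= val_tcast /= -map_comp -[RHS]map_id; apply/eq_in_map => x xs /=.
  by rewrite inordK ?lts.
exists t.
  rewrite mem_filter mem_enum inE andbT tE sms eqxx andbT /s.
  rewrite (sorted_pairwise geq_trans) pairwise_cat -(sorted_pairwise geq_trans) srt /=.
  rewrite -(sorted_pairwise geq_trans); apply/andP; split.
    by apply/allrelP => x y _; rewrite mem_nseq => /andP[_ /eqP->].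
  by case: (n - _)%N => //= m; elim: m => //= m ->.
rewrite tE /s filter_cat /=.
have -> : [seq k <- nseq (n - size la) 0%N | (0 < k)%N] = [::].
  by elim: (n - _)%N.
rewrite cats0; apply/esym/all_filterP/allP => x xl; rewrite lt0n.
by apply: contraNneq n0 => <-.
Qed.

Lemma parts_uniq n d : uniq (parts n d).
Proof.
rewrite /parts pmap_sub_uniq // map_inj_in_uniq; first exact: filter_uniq (enum_uniq _).
move=> t u; rewrite !mem_filter => /andP[/andP[st _] _] /andP[/andP[su _] _] E.
apply/val_inj/(inj_map val_inj) => /=.
have cE : count (ltn 0) (map val t) = count (ltn 0) (map val u).
  by rewrite -!size_filter E.
by rewrite (sorted_geq_filter_pos st) (sorted_geq_filter_pos su) E cE
           !size_map !size_tuple.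
Qed.

(* -------------------------------------------------------------------- *)
(* Symmetric functions. An element of the ring of symmetric functions is *)
(* given by its restrictions to N variables, for every N.                *)

Definition symfun (R : nzRingType) := forall N : nat, {mpoly R[N]}.

Section SymFun.
Variable R : comNzRingType.

Definition psum (r : nat) : symfun R := fun N => \sum_(i < N) 'X_i ^+ r.

Definition p_fun rho : symfun R := fun N => \prod_(r <- rho) psum r N.

(* The sum of all distinct monomials whose nonzero exponents are, up to  *)
(* order, the parts of mu; it is 0 when N < plength mu.                  *)
Definition m_fun mu : symfun R := fun N =>
  \sum_(e : 'X_{1..N < (psize mu).+1}
         | perm_eq [seq k <- bmnm e | (0 < k)%N] mu) 'X_[bmnm e].

End SymFun.

Definition zpart rho : nat :=
  (\prod_(r <- undup rho) (r ^ pmult rho r * (pmult rho r)`!))%N.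

(* <f, g>_alpha = r, computed on expansions of f and g in power sums.    *)
Definition jack_pairing (R : comNzRingType) (alpha : R) (f g : symfun R)
    (r : R) : Prop :=
  exists (s : seq intpart) (u v : intpart -> R),
    [/\ uniq s,
        forall N, f N = \sum_(rho <- s) u rho *: p_fun R rho N,
        forall N, g N = \sum_(rho <- s) v rho *: p_fun R rho N
      & r = \sum_(rho <- s)
              u rho * v rho * ((zpart rho)%:R * alpha ^+ plength rho)].

Definition is_jack_family (R : comNzRingType) (alpha : R)
    (J : intpart -> symfun R) : Prop :=
  (forall la mu, la != mu -> jack_pairing alpha (J la) (J mu) 0) /\
  (forall la, exists u : intpart -> R,
    [/\ forall mu, u mu != 0 -> dominated mu la,
        forall N, J la N =
          \sum_(mu <- partitions_of (psize la)) u mu *: m_fun R mu N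
      & u (pcol (psize la)) = ((psize la)`!)%:R]).

(* -------------------------------------------------------------------- *)

Section Constants.
Variables (K : fieldType) (alpha : K).

(* On the boxes (i, j) of la the natural subtractions are exact.         *)
Definition jnorm la : K :=
  \prod_(1 <= i < (plength la).+1) \prod_(1 <= j < (ppart la i).+1)
    (((ppart la i - j)%:R * alpha + (pconj la j - i + 1)%:R) *
     ((ppart la i - j + 1)%:R * alpha + (pconj la j - i)%:R)).

Definition gpoch (a : K) la : K :=
  \prod_(1 <= i < (plength la).+1) \prod_(1 <= j < (ppart la i).+1)
    (a + (j - 1)%:R - (i - 1)%:R / alpha).

Definition poch (c : K) (k : nat) : K := \prod_(0 <= i < k) (c + i%:R).

End Constants.

(* -------------------------------------------------------------------- *)
(* Formal power series in n variables, as coefficient functions.         *)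

Definition fps (K : nzRingType) (n : nat) := 'X_{1..n} -> K.

Section Series.
Variable K : fieldType.

(* F(x_1, ..., x_m, 0, ..., 0), for m <= n.                              *)
Definition fps_restrict (n m : nat) (F : fps K n) : fps K m :=
  fun e => F [multinom nth 0%N e i | i < n].

Definition fps_hcomp (n : nat) (F : fps K n) (d : nat) : {mpoly K[n]} :=
  \sum_(e : 'X_{1..n < d.+1} | mdeg e == d) F (bmnm e) *: 'X_[bmnm e].

Section Operators.
Variables (m : nat) (alpha a b c : K).

Definition Lop (p : {mpoly K[m]}) : {mpoly K[m]} :=
  let q := \sum_(i < m) p^`M(i) in
  c *: q + \sum_(i < m) 'X_i * q^`M(i).

(* Each term of the double sum is a rational function, whence the target. *)
Definition Mop (p : {mpoly K[m]}) : {fraction {mpoly K[m]}} :=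
  (\sum_(i < m) ('X_i ^+ 2 * p^`M(i)^`M(i) + (a + b + 1) *: ('X_i * p^`M(i))
                 + (a * b) *: p))%:F
  + (alpha^-1)%:MP_[m]%:F *
    \sum_(i < m) \sum_(j < m | j != i)
      ('X_i + 'X_j)%:F / ('X_i - 'X_j)%:F * ('X_i * p^`M(i))%:F.

(* (L - M)(F) = 0, the operators acting term-wise. As L lowers degrees by *)
(* one and M preserves them, the component of degree d of (L - M)(F) is   *)
(* L(F_(d+1)) - M(F_d), where F_d is the component of degree d of F.      *)
Definition annihilated (F : fps K m) : Prop :=
  forall d : nat, (Lop (fps_hcomp F d.+1))%:F - Mop (fps_hcomp F d) = 0.

End Operators.

(* The series \sum_la C_la alpha^|la| J_la(x) / j_la over the partitions  *)
(* of length at most n, where iota embeds the coefficients of J into K.   *)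
(* J_la being homogeneous of degree |la|, only |la| = mdeg e contributes  *)
(* to the coefficient of x^e.                                             *)
Definition jack_series (Q : nzRingType) (iota : Q -> K) (alpha : K)
    (J : intpart -> symfun Q) (n : nat) (C : intpart -> K) : fps K n :=
  fun e => \sum_(la <- parts n (mdeg e))
    C la * alpha ^+ psize la * iota ((J la n)@_e) / jnorm alpha la.

End Series.

Arguments fps_restrict {K n} m F _.
Arguments jack_series {K Q} iota alpha J n C _.

(* -------------------------------------------------------------------- *)
(* The ground fields Q(alpha) and K = Q(alpha)(a, b, c).                 *)

Definition Qalpha : fieldType := {fraction {poly rat}}.
Definition alphaQ : Qalpha := ('X : {poly rat})%:F.

Definition Kabc : fieldType := {fraction {mpoly Qalpha[3]}}.
Definition iotaK (z : Qalpha) : Kabc := (z%:MP_[3])%:F.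
Definition alphaK : Kabc := iotaK alphaQ.
Definition aK : Kabc := ('X_(inord 0) : {mpoly Qalpha[3]})%:F.
Definition bK : Kabc := ('X_(inord 1) : {mpoly Qalpha[3]})%:F.
Definition cK : Kabc := ('X_(inord 2) : {mpoly Qalpha[3]})%:F.

Section Main.
Variables (J : intpart -> symfun Qalpha) (n : nat).

Definition in_Fx (F : fps Kabc n) : Prop :=
  exists C : intpart -> Kabc, F =1 jack_series iotaK alphaK J n C.

Definition BO_series : fps Kabc n :=
  jack_series iotaK alphaK J n (fun la =>
    gpoch alphaK aK la * gpoch alphaK bK la / poch cK (psize la)).

Definition BO_system (F : fps Kabc n) : Prop :=
  [/\ annihilated alphaK aK bK cK F,
      F 0%MM = 1
    & forall m : nat, (1 <= m)%N -> (m <= n - 1)%N ->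
        annihilated alphaK aK bK cK (fps_restrict m F)].

End Main.

Arguments BO_series : clear implicits.

(* Main.v *)
Require Import Defs.
From HB Require Import structures.
From mathcomp Require Import all_boot all_order all_algebra.
From mathcomp Require Import ssrcomplements mpoly perm ring zify.

Set Implicit Arguments.
Unset Strict Implicit.
Unset Printing Implicit Defensive.

Import Order.Theory GRing.Theory.
Local Open Scope ring_scope.

(* Write E for the sum of the d/dx_i. On the component of degree d + 1 the    *)
(* operator L(c) is (c + d) E, while M(a, b) is a scalar plus the             *)
(* Laplace-Beltrami operator on the component of degree d, so the equation    *)
(* is a recursion giving E F_(d+1) in terms of F_d. As c + d <> 0 and a       *)
(* symmetric polynomial of positive degree is zero when E kills its           *)
(* restrictions to every number m of variables, 1 <= m <= n, the solution is  *)
(* unique.                                                                    *)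
(* For existence, the Laplace-Beltrami operator has J_la as an eigenvector,   *)
(* with an eigenvalue given by the content sum ct(la). In the power sums it   *)
(* is self-adjoint for the Jack product, and up to a factor its commutator    *)
(* with d/dp_1 is the part of E that does not depend on n. Hence              *)
(*   E J_la = sum_mu (n + alpha x) g(la, mu) J_mu,   x = ct(la) - ct(mu),     *)
(* where d/dp_1 J_la = sum_mu g(la, mu) J_mu. If p_1 J_mu is the sum of the   *)
(* kappa(la, mu) J_la, then g and kappa are adjoint, and the recursion        *)
(* becomes a closed formula for                                               *)
(*   sum_la kappa(la, mu) (a + x) (b + x) (n + alpha x),                      *)
(* that is, for the moments of x of order at most 3 with weights              *)
(* kappa(la, mu). They follow by induction on mu: in n = l(la) variables,     *)
(* J_la is proportional to x_1 ... x_n J_nu, nu being la without its first    *)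
(* column. The same induction shows that the norm of J_la is j_la.            *)

(** * Operators on polynomials *)

(** Uniqueness is carried by [translation_kernel_deg]: the equations in every number of variables up
    to n, and not just the one in n variables, determine each symmetric component from the preceding
    one. [series_unique] applies it to the difference of two solutions. For existence, [lbrel_ev]
    turns the Laplace-Beltrami operator into [jackop], an operator in the power sums that is
    self-adjoint ([jackop_selfadj]). Self-adjointness, triangularity ([lbrel_lead]) and definiteness
    of the Jack product make the Jack polynomials eigenvectors ([jack_eigen]). What is needed about
    the numbers kappa and g comes from one factorization, [jack_strip]. It relates the pair (la, mu)
    to the pair with first columns removed when the lengths agree ([kap_strip]), and it identifies
    the pair when la is longer ([gdn_strip]). Evaluation at (1, ..., 1) ([jack_one]) makes the
    proportionality factors explicit. In [moment_strip] the weight x + n / alpha vanishes on the box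
    that opens row n + 1, so the moments obey a recursion without boundary terms, solved in
    [kap_moments]. For the norm, a similar sum over g is evaluated in two ways ([gdn_moment_strip]),
    columns being treated separately ([nrm_column]); [nrm_jnorm] concludes. Finally
    [eigenvalue_moments] identifies the cubic moment with the eigenvalue of M(a, b), and
    [BO_annihilated] compares the coefficients of each J_mu. *)

Section MonomialOrder.
Variable n : nat.
Implicit Types (m : 'X_{1..n}) (i j : 'I_n).

Lemma ltmc_mnm1 i j : (i < j)%N -> (U_(j)%MM < U_(i)%MM :> 'X_{1..n})%O.
Proof.
move=> ij; apply/ltmcP; first by rewrite !mdeg1.
exists i; last by rewrite !mnm1E eqxx; case: eqP ij => // ->; rewrite ltnn.
move=> k ki; rewrite !mnm1E; case: eqP => [E|_]; case: eqP => [E'|_] //.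
  by move: ki; rewrite -E; lia.
by move: ki; rewrite -E' ltnn.
Qed.

Lemma ltmc_shift i j m m' : (i < j)%N -> (m' + U_(j) = m + U_(i))%MM -> (m < m')%O.
Proof.
move=> ij E; rewrite -(ltmc_add2l m m' U_(j)%MM) E.
by rewrite ltmc_add2r ltmc_mnm1.
Qed.

End MonomialOrder.

Section Euler.
Variables (K : comNzRingType) (n : nat).
Implicit Types (p q : {mpoly K[n]}) (m : 'X_{1..n}) (i j : 'I_n).

Lemma mcoeffXM i p m :
  ('X_i * p)@_m = if m i == 0%N then 0 else p@_(m - U_(i))%MM.
Proof.
case: ifPn => [|mi]; last first.
  have {1}-> : m = (U_(i) + (m - U_(i)))%MM by rewrite addmC submK // lep1mP.
  by rewrite mulrC mcoeffMX.
move=> mi; rewrite mcoeffM big1 // => -[k1 k2] /eqP E /=; rewrite mcoeffX.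
case: eqP => [Ek|]; last by rewrite mul0r.
by move: mi; rewrite (congr1 (fun u : 'X_{1..n} => u i) E) /= -Ek mnmDE mnm1E eqxx.
Qed.

Definition eul i p := 'X_i * p^`M(i).

Lemma mcoeff_eul i p m : (eul i p)@_m = (m i)%:R * p@_m.
Proof.
rewrite mcoeffXM; case: eqP => [->|/eqP mi]; first by rewrite mul0r.
rewrite mcoeff_deriv submK ?lep1mP // mnmBE mnm1E eqxx subn1 prednK ?lt0n //.
by rewrite mulr_natl.
Qed.

Lemma eulD i p q : eul i (p + q) = eul i p + eul i q.
Proof. by rewrite /eul mderivD mulrDr. Qed.

Lemma eulZ i c p : eul i (c *: p) = c *: eul i p.
Proof. by rewrite /eul mderivZ scalerAr. Qed.

Lemma eulM i p q : eul i (p * q) = eul i p * q + p * eul i q.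
Proof. by rewrite /eul mderivM; ring. Qed.

Lemma mderiv_eul i j p :
  (eul i p)^`M(j) = p^`M(i) *+ (i == j) + 'X_i * p^`M(i)^`M(j).
Proof.
rewrite /eul mderivM mderivX mnm1E; congr (_ + _).
case: eqP => [<-|_]; last by rewrite scale0r mul0r.
by rewrite scale1r -[X in (X - _)%MM]add0m addmK mpolyX0 mul1r.
Qed.

Lemma eul2E i p : 'X_i ^+ 2 * p^`M(i)^`M(i) = eul i (eul i p) - eul i p.
Proof. by rewrite {1}/eul mderiv_eul eqxx mulr1n /eul; ring. Qed.

Definition euler p := \sum_(i < n) eul i p.

Lemma mcoeff_euler p m : (euler p)@_m = (mdeg m)%:R * p@_m.
Proof.
rewrite raddf_sum /= (eq_bigr (fun i => (m i)%:R * p@_m)); last first.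
  by move=> i _; rewrite mcoeff_eul.
by rewrite -mulr_suml mdegE natr_sum.
Qed.

Lemma euler_dhomog d p : p \is d.-homog -> euler p = d%:R *: p.
Proof.
move=> hp; apply/mpolyP => m; rewrite mcoeff_euler mcoeffZ.
by case: (eqVneq (mdeg m) d) => [->//|md]; rewrite (dhomog_nemf_coeff hp md) !mulr0.
Qed.

End Euler.

(* The Laplace-Beltrami operator, as a relation: [lbrel f g] says that        *)
(* alpha * sum_i x_i^2 d_i^2 f                                                *)
(*   + sum_(i < j) (x_i + x_j) / (x_i - x_j) (x_i d_i f - x_j d_j f)          *)
(* is the polynomial alpha * g, the quotients being the polynomials G i j.    *)
Section LaplaceBeltrami.
Variables (K : fieldType) (alpha : K) (n : nat).
Implicit Types (f g h p q : {mpoly K[n]}) (m : 'X_{1..n}) (i j : 'I_n).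

Definition lbrel f g := exists G : 'I_n -> 'I_n -> {mpoly K[n]},
  (forall i j, (i < j)%N ->
     ('X_i - 'X_j) * G i j = ('X_i + 'X_j) * (eul i f - eul j f)) /\
  alpha *: \sum_(i < n) 'X_i ^+ 2 * f^`M(i)^`M(i) + \sum_(i < n) \sum_(j < n | (i < j)%N) G i j
    = alpha *: g.

Lemma lbrel0 : lbrel 0 0.
Proof.
exists (fun _ _ => 0); split=> [i j _|].
  by rewrite /eul !mderiv0 !mulr0 subr0 mulr0.
rewrite big1; last by move=> i _; rewrite !mderiv0 mulr0.
by rewrite big1 ?addr0 // => i _; rewrite big1.
Qed.

Lemma lbrelD f1 g1 f2 g2 : lbrel f1 g1 -> lbrel f2 g2 -> lbrel (f1 + f2) (g1 + g2).
Proof.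
move=> [G1 [H1 E1]] [G2 [H2 E2]]; exists (fun i j => G1 i j + G2 i j); split.
  by move=> i j ij; rewrite mulrDr H1 // H2 // !eulD; ring.
rewrite scalerDr -E1 -E2 addrACA -scalerDr -!big_split /=.
congr (alpha *: _ + _); apply: eq_bigr => i _; last by rewrite big_split.
by rewrite !mderivD mulrDr.
Qed.

Lemma lbrelZ c f g : lbrel f g -> lbrel (c *: f) (c *: g).
Proof.
move=> [G [H E]]; exists (fun i j => c *: G i j); split.
  by move=> i j ij; rewrite -scalerAr H // !eulZ -scalerBr scalerAr.
rewrite scalerA mulrC -scalerA -E scalerDr !scaler_sumr.
congr (_ + _); last by apply: eq_bigr => i _; rewrite scaler_sumr.
apply: eq_bigr => i _.
by rewrite !mderivZ -scalerAr !scalerA mulrC.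
Qed.

Lemma lbrel_sum (I : eqType) (s : seq I) (F G : I -> {mpoly K[n]}) :
  {in s, forall k, lbrel (F k) (G k)} -> lbrel (\sum_(k <- s) F k) (\sum_(k <- s) G k).
Proof.
elim: s => [_|k s IH H]; first by rewrite !big_nil; exact: lbrel0.
rewrite !big_cons; apply: lbrelD; first by apply: H; rewrite inE eqxx.
by apply: IH => l ls; apply: H; rewrite inE ls orbT.
Qed.

(** Compare the coefficients of x_i x^m. Besides x_i times x^m, only x_j times x^m x_i / x_j could
    contribute, and that monomial is larger than x^m because i < j, so both G and h vanish there. *)
Lemma quotient_top_coeff i j (G h : {mpoly K[n]}) m : (i < j)%N ->
    ('X_i - 'X_j) * G = ('X_i + 'X_j) * h ->
    (forall m', (m < m')%O -> G@_m' = 0) -> (forall m', (m < m')%O -> h@_m' = 0) ->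
  G@_m = h@_m.
Proof.
move=> ij E HG Hh.
have Xj (q : {mpoly K[n]}) : (forall m', (m < m')%O -> q@_m' = 0) -> ('X_j * q)@_(m + U_(i))%MM = 0.
  move=> Hq; rewrite mcoeffXM; case: ifP => // /negbT h0; apply: Hq.
  by apply: (ltmc_shift ij); rewrite submK // lep1mP.
have Xi (q : {mpoly K[n]}) : ('X_i * q)@_(m + U_(i))%MM = q@_m by rewrite mulrC addmC mcoeffMX.
move/(congr1 (fun q => q@_(m + U_(i))%MM)): E.
by rewrite mulrBl mulrDl mcoeffB mcoeffD !Xi !Xj // subr0 addr0.
Qed.

(** The coefficient of [eul i f - eul j f] at k is (k_i - k_j) times that of f. A monomial of G
    above m would make the leading monomial of G lie above m, where [quotient_top_coeff] equates its
    coefficient with a zero one. *)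
Lemma quotient_lead i j (G : {mpoly K[n]}) f m : (i < j)%N ->
    ('X_i - 'X_j) * G = ('X_i + 'X_j) * (eul i f - eul j f) ->
    (forall m', (m < m')%O -> f@_m' = 0) ->
  (forall m', (m < m')%O -> G@_m' = 0) /\ G@_m = ((m i)%:R - (m j)%:R) * f@_m.
Proof.
move=> ij E Hf; set h := eul i f - eul j f in E.
have hE k : h@_k = ((k i)%:R - (k j)%:R) * f@_k.
  by rewrite /h mcoeffB !mcoeff_eul mulrBl.
have Hh m' : (m < m')%O -> h@_m' = 0 by move=> mm; rewrite hE Hf // mulr0.
have HG m' : (m < m')%O -> G@_m' = 0.
  move=> mm; apply/eqP; apply/negPn/negP => Gm'.
  have G0 : G != 0 by apply: contraNneq Gm' => ->; rewrite mcoeff0.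
  have le : (m' <= mlead G)%O by apply: msupp_le_mlead; rewrite mcoeff_msupp.
  have lt := lt_le_trans mm le.
  have := quotient_top_coeff ij E (@mcoeff_gt_mlead _ _ G)
            (fun k kk => Hh k (lt_trans lt kk)).
  by move/eqP; rewrite Hh // mleadc_eq0 (negPf G0).
by split=> //; rewrite (quotient_top_coeff ij E HG Hh) hE.
Qed.

(* alpha times the eigenvalue with leading monomial x^m. *)
Definition lbeig m : K := alpha * (\sum_(i < n) (m i * (m i).-1)%N)%:R
  + \sum_(i < n) \sum_(j < n | (i < j)%N) ((m i)%:R - (m j)%:R).

Lemma mcoeff_eul2 i f m :
  ('X_i ^+ 2 * f^`M(i)^`M(i))@_m = (m i * (m i).-1)%:R * f@_m.
Proof.
rewrite eul2E mcoeffB !mcoeff_eul natrM; case: (m i) => [|k]; first by ring.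
by rewrite -natr1 /=; ring.
Qed.

(** Triangularity: neither the second order terms nor, by [quotient_lead], the quotients create
    monomials above m, and at m they act by scalars that add up to [lbeig m]. *)
Lemma lbrel_lead f g m : lbrel f g -> (forall m', (m < m')%O -> f@_m' = 0) ->
  (forall m', (m < m')%O -> alpha * g@_m' = 0) /\ alpha * g@_m = lbeig m * f@_m.
Proof.
move=> [G [H E]] Hf.
have ag k : alpha * g@_k = alpha * (\sum_(i < n) (k i * (k i).-1)%N)%:R * f@_k
    + \sum_(i < n) \sum_(j < n | (i < j)%N) (G i j)@_k.
  rewrite -mcoeffZ -E mcoeffD mcoeffZ !raddf_sum /= -mulrA mulr_suml.
  congr (_ * _ + _); apply: eq_bigr => i _; first by rewrite mcoeff_eul2.
  by rewrite raddf_sum.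
split=> [m' mm|].
  rewrite ag Hf // mulr0 add0r big1 // => i _; rewrite big1 // => j ij.
  by case: (quotient_lead ij (H i j ij) Hf) => HG _; exact: HG.
rewrite ag /lbeig mulrDl mulr_suml; congr (_ + _); apply: eq_bigr => i _.
rewrite mulr_suml; apply: eq_bigr => j ij.
by case: (quotient_lead ij (H i j ij) Hf).
Qed.

Definition prodX : {mpoly K[n]} := \prod_(i < n) 'X_i.

Lemma eul_prodX i : eul i prodX = prodX.
Proof.
apply/mpolyP => m; rewrite mcoeff_eul /prodX mprodXE mcoeffX.
case: eqP => [<-|_]; last by rewrite mulr0.
by rewrite mnm_sumE (bigD1 i) //= mnm1E eqxx big1 ?mul1r // => j /negPf ji; rewrite mnm1E ji.
Qed.

(** Conjugation by x_1 ... x_n replaces x_i d_i by x_i d_i + 1. Differences of two such operators do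
    not change, so the quotients are merely multiplied, while x_i^2 d_i^2 gains 2 x_i d_i. *)
Lemma lbrel_prodX f g : lbrel f g -> lbrel (prodX * f) (prodX * (g + 2%:R *: euler f)).
Proof.
move=> [G [H E]]; exists (fun i j => prodX * G i j); split.
  move=> i j ij; rewrite mulrCA H // (eulM i prodX) (eulM j prodX) !eul_prodX.
  by ring.
have -> : \sum_(i < n) \sum_(j < n | (i < j)%N) prodX * G i j
   = prodX * \sum_(i < n) \sum_(j < n | (i < j)%N) G i j.
  by rewrite mulr_sumr; apply: eq_bigr => i _; rewrite mulr_sumr.
rewrite scalerAr scalerDr -E (eq_bigr (fun i =>
   prodX * ('X_i ^+ 2 * f^`M(i)^`M(i) + 2%:R *: eul i f))); last first.
  move=> i _; have eP h : eul i (prodX * h) = prodX * (h + eul i h).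
    by rewrite (eulM i prodX h) eul_prodX mulrDr.
  rewrite !eul2E !eP eulD.
  by rewrite scaler_nat; ring.
rewrite -mulr_sumr big_split /= scalerAr -mulrDr; congr (_ * _).
by rewrite /euler scalerDr -scaler_sumr addrAC.
Qed.

End LaplaceBeltrami.

Lemma map_mpoly_deriv (K L : fieldType) (iota : {rmorphism K -> L}) n
    (p : {mpoly K[n]}) i : map_mpoly iota p^`M(i) = (map_mpoly iota p)^`M(i).
Proof.
by apply/mpolyP => m; rewrite mcoeff_deriv !mcoeff_map_mpoly /= mcoeff_deriv raddfMn.
Qed.

Lemma lbrel_map (K L : fieldType) (iota : {rmorphism K -> L}) (alpha : K) n
    (f g : {mpoly K[n]}) :
  lbrel alpha f g -> lbrel (iota alpha) (map_mpoly iota f) (map_mpoly iota g).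
Proof.
move=> [G [H E]]; exists (fun i j => map_mpoly iota (G i j)); split.
  move=> i j ij; have /= := congr1 (map_mpoly iota) (H i j ij).
  by rewrite !rmorphM rmorphB rmorphD !rmorphB !rmorphM /= !map_mpolyX !map_mpoly_deriv.
rewrite -map_mpolyZ -E rmorphD /= map_mpolyZ !rmorph_sum /=.
congr (_ *: _ + _); apply: eq_bigr => i _; last by rewrite rmorph_sum.
by rewrite rmorphM rmorphXn /= map_mpolyX !map_mpoly_deriv.
Qed.

Section PaperOperators.
Variables (K : fieldType) (alpha a b c : K).

Lemma pair_quotient (L : fieldType) (d s y z : L) : d != 0 ->
  d * (s / d * y + s / - d * z) = s * (y - z).
Proof. by move=> d0; field; rewrite oppr_eq0 d0. Qed.

(** The ordered pairs (i, j) and (j, i) have opposite denominators and together give the polynomial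
    quotient G i j, so the rational double sum is a polynomial. *)
Lemma Mop_lbrel n (f g : {mpoly K[n]}) : alpha != 0 -> lbrel alpha f g ->
  Mop alpha a b f = (g + (a + b + 1) *: euler f + (n%:R * (a * b)) *: f)%:F.
Proof.
move=> a0 [G [H E]]; rewrite /Mop.
have XX (i j : 'I_n) : (i < j)%N -> 'X_i - 'X_j != 0 :> {mpoly K[n]}.
  move=> ij; rewrite subr_eq0; apply/eqP => /(congr1 (fun q => q@_U_(i)%MM)).
  rewrite !mcoeffXU eqxx; case: eqP => [E'|_] /eqP; last by rewrite oner_eq0.
  by move: ij; rewrite E' ltnn.
have -> : \sum_(i < n) \sum_(j < n | j != i)
     ('X_i + 'X_j)%:F / ('X_i - 'X_j)%:F * ('X_i * f^`M(i))%:F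
   = (\sum_(i < n) \sum_(j < n | (i < j)%N) G i j)%:F.
  pose A (i j : 'I_n) : {fraction {mpoly K[n]}} :=
    ('X_i + 'X_j)%:F / ('X_i - 'X_j)%:F * ('X_i * f^`M(i))%:F.
  have splitA (i : 'I_n) : \sum_(j < n | j != i) A i j =
      \sum_(j < n | (i < j)%N) A i j + \sum_(j < n | (j < i)%N) A i j.
    rewrite (bigID (fun j : 'I_n => (i < j)%N)) /=; congr (_ + _); apply: eq_bigl => j;
    rewrite -(inj_eq val_inj) /=; lia.
  rewrite (eq_bigr _ (fun i _ => splitA i)) big_split /=.
  rewrite [X in _ + X](exchange_big_dep xpredT) //= -big_split /= rmorph_sum.
  apply: eq_bigr => i _; rewrite rmorph_sum /=.
  rewrite -big_split /=; apply: eq_bigr => j ij; rewrite /A.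
  have D0 : ('X_i - 'X_j)%:F != 0 :> {fraction {mpoly K[n]}}.
    by rewrite tofrac_eq0 XX.
  have E' : ('X_j - 'X_i)%:F = - ('X_i - 'X_j)%:F :> {fraction {mpoly K[n]}}.
    by rewrite -tofracN opprB.
  apply: (mulfI D0); rewrite -[in RHS]tofracM H // ['X_j + _]addrC E' pair_quotient //.
  by rewrite -tofracB -tofracM.
rewrite -tofracM -tofracD mul_mpolyC; congr (_ %:F).
have {E} -> : \sum_(i < n) \sum_(j < n | (i < j)%N) G i j =
    alpha *: g - alpha *: (\sum_(i < n) 'X_i ^+ 2 * f^`M(i)^`M(i)).
  by rewrite -E addrC addKr.
rewrite scalerBr !scalerA mulVf // !scale1r !big_split /= -scaler_sumr sumr_const.
rewrite card_ord -scaler_nat scalerA /euler /eul; ring.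
Qed.

Definition translation n (p : {mpoly K[n]}) := \sum_(i < n) p^`M(i).

(** [translation p] is homogeneous of degree d, and the Euler operator acts on it as the scalar
    d. *)
Lemma Lop_dhomog n (p : {mpoly K[n]}) d : p \is d.+1.-homog ->
  Lop c p = (c + d%:R) *: translation p.
Proof.
move=> hp; rewrite /Lop -/(translation p) scalerDl; congr (_ + _).
rewrite -[LHS]/(euler (translation p)); apply: euler_dhomog.
apply: rpred_sum => i _; apply/dhomogP => m; rewrite mcoeff_msupp mcoeff_deriv => h.
have : (m + U_(i))%MM \in msupp p.
  by rewrite mcoeff_msupp; apply: contraNneq h => ->; rewrite mul0rn.
by move/(dhomog_mf hp); rewrite /= mdegD mdeg1 addn1 => -[].
Qed.

End PaperOperators.

(** * Symmetric series killed by the translation operator *)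

Section TranslationKernel.
Variables (K : fieldType) (n : nat) (F : fps K n).
Hypothesis char0 : forall k : nat, k.+1%:R != 0 :> K.
Hypothesis Fsym : forall e e' : 'X_{1..n}, perm_eq e e' -> F e = F e'.

Lemma ext_multinomE (m : nat) (e : 'X_{1..m}) : (m <= n)%N ->
  [multinom nth 0%N e i | i < n] = e ++ nseq (n - m) 0%N :> seq nat.
Proof.
move=> mn; have sz : size (e ++ nseq (n - m) 0%N) = n.
  by rewrite size_cat size_nseq size_tuple subnKC.
apply: (@eq_from_nth _ 0%N); first by rewrite size_tuple sz.
rewrite size_tuple => i i_n; rewrite -[LHS](mnm_nth 0%N _ (Ordinal i_n)) mnmE nth_cat.
rewrite size_tuple nth_nseq; case: ltnP => // mi; rewrite nth_default ?size_tuple //.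
by case: ifP.
Qed.

(** Induction on the number of nonzero exponents. By symmetry the nonzero exponents may be moved to
    the front, and the equation in exactly that many variables is used. *)
Lemma translation_kernel_deg d :
    (forall (m : nat) (e : 'X_{1..m}), (1 <= m <= n)%N -> mdeg e = d ->
       \sum_(i < m) (e i).+1%:R * fps_restrict m F (e + U_(i))%MM = 0) ->
  forall e : 'X_{1..n}, mdeg e = d.+1 -> F e = 0.
Proof.
move=> HF e; have [k] := ubnP (count (ltn 0) e); elim: k e => // k IHk e ek de.
set m := count (ltn 0) e in ek.
have szm : size [seq x <- e | (0 < x)%N] == m by rewrite size_filter.
have mn : (m <= n)%N by rewrite (leq_trans (count_size _ _)) // size_tuple.
pose e0 : 'X_{1..m} := [multinom Tuple szm].
have pe (e1 : 'X_{1..n}) (e2 : 'X_{1..m}) :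
    perm_eq [seq x <- e1 | (0 < x)%N] e2 -> count (ltn 0) e1 = m ->
    F e1 = fps_restrict m F e2.
  move=> p c1; apply: Fsym; rewrite ext_multinomE //.
  rewrite -(perm_cat2r (nseq (n - m) 0%N)) in p; apply: perm_trans p.
  rewrite -(perm_filterC (ltn 0)) perm_cat2l.
  set s := [seq _ <- _ | _].
  have /all_pred1P -> : all (pred1 0%N) s.
    by apply/allP => x; rewrite mem_filter /= -leqNgt leqn0 => /andP[].
  have -> : size s = (n - m)%N; last by [].
  have := count_predC (ltn 0) e1; rewrite c1 size_tuple => <-.
  by rewrite size_filter addKn.
have cpos (e2 : 'X_{1..m}) : (forall i, 0 < e2 i)%N -> [seq x <- e2 | (0 < x)%N] = e2.
  move=> h; apply/all_filterP/(all_nthP 0%N) => i; rewrite size_tuple => im.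
  by have := h (Ordinal im); rewrite (mnm_nth 0%N).
have dext (e2 : 'X_{1..m}) : mdeg [multinom nth 0%N e2 i | i < n] = mdeg e2.
  by rewrite /mdeg ext_multinomE // big_cat /= [X in (_ + X)%N]big1_seq ?addn0 //
     => i; rewrite mem_nseq => /andP[_ /andP[_ /eqP]].
have fext (e2 : 'X_{1..m}) : [seq x <- [multinom nth 0%N e2 i | i < n] | (0 < x)%N]
   = [seq x <- e2 | (0 < x)%N].
  by rewrite ext_multinomE // filter_cat (_ : [seq x <- nseq _ _ | _] = [::])
     ?cats0 //; elim: (n - m)%N.
have e0pos i : (0 < e0 i)%N.
  rewrite (mnm_nth 0%N) /=.
  have : nth 0%N [seq x <- e | (0 < x)%N] i \in [seq x <- e | (0 < x)%N].
    by rewrite mem_nth // (eqP szm).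
  by rewrite mem_filter => /andP[].
have de0 : mdeg e0 = d.+1.
  rewrite -de /mdeg /= big_filter [RHS](bigID (ltn 0)) /=.
  by rewrite [X in (_ = _ + X)%N]big1 ?addn0 // => i; rewrite -leqNgt leqn0 => /eqP.
rewrite (pe e e0) //.
have m_gt0 : (0 < m)%N.
  rewrite lt0n; apply: contra_eqN de0 => /eqP m0; rewrite mdegE big1 // => -[j jm].
  by exfalso; move: jm; rewrite m0.
pose i0 := Ordinal m_gt0.
have [l] := ubnP (e0 i0); move: e0pos de0.
elim: l (e0) => // l IHl {}e0 e0pos de0 el.
have U0 : (U_(i0) <= e0)%MM by rewrite lep1mP -lt0n.
have deg1 : mdeg (e0 - U_(i0))%MM = d.
  by apply/eqP; rewrite -(eqn_add2r 1) -[X in (_ + X)%N](mdeg1 i0) -mdegD submK // de0 addn1.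
have mrange : (1 <= m <= n)%N by rewrite m_gt0.
(* In this coefficient the term i = i0 is a nonzero multiple of F at e0. Every other term has a
   smaller first exponent, either still positive (inner induction) or zero, and then with fewer
   nonzero exponents (outer induction). *)
have := HF m (e0 - U_(i0))%MM mrange deg1.
rewrite (bigD1 i0) //= submK // big1 ?addr0 => [/eqP|i ii0].
  by rewrite mulf_eq0 (negPf (char0 _)) => /eqP.
set e1 := (_ + U_(i))%MM.
have de1 : mdeg e1 = d.+1 by rewrite mdegD mdeg1 deg1 addn1.
have e1E j : e1 j = (e0 j - (i0 == j) + (i == j))%N by rewrite mnmDE mnmBE !mnm1E.
case: (posnP (e1 i0)) => [z|p].
  rewrite [X in _ * X]IHk ?mulr0 //; last by rewrite dext.
  rewrite -(size_filter (ltn 0)) fext size_filter.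
  have sz1 : size e1 = m by rewrite size_tuple.
  have lt1 : (count (ltn 0) e1 < m)%N.
    rewrite ltn_neqAle; apply/andP; split; last by rewrite -[X in (_ <= X)%N]sz1 count_size.
    apply/negP => /eqP c1; have : all (ltn 0) e1 by rewrite all_count c1 sz1.
    by move/(all_nthP 0%N)/(_ i0); rewrite sz1 -mnm_nth z => /(_ m_gt0).
  by apply: leq_trans lt1 _.
rewrite IHl ?mulr0 // => [j|].
  case: (eqVneq j i0) => [->//|ji]; rewrite e1E eq_sym (negPf ji) subn0.
  exact: leq_trans (e0pos j) (leq_addr _ _).
rewrite e1E eqxx (negPf ii0) addn0; have := e0pos i0; move: el; lia.
Qed.

End TranslationKernel.

(** * Symmetric functions as polynomials in the power sums *)

Lemma mnm_rec n (P : 'X_{1..n} -> Prop) : P 0%MM ->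
  (forall i m, P m -> P (U_(i) + m)%MM) -> forall m, P m.
Proof.
move=> P0 PS m; have [k] := ubnP (mdeg m); elim: k m => // k IH m mk.
case: (eqVneq m 0%MM) => [->//|m0].
have /existsP[i mi] : [exists i, m i != 0%N].
  apply: contraNT m0 => /existsPn h; apply/eqP/mnmP => i; rewrite mnm0E.
  by apply/eqP; have := h i; rewrite negbK.
have E : m = (U_(i) + (m - U_(i)))%MM by rewrite addmC submK // lep1mP.
rewrite E; apply: PS; apply: IH.
by move: mk (congr1 mdeg E); rewrite mdegD mdeg1; lia.
Qed.

Lemma sum_offdiag (V : zmodType) n (A : 'I_n -> 'I_n -> V) :
  \sum_(i < n) \sum_(j < n | (i < j)%N) (A i j + A j i)
    = \sum_(i < n) \sum_(j < n) A i j - \sum_(i < n) A i i.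
Proof.
have splitA (i : 'I_n) : \sum_(j < n) A i j = A i i +
    (\sum_(j < n | (i < j)%N) A i j + \sum_(j < n | (j < i)%N) A i j).
  rewrite (bigD1 i) //= (bigID (fun j : 'I_n => (i < j)%N)) /=.
  by congr (_ + (_ + _)); apply: eq_bigl => j; rewrite -(inj_eq val_inj) /=; lia.
rewrite (eq_bigr _ (fun i _ => splitA i)) big_split /= [RHS]addrC addKr.
rewrite [RHS]big_split /= [X in _ = _ + X](exchange_big_dep xpredT) //= -big_split /=.
by apply: eq_bigr => i _; rewrite big_split.
Qed.

Section PowerSums.
Variables (K : fieldType) (alpha : K) (D : nat).
Hypothesis char0 : forall k : nat, k.+1%:R != 0 :> K.

(* A polynomial in D variables stands for a symmetric function: X_r is the    *)
(* power sum p_(r+1), and [ev N] restricts to N variables.                    *)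
Fact ev_key : unit. Proof. exact: tt. Qed.
Definition ev N (F : {mpoly K[D]}) : {mpoly K[N]} :=
  locked_with ev_key (comp_mpoly [tuple psum K i.+1 N | i < D]) F.

Implicit Types (F G H : {mpoly K[D]}).

Lemma evE N F : ev N F = F \mPo [tuple psum K i.+1 N | i < D].
Proof. by rewrite /ev unlock. Qed.

Lemma evX N i : ev N 'X_i = psum K i.+1 N.
Proof. by rewrite evE comp_mpolyXU -tnth_nth tnth_mktuple. Qed.

Lemma evC N c : ev N c%:MP = c%:MP.
Proof. by rewrite evE comp_mpolyC. Qed.

Lemma evZ N c F : ev N (c *: F) = c *: ev N F.
Proof. by rewrite !evE comp_mpolyZ. Qed.

Lemma evD N F G : ev N (F + G) = ev N F + ev N G.
Proof. by rewrite !evE comp_mpolyD. Qed.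

Lemma evB N F G : ev N (F - G) = ev N F - ev N G.
Proof. by rewrite !evE comp_mpolyB. Qed.

Lemma evM N F G : ev N (F * G) = ev N F * ev N G.
Proof. by rewrite !evE rmorphM. Qed.

Lemma ev0 N : ev N 0 = 0.
Proof. by rewrite evE comp_mpoly0. Qed.

Lemma ev_sum N (I : Type) (s : seq I) (P : pred I) (E : I -> {mpoly K[D]}) :
  ev N (\sum_(i <- s | P i) E i) = \sum_(i <- s | P i) ev N (E i).
Proof. by elim/big_rec2: _ => [|i x F _ <-]; rewrite ?ev0 ?evD. Qed.

Lemma mderivXn N (i : 'I_N) r :
  ('X_i ^+ r.+1 : {mpoly K[N]})^`M(i) = r.+1%:R *: 'X_i ^+ r.
Proof.
rewrite mpolyXn mderivX mulmnE mnm1E eqxx mul1n mulmS addmC addmK.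
by rewrite mpolyXn.
Qed.

Lemma mderivXn_neq N (i j : 'I_N) r : i != j ->
  ('X_i ^+ r : {mpoly K[N]})^`M(j) = 0.
Proof. by move=> ij; rewrite mpolyXn mderivX mulmnE mnm1E (negPf ij) mul0n scale0r. Qed.

Lemma mderiv_psum N (i : 'I_N) r :
  (psum K r.+1 N)^`M(i) = r.+1%:R *: 'X_i ^+ r.
Proof.
rewrite /psum raddf_sum /= (bigD1 i) //= mderivXn big1 ?addr0 // => j ji.
by rewrite mderivXn_neq.
Qed.

(** Chain rule: the derivative of p_(r+1) in x_i is (r + 1) x_i^r. *)
Lemma ev_deriv N i F :
  (ev N F)^`M(i) = \sum_(r < D) r.+1%:R *: ('X_i ^+ r * ev N F^`M(r)).
Proof.
elim/mpolyind: F => [|c m F _ _ IH].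
  by rewrite ev0 mderiv0 big1 // => r _; rewrite mderiv0 ev0 mulr0 scaler0.
rewrite evD /= mderivD IH evZ mderivZ.
rewrite [in RHS](eq_bigr (fun r : 'I_D =>
  c *: (r.+1%:R *: ('X_i ^+ r * ev N 'X_[m]^`M(r)))
   + r.+1%:R *: ('X_i ^+ r * ev N F^`M(r)))); last first.
  move=> r _; rewrite mderivD mderivZ evD evZ mulrDr scalerDr.
  by rewrite -scalerAr !scalerA mulrC.
rewrite big_split /= -scaler_sumr; congr (_ *: _ + _) => {c F IH}.
elim/mnm_rec: m => [|s m IH].
  rewrite mpolyX0 -mpolyC1 evC mderivC big1 // => r _.
  by rewrite mderivC ev0 mulr0 scaler0.
rewrite mpolyXD evM mderivM IH evX mderiv_psum.
rewrite [in RHS](eq_bigr (fun r : 'I_D => (r == s)%:R *: (r.+1%:R *: 'X_i ^+ r * ev N 'X_[m])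
   + psum K s.+1 N * (r.+1%:R *: ('X_i ^+ r * ev N 'X_[m]^`M(r))))); last first.
  move=> r _; rewrite mderivM evD evM evX mulrDr scalerDr; congr (_ + _); last first.
    by rewrite -!scalerAr mulrCA.
  rewrite mderivX mnm1E eq_sym; case: eqP => [->|_]; last first.
    by rewrite !scale0r mul0r ev0 mulr0 scaler0.
  by rewrite !scale1r -[X in (X - _)%MM]add0m addmK mpolyX0 mul1r scalerAl.
rewrite big_split /= -mulr_sumr; congr (_ + _).
by rewrite (bigD1 s) //= eqxx scale1r big1 ?addr0 // => r /negPf->; rewrite scale0r.
Qed.

Lemma ev_eul N i F :
  eul i (ev N F) = \sum_(r < D) r.+1%:R *: ('X_i ^+ r.+1 * ev N F^`M(r)).
Proof.
rewrite /eul ev_deriv mulr_sumr; apply: eq_bigr => r _.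
by rewrite -scalerAr mulrA exprS.
Qed.

(** Algebraic independence of the power sums, by induction on the degree. If F evaluates to 0, then
    by [ev_deriv] a one-variable polynomial of degree less than D, whose coefficients are multiples
    of the evaluated derivatives of F, has the N distinct roots x_1, ..., x_N. So the derivatives of
    F vanish and F is constant. *)
Lemma ev_inj N F : (D <= N)%N -> ev N F = 0 -> F = 0.
Proof.
move=> DN; have [k] : exists k, forall m, (k <= mdeg m)%N -> F@_m = 0.
  by exists (msize F) => m h; apply/memN_msupp_eq0/msize_mdeg_ge.
elim: k F => [|k IH] F Fk F0; first by apply/mpolyP => m; rewrite Fk // mcoeff0.
have dF0 (r : 'I_D) : F^`M(r) = 0.
  apply: IH => [m km|].
    by rewrite mcoeff_deriv Fk ?mul0rn // mdegD mdeg1 addn1.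
  pose P : {poly {mpoly K[N]}} := \poly_(s < D) (if insub s is Some s' then
    s.+1%:R *: ev N F^`M(s') else 0).
  have PE (s : 'I_D) : P`_s = s.+1%:R *: ev N F^`M(s) by rewrite coef_poly ltn_ord valK.
  have P0 : P = 0.
    apply: (@roots_geq_poly_eq0 _ _ [seq 'X_i | i <- enum 'I_N]).
    - apply/allP => _ /mapP[i _ ->]; apply/eqP.
      have := ev_deriv i F; rewrite F0 mderiv0 (horner_coef_wide _ (size_poly _ _)) => Z.
      rewrite [RHS]Z.
      by apply: eq_bigr => s _; rewrite PE -scalerAl mulrC.
    - rewrite map_inj_uniq ?enum_uniq // => i j /(congr1 (fun p => p@_U_(i)%MM)).
      rewrite !mcoeffXU eqxx; case: eqP => [->//|_] /eqP; by rewrite oner_eq0.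
    - by rewrite size_map -cardE card_ord (leq_trans (size_poly _ _)).
  have := PE r; rewrite P0 coef0 => /esym/eqP.
  by rewrite mscalerI (negPf (char0 _)) => /eqP.
have FC : F = (F@_0)%:MP.
  apply/mpolyP => m; rewrite mcoeffC; case: (eqVneq m 0%MM) => [->|m0]; first by rewrite mulr1.
  have /existsP[i mi] : [exists i, m i != 0%N].
    apply: contraNT m0 => /existsPn h; apply/eqP/mnmP => i; rewrite mnm0E.
    by apply/eqP; have := h i; rewrite negbK.
  have := congr1 (fun p => p@_(m - U_(i))%MM) (dF0 i).
  rewrite mcoeff_deriv submK ?lep1mP // mcoeff0 mulr0 -mulr_natr => /eqP.
  by rewrite mulf_eq0 (negPf (char0 _)) orbF => /eqP.
by move: F0; rewrite FC evC => /eqP; rewrite mpolyC_eq0 => /eqP->.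
Qed.

Lemma psum_sym r N : psum K r N \is symmetric.
Proof.
apply/issymP => s; rewrite /psum raddf_sum /= [RHS](reindex_inj (@perm_inj _ s)) /=.
apply: eq_bigr => i _; rewrite rmorphXn /= msymX; congr (_ ^+ _); congr mpolyX.
apply/mnmP => j; rewrite mnmE !mnm1E; congr (nat_of_bool _).
by rewrite -(inj_eq (@perm_inj _ s)) permKV.
Qed.

Lemma ev_sym N F : ev N F \is symmetric.
Proof.
by rewrite evE; apply: mcomp_sym => i; rewrite -tnth_nth tnth_mktuple psum_sym.
Qed.

Lemma psum_dhomog r N : psum K r N \is r.-homog.
Proof.
apply: rpred_sum => i _; rewrite mpolyXn dhomogX.
by rewrite /= mdegMn mdeg1 mul1n.
Qed.

Lemma ev_dhomog N d F : F \is d.-homog for mnmwgt -> ev N F \is d.-homog.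
Proof.
move=> /dhomogP hF; rewrite evE comp_mpolyEX.
rewrite big_seq; apply: rpred_sum => m mF; apply: rpredZ; rewrite comp_mpolyX -(hF _ mF) /=.
rewrite /mnmwgt; elim/big_ind2: _ => [|p d1 q d2 h1 h2|i _].
- exact: dhomog1.
- exact: dhomogM.
- by rewrite tnth_mktuple mulnC; apply: dhomogMn; exact: psum_dhomog.
Qed.

End PowerSums.

(** * The Jack product and the Laplace-Beltrami operator in the power sums *)

Section JackOperator.
Variables (K : fieldType) (alpha : K) (D' : nat).
Hypothesis alpha_neq0 : alpha != 0.
Local Notation D := D'.+1.
Implicit Types (F G H : {mpoly K[D]}).

(* z_rho alpha^(plength rho), where m_i is the number of parts of rho equal   *)
(* to i + 1.                                                                  *)
Definition pweight (m : 'X_{1..D}) : K :=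
  \prod_(i < D) ((i.+1%:R * alpha) ^+ m i * (m i)`!%:R).

(** The Jack scalar product, for which the monomials in the power sums are orthogonal. *)
Definition form F G : K := \sum_(m <- msupp F) F@_m * G@_m * pweight m.

Lemma formE k F G : (msize F <= k)%N ->
  form F G = \sum_(m : 'X_{1..D < k}) F@_m * G@_m * pweight m.
Proof.
pose I : subFinType _ := 'X_{1..D < k}.
move=> Fk; rewrite /form (big_mksub I) /=; first last.
- by move=> m mF; apply: leq_trans Fk; exact: msize_mdeg_lt.
- exact: msupp_uniq.
by rewrite big_rmcond //= => m /memN_msupp_eq0 ->; rewrite !mul0r.
Qed.

Lemma formC F G : form F G = form G F.
Proof.
rewrite (formE _ (leq_maxl (msize F) (msize G))) (formE _ (leq_maxr (msize F) (msize G))).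
by apply: eq_bigr => m _; rewrite [F@_m * _]mulrC.
Qed.

Lemma formDl F1 F2 G : form (F1 + F2) G = form F1 G + form F2 G.
Proof.
pose k := maxn (msize (F1 + F2)) (maxn (msize F1) (msize F2)).
rewrite !(@formE k) ?leq_max ?leqnn ?orbT //; rewrite -big_split /=.
by apply: eq_bigr => m _; rewrite mcoeffD !mulrDl.
Qed.

Lemma formZl c F G : form (c *: F) G = c * form F G.
Proof.
pose k := maxn (msize (c *: F)) (msize F).
rewrite !(@formE k) ?leq_max ?leqnn ?orbT //; rewrite mulr_sumr.
by apply: eq_bigr => m _; rewrite mcoeffZ !mulrA.
Qed.

Lemma form0l G : form 0 G = 0.
Proof. by rewrite -(scale0r (0 : {mpoly K[D]})) formZl mul0r. Qed.

Lemma formDr F G1 G2 : form F (G1 + G2) = form F G1 + form F G2.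
Proof. by rewrite !(formC F) formDl. Qed.

Lemma formZr c F G : form F (c *: G) = c * form F G.
Proof. by rewrite !(formC F) formZl. Qed.

Lemma form0r G : form G 0 = 0.
Proof. by rewrite formC form0l. Qed.

Lemma form_suml (I : Type) (s : seq I) (P : pred I) (E : I -> {mpoly K[D]}) G :
  form (\sum_(i <- s | P i) E i) G = \sum_(i <- s | P i) form (E i) G.
Proof. by elim/big_rec2: _ => [|i x F _ <-]; rewrite ?form0l ?formDl. Qed.

Lemma form_sumr (I : Type) (s : seq I) (P : pred I) (E : I -> {mpoly K[D]}) G :
  form G (\sum_(i <- s | P i) E i) = \sum_(i <- s | P i) form G (E i).
Proof. by rewrite formC form_suml; apply: eq_bigr => i _; rewrite formC. Qed.

Lemma form_mnm m G : form 'X_[m] G = G@_m * pweight m.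
Proof. by rewrite /form msuppX big_seq1 mcoeffX eqxx mul1r. Qed.

Lemma pweightU i m :
  pweight (U_(i) + m) = (i.+1%:R * alpha) * (m i).+1%:R * pweight m.
Proof.
rewrite /pweight (bigD1 i) //= [in RHS](bigD1 i) //=.
rewrite mnmDE mnm1E eqxx add1n exprS factS natrM.
rewrite (eq_bigr (fun j : 'I_D => (j.+1%:R * alpha) ^+ m j * (m j)`!%:R)); last first.
  by move=> j /negPf ji; rewrite mnmDE mnm1E eq_sym ji.
by ring.
Qed.

Lemma form_adj i F G : form ('X_i * F) G = i.+1%:R * alpha * form F G^`M(i).
Proof.
elim/mpolyind: F => [|c m F _ _ IH]; first by rewrite mulr0 !form0l mulr0.
rewrite mulrDr !formDl mulrDr IH -scalerAr !formZl -mpolyXD !form_mnm.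
by rewrite pweightU mcoeff_deriv addmC -mulr_natr; congr (_ + _); ring.
Qed.

(** Power sums and derivatives indexed by all naturals, 0 from index D on. In weight at most D the
    truncation loses nothing, since the derivatives in the discarded terms vanish there. *)
Definition pX (k : nat) : {mpoly K[D]} := if insub k is Some i then 'X_i else 0.
Definition pder (k : nat) F : {mpoly K[D]} :=
  if insub k is Some i then F^`M(i) else 0.

Lemma pXE (i : 'I_D) : pX i = 'X_i. Proof. by rewrite /pX valK. Qed.
Lemma pderE (i : 'I_D) F : pder i F = F^`M(i). Proof. by rewrite /pder valK. Qed.
Lemma pX_ge k : (D <= k)%N -> pX k = 0.
Proof. by move=> h; rewrite /pX insubF // ltnNge h. Qed.
Lemma pder_ge k F : (D <= k)%N -> pder k F = 0.
Proof. by move=> h; rewrite /pder insubF // ltnNge h. Qed.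

Lemma form_padj k F G : form (pX k * F) G = k.+1%:R * alpha * form F (pder k G).
Proof.
case: (ltnP k D) => kD; first by rewrite (pXE (Ordinal kD)) (pderE (Ordinal kD)) form_adj.
by rewrite pX_ge // pder_ge // mul0r form0l form0r mulr0.
Qed.

Definition jackop_split F := \sum_(r < D) \sum_(s < D)
  (r.+1 * s.+1)%:R *: (pX (r + s).+1 * F^`M(r)^`M(s)).
Definition jackop_diag F := \sum_(r < D) (r.+1 * r)%:R *: ('X_r * F^`M(r)).
Definition jackop_join F := \sum_(r < D) \sum_(s < D)
  (r + s).+2%:R *: ('X_r * 'X_s * pder (r + s).+1 F).

(* The Laplace-Beltrami operator in the power sums, with the terms that       *)
(* depend on the number of variables removed.                                 *)
Definition jackop F : {mpoly K[D]} :=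
  jackop_split F + (1 - alpha^-1) *: jackop_diag F + alpha^-1 *: jackop_join F.

Lemma pderZ k c F : pder k (c *: F) = c *: pder k F.
Proof. by rewrite /pder; case: insub => [i|]; rewrite ?mderivZ ?scaler0. Qed.
Lemma pderD k F G : pder k (F + G) = pder k F + pder k G.
Proof. by rewrite /pder; case: insub => [i|]; rewrite ?mderivD ?addr0. Qed.

Lemma jackopZ c F : jackop (c *: F) = c *: jackop F.
Proof.
have E1 : jackop_split (c *: F) = c *: jackop_split F.
  rewrite /jackop_split scaler_sumr; apply: eq_bigr => r _.
  rewrite scaler_sumr; apply: eq_bigr => s _.
  by rewrite !mderivZ -scalerAr !scalerA mulrC.
have E2 : jackop_diag (c *: F) = c *: jackop_diag F.
  rewrite /jackop_diag scaler_sumr; apply: eq_bigr => r _.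
  by rewrite !mderivZ -scalerAr !scalerA mulrC.
have E3 : jackop_join (c *: F) = c *: jackop_join F.
  rewrite /jackop_join scaler_sumr; apply: eq_bigr => r _.
  rewrite scaler_sumr; apply: eq_bigr => s _.
  by rewrite pderZ -scalerAr !scalerA mulrC.
by rewrite /jackop E1 E2 E3 !scalerDr !scalerA ![c * _]mulrC.
Qed.

Lemma jackopD F G : jackop (F + G) = jackop F + jackop G.
Proof.
have E1 : jackop_split (F + G) = jackop_split F + jackop_split G.
  rewrite /jackop_split -big_split; apply: eq_bigr => r _.
  rewrite -big_split; apply: eq_bigr => s _.
  by rewrite !mderivD mulrDr scalerDr.
have E2 : jackop_diag (F + G) = jackop_diag F + jackop_diag G.
  rewrite /jackop_diag -big_split; apply: eq_bigr => r _.
  by rewrite !mderivD mulrDr scalerDr.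
have E3 : jackop_join (F + G) = jackop_join F + jackop_join G.
  rewrite /jackop_join -big_split; apply: eq_bigr => r _.
  rewrite -big_split; apply: eq_bigr => s _.
  by rewrite pderD mulrDr scalerDr.
by rewrite /jackop E1 E2 E3 !scalerDr [RHS]addrACA; congr (_ + _); rewrite addrACA.
Qed.

Lemma jackop0 : jackop 0 = 0.
Proof. by rewrite -(scale0r (0 : {mpoly K[D]})) jackopZ !scale0r. Qed.

Lemma jackop_sum (I : Type) (s : seq I) (P : pred I) (E : I -> {mpoly K[D]}) :
  jackop (\sum_(i <- s | P i) E i) = \sum_(i <- s | P i) jackop (E i).
Proof. by elim/big_rec2: _ => [|i x F _ <-]; rewrite ?jackop0 ?jackopD. Qed.

(** Each multiplication by p_k moves across as k alpha d/dp_k. Splitting has one multiplication and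
    two derivatives, joining two multiplications and one derivative, which leaves a factor 1 /
    alpha. *)
Lemma jackop_split_join F G : form (jackop_split F) G = alpha^-1 * form F (jackop_join G).
Proof.
rewrite /jackop_split /jackop_join form_suml form_sumr mulr_sumr; apply: eq_bigr => r _.
rewrite form_suml form_sumr mulr_sumr; apply: eq_bigr => s _.
rewrite formZl formZr form_padj [form F _]formC -[_ * _ * pder _ _]mulrA !form_adj.
rewrite [form (pder _ _) _]formC natrM mderiv_comm.
by field.
Qed.

Lemma jackop_diag_sym F G : form (jackop_diag F) G = form F (jackop_diag G).
Proof.
rewrite /jackop_diag form_suml form_sumr; apply: eq_bigr => r _.
by rewrite formZl formZr form_adj [in RHS]formC form_adj formC.
Qed.

Lemma jackop_selfadj F G : form (jackop F) G = form F (jackop G).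
Proof.
rewrite /jackop !formDl !formDr !formZl !formZr jackop_diag_sym jackop_split_join.
have -> : form (jackop_join F) G = alpha * form F (jackop_split G).
  by rewrite [RHS]mulrC [form F _]formC jackop_split_join mulrAC mulVf // mul1r formC.
by rewrite mulrA mulVf // mul1r; ring.
Qed.

Lemma mderivXU (i j : 'I_D) : ('X_j : {mpoly K[D]})^`M(i) = (j == i)%:R%:MP.
Proof.
rewrite mderivX mnm1E; case: eqP => [->|_]; last by rewrite scale0r mpolyC0.
by rewrite scale1r -[X in (X - _)%MM]add0m addmK mpolyX0 mpolyC1.
Qed.

(** The part of the sum of the d/dx_i that does not depend on the number of variables, see
    [translation_ev]. *)
Definition lowerop F : {mpoly K[D]} := \sum_(s < D) s.+2%:R *: ('X_s * pder s.+1 F).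

(** Only joining effectively multiplies by p_1, once through r = 0 and once through s = 0, whence
    the factor 2. Splitting multiplies by p_2 and higher, and the diagonal coefficient (r + 1) r
    vanishes at r = 0. *)
Lemma mderiv_jackop F :
  (jackop F)^`M(ord0) = jackop F^`M(ord0) + (2%:R / alpha) *: lowerop F.
Proof.
have pd k : (pder k F)^`M(ord0) = pder k F^`M(ord0).
  by rewrite /pder; case: insub => [i|]; rewrite ?mderiv0 // mderiv_comm.
have E1 : (jackop_split F)^`M(ord0) = jackop_split F^`M(ord0).
  rewrite /jackop_split raddf_sum; apply: eq_bigr => r _.
  rewrite raddf_sum; apply: eq_bigr => s _.
  rewrite /= mderivZ mderivM /pX; case: insubP => [i _ iE|_]; last by rewrite mderiv0 !mul0r addr0.
  rewrite mderivXU (_ : i == ord0 = false); last by rewrite -(inj_eq val_inj) iE.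
  by rewrite mpolyC0 mul0r add0r [_^`M(s)^`M(ord0)]mderiv_comm [F^`M(r)^`M(ord0)]mderiv_comm.
have E2 : (jackop_diag F)^`M(ord0) = jackop_diag F^`M(ord0).
  rewrite /jackop_diag raddf_sum; apply: eq_bigr => r _ /=.
  rewrite mderivZ mderivM mderivXU; case: eqP => [->|_]; first by rewrite muln0 !scale0r.
  by rewrite mpolyC0 mul0r add0r mderiv_comm.
have E3 : (jackop_join F)^`M(ord0) = jackop_join F^`M(ord0) + 2%:R *: lowerop F.
  rewrite scaler_nat mulr2n {1}/lowerop addrA [RHS]addrAC /jackop_join raddf_sum /=.
  have Er (r : 'I_D) : (\sum_(s < D) (r + s).+2%:R *: ('X_r * 'X_s * pder (r + s).+1 F))^`M(ord0)
    = \sum_(s < D) (r + s).+2%:R *: ('X_r * 'X_s * pder (r + s).+1 F^`M(ord0))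
      + r.+2%:R *: ('X_r * pder r.+1 F)
      + (if r == ord0 then lowerop F else 0).
    rewrite raddf_sum /= (eq_bigr (fun s : 'I_D =>
       (r + s).+2%:R *: ('X_r * 'X_s * pder (r + s).+1 F^`M(ord0))
       + (s == ord0)%:R *: (r.+2%:R *: ('X_r * pder r.+1 F))
       + (r == ord0)%:R *: (s.+2%:R *: ('X_s * pder s.+1 F)))); last first.
      move=> s _; rewrite mderivZ !mderivM !mderivXU pd.
      case: (eqVneq s ord0) => [->|_]; case: (eqVneq r ord0) => [->|_];
      rewrite /= ?addn0 ?add0n -!mul_mpolyC ?mpolyC0 ?mpolyC1; ring.
    rewrite !big_split /= -!addrA; congr (_ + (_ + _)).
      by rewrite (bigD1 ord0) //= scale1r big1 ?addr0 // => s /negPf->; rewrite scale0r.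
    rewrite /lowerop; case: (r == ord0); last by rewrite big1 // => s _; rewrite scale0r.
    by apply: eq_bigr => s _; rewrite scale1r.
  rewrite (eq_bigr _ (fun r _ => Er r)) !big_split /= -!addrA; congr (_ + _).
  rewrite addrC; congr (_ + _).
  by rewrite (bigD1 ord0) //= big1 ?addr0 // => r /negPf->.
rewrite /jackop !mderivD !mderivZ E1 E2 E3 scalerDr scalerA [2%:R / _]mulrC.
by rewrite addrA.
Qed.

End JackOperator.

(** The substitution t = r + s + 1, k = s. *)
Lemma sum_triangle (V : zmodType) (D : nat) (A : nat -> nat -> V) :
  \sum_(t < D) \sum_(k < t) A t k
    = \sum_(r < D) \sum_(s < D | ((r + s).+1 < D)%N) A (r + s).+1 s.
Proof.
elim: D => [|D IH]; first by rewrite !big_ord0.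
rewrite big_ord_recr IH /= [in RHS]big_ord_recr /=.
rewrite [X in _ = _ + X]big1 ?addr0 => [|s]; last by rewrite ltnS; lia.
rewrite [in RHS](eq_bigr (fun r : 'I_D => \sum_(s < D | ((r + s).+1 < D)%N) A (r + s).+1 s
  + A D (D - r.+1)%N)); last first.
  move=> r _; have rD := ltn_ord r.
  have kD : (D - r.+1 < D.+1)%N by lia.
  rewrite (bigD1 (Ordinal kD)) /=; last by lia.
  rewrite addrC; congr (_ + A _ _); last by lia.
  rewrite big_mkcond big_ord_recr /= ifF ?addr0; last by lia.
  rewrite [RHS]big_mkcond; apply: eq_bigr => s _; rewrite -(inj_eq val_inj) /=.
  by congr (if _ then _ else _); lia.
rewrite big_split /=; congr (_ + _).
rewrite (reindex_inj rev_ord_inj); apply: eq_bigr => i _; congr (A _ _).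
Qed.

Section JackOperatorEval.
Variables (K : fieldType) (alpha : K) (D' : nat).
Hypothesis alpha_neq0 : alpha != 0.
Local Notation D := D'.+1.
Implicit Types (F G H : {mpoly K[D]}).
Local Notation ev := (@ev K D).
Local Notation jackop := (@jackop K alpha D').
Local Notation pX := (pX K D').
Local Notation "d .-wgt" := (d.-homog for mnmwgt) (at level 1).

Lemma deriv_wgt (r : 'I_D) d F : F \is (r.+1 + d).-wgt -> F^`M(r) \is d.-wgt.
Proof.
move=> hF; apply/dhomogP => m; rewrite mcoeff_msupp mcoeff_deriv => h.
have mF : (m + U_(r))%MM \in msupp F.
  by rewrite mcoeff_msupp; apply: contraNneq h => ->; rewrite mul0rn.
by have /= := dhomog_mf hF mF; rewrite mnmwgtD mnmwgt1 addnC => /addnI.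
Qed.

Lemma deriv_wgt_low (r : 'I_D) d F : (d < r.+1)%N -> F \is d.-wgt -> F^`M(r) = 0.
Proof.
move=> dr hF; apply/mpolyP => m; rewrite mcoeff0 mcoeff_deriv.
rewrite (dhomog_nemf_coeff hF) ?mul0rn //= mnmwgtD mnmwgt1.
by apply: contraTneq dr => <-; rewrite -leqNgt leq_addl.
Qed.

Lemma X_wgt (i : 'I_D) : ('X_i : {mpoly K[D]}) \is i.+1.-wgt.
Proof. by rewrite dhomogX /= mnmwgt1. Qed.

Lemma pX_wgt k : pX k \is k.+1.-wgt.
Proof.
rewrite /pX; case: insubP => [i _ <-|_]; first exact: X_wgt.
exact: dhomog0.
Qed.

Lemma jackop_wgt d F : F \is d.-wgt -> jackop F \is d.-wgt.
Proof.
move=> hF; rewrite /jackop; apply: rpredD; first apply: rpredD; last first.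
- apply: rpredZ; apply: rpred_sum => r _; apply: rpred_sum => s _; apply: rpredZ.
  rewrite /pder; case: insubP => [i _ iE|_]; last by rewrite mulr0 dhomog0.
  case: (ltnP d i.+1) => di; first by rewrite (deriv_wgt_low di hF) mulr0 dhomog0.
  have -> : d = ((r.+1 + s.+1) + (d - i.+1))%N by rewrite iE in di *; lia.
  apply: dhomogM; first by apply: dhomogM; exact: X_wgt.
  by apply: deriv_wgt; rewrite subnKC.
- apply: rpredZ; apply: rpred_sum => r _; apply: rpredZ.
  case: (ltnP d r.+1) => dr; first by rewrite (deriv_wgt_low dr hF) mulr0 dhomog0.
  rewrite -(subnKC dr); apply: dhomogM; first exact: X_wgt.
  by apply: deriv_wgt; rewrite subnKC.
apply: rpred_sum => r _; apply: rpred_sum => s _; apply: rpredZ.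
case: (ltnP d r.+1) => dr.
  by rewrite (deriv_wgt_low dr hF) mderiv0 mulr0 dhomog0.
rewrite -(subnKC dr) in hF *.
case: (ltnP (d - r.+1) s.+1) => ds.
  by rewrite (deriv_wgt_low ds (deriv_wgt hF)) mulr0 dhomog0.
have -> : (r.+1 + (d - r.+1) = (r + s).+2 + (d - r.+1 - s.+1))%N by lia.
apply: dhomogM; first exact: pX_wgt.
by apply: deriv_wgt; rewrite subnKC //; apply: deriv_wgt.
Qed.

Lemma ev_pX N k : (k < D)%N -> ev N (pX k) = psum K k.+1 N.
Proof. by move=> kD; rewrite (pXE _ (Ordinal kD)) evX. Qed.

(** Summing the chain rule over i turns x_i^r into p_r, and p_0 is the number N of variables. *)
Lemma translation_ev N F : translation (ev N F) =
  N%:R *: ev N F^`M(ord0) + ev N (lowerop F).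
Proof.
rewrite /translation (eq_bigr _ (fun i _ => ev_deriv i F)) exchange_big /=.
rewrite big_ord_recl; congr (_ + _).
  under eq_bigr do rewrite expr0 scale1r mul1r.
  by rewrite sumr_const card_ord scaler_nat.
rewrite /lowerop ev_sum /= [RHS]big_ord_recr /= pder_ge // mulr0 scaler0 ev0 addr0.
apply: eq_bigr => s _; rewrite evZ evM evX -scaler_sumr -mulr_suml.
by rewrite (pderE (lift ord0 s)).
Qed.

Lemma evB2 N F d : F \is d.-wgt -> (d <= D)%N ->
  \sum_(i < N) 'X_i ^+ 2 * (ev N F)^`M(i)^`M(i)
   = ev N (jackop_split F) + ev N (jackop_diag F).
Proof.
move=> hF dD.
have Ei (i : 'I_N) : 'X_i ^+ 2 * (ev N F)^`M(i)^`M(i) = \sum_(r < D) (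
    (r.+1 * r)%:R *: ('X_i ^+ r.+1 * ev N F^`M(r))
    + \sum_(s < D) (r.+1 * s.+1)%:R *: ('X_i ^+ (r + s).+2 * ev N F^`M(r)^`M(s))).
  rewrite eul2E {2}ev_eul ev_eul /eul raddf_sum /= mulr_sumr -sumrB.
  apply: eq_bigr => r _; rewrite mderivZ -scalerAr -/(eul i _) eulM.
  rewrite {1}/eul mderivXn -scalerAr -exprS ev_eul mulr_sumr !scalerDr addrAC.
  congr (_ + _).
    rewrite -scalerAl scalerA -scalerBl; congr (_ *: _).
    by rewrite natrM -natr1; ring.
  rewrite scaler_sumr; apply: eq_bigr => s _.
  by rewrite -scalerAr scalerA -natrM mulrA -exprD addSn addnS.
rewrite (eq_bigr _ (fun i _ => Ei i)) exchange_big /= [RHS]addrC.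
rewrite /jackop_split /jackop_diag !ev_sum -big_split /=; apply: eq_bigr => r _.
rewrite big_split /= exchange_big /=; congr (_ + _).
  by rewrite evZ evM evX -scaler_sumr -mulr_suml.
rewrite ev_sum; apply: eq_bigr => s _ /=.
rewrite evZ evM -scaler_sumr -mulr_suml.
(* When p_(r+s+2) lies beyond D, the double derivative is 0 because F has weight at most D. *)
case: (ltnP (r + s).+1 D) => rsD; first by rewrite ev_pX.
have -> : F^`M(r)^`M(s) = 0; last by rewrite ev0 !mulr0.
apply/mpolyP => m; rewrite !mcoeff_deriv mcoeff0 (dhomog_nemf_coeff hF) ?mul0rn //=.
by rewrite !mnmwgtD !mnmwgt1; apply: contraTneq rsD; lia.
Qed.

(** The inner sum is the quotient of x_i^(r+1) - x_j^(r+1) by x_i - x_j. Multiplied by x_i + x_j it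
    becomes U i j + U j i, so the sum over i < j is the full double sum minus the diagonal. *)
Lemma sum_ltn_quotients N (r : nat) :
  \sum_(i < N) \sum_(j < N | (i < j)%N)
     ('X_i + 'X_j) * (\sum_(k < r.+1) 'X_i ^+ (r - k) * 'X_j ^+ k)
   = (N%:R - r.+1%:R) *: psum K r.+1 N
     + \sum_(k < r) psum K (r - k) N * psum K k.+1 N.
Proof.
pose U (i j : 'I_N) : {mpoly K[N]} :=
  'X_i ^+ r.+1 + \sum_(k < r) 'X_i ^+ (r - k) * 'X_j ^+ k.+1.
have UE i j : 'X_i * (\sum_(k < r.+1) 'X_i ^+ (r - k) * 'X_j ^+ k) = U i j.
  rewrite mulr_sumr big_ord_recl /= subn0 mulr1 -exprS; congr (_ + _).
  apply: eq_bigr => k _; rewrite mulrA -exprS /bump /= add1n subnS.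
  by rewrite prednK // subn_gt0.
have EU (i j : 'I_N) :
    ('X_i + 'X_j) * (\sum_(k < r.+1) 'X_i ^+ (r - k) * 'X_j ^+ k) = U i j + U j i.
  rewrite mulrDl UE -UE; congr (_ + _); rewrite -UE; congr (_ * _).
  rewrite (reindex_inj rev_ord_inj) /=; apply: eq_bigr => k _.
  by rewrite subSS subKn 1?mulrC // -ltnS.
under eq_bigr do under eq_bigr do rewrite EU.
rewrite sum_offdiag.
have -> : \sum_(i < N) U i i = r.+1%:R *: psum K r.+1 N.
  rewrite /psum scaler_sumr; apply: eq_bigr => i _; rewrite /U.
  rewrite (eq_bigr (fun=> 'X_i ^+ r.+1)); last first.
    by move=> k _; rewrite -exprD addnS subnK // ltnW.
  by rewrite sumr_const card_ord scaler_nat mulrS.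
have -> : \sum_(i < N) \sum_(j < N) U i j = N%:R *: psum K r.+1 N
     + \sum_(k < r) psum K (r - k) N * psum K k.+1 N.
  under eq_bigr do rewrite big_split /= sumr_const card_ord exchange_big /=.
  rewrite big_split /= sumrMnl scaler_nat /psum; congr (_ + _).
  rewrite exchange_big /=; apply: eq_bigr => k _; rewrite mulr_suml.
  by apply: eq_bigr => i _; rewrite mulr_sumr.
by rewrite scalerBl addrAC.
Qed.

(** By the chain rule the quotients are combinations of those summed in [sum_ltn_quotients]. The
    number N of variables survives only in front of the Euler operator, so [jackop] is free of
    it. *)
Lemma lbrel_ev N d F : F \is d.-wgt -> (d <= D)%N ->
  lbrel alpha (ev N F) (ev N (jackop F) + (alpha^-1 * (N%:R - 1)) *: euler (ev N F)).
Proof.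
move=> hF dD.
exists (fun i j => \sum_(r < D) r.+1%:R *: ((('X_i + 'X_j) *
   (\sum_(k < r.+1) 'X_i ^+ (r - k) * 'X_j ^+ k)) * ev N F^`M(r))); split.
  move=> i j _; rewrite !ev_eul -sumrB !mulr_sumr; apply: eq_bigr => r _.
  rewrite -scalerBr -mulrBl -!scalerAr subrXX; congr (_ *: _).
  by rewrite /=; ring.
rewrite (evB2 N hF dD).
have -> : \sum_(i < N) \sum_(j < N | (i < j)%N) \sum_(r < D) r.+1%:R *: ((('X_i + 'X_j) *
   (\sum_(k < r.+1) 'X_i ^+ (r - k) * 'X_j ^+ k)) * ev N F^`M(r))
  = (N%:R - 1) *: euler (ev N F) - ev N (jackop_diag F) + ev N (jackop_join F).
  transitivity (\sum_(r < D) r.+1%:R *: (((N%:R - r.+1%:R) *: psum K r.+1 N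
     + \sum_(k < r) psum K (r - k) N * psum K k.+1 N) * ev N F^`M(r))).
    under eq_bigr do rewrite exchange_big /=.
    rewrite exchange_big /=; apply: eq_bigr => r _; rewrite -sum_ltn_quotients.
    rewrite mulr_suml scaler_sumr; apply: eq_bigr => i _.
    by rewrite mulr_suml scaler_sumr.
  under eq_bigr do rewrite mulrDl scalerDr.
  rewrite big_split /=; congr (_ + _).
    rewrite /euler (eq_bigr _ (fun i _ => ev_eul i F)) exchange_big /=.
    rewrite scaler_sumr /jackop_diag ev_sum -sumrB; apply: eq_bigr => r _ /=.
    rewrite evZ evM evX -scaler_sumr -mulr_suml -/(psum K r.+1 N) -scalerAl !scalerA.
    by rewrite -scalerBl natrM -natr1; congr (_ *: _); ring.
  rewrite /jackop_join ev_sum /=.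
  transitivity (\sum_(t < D) \sum_(k < t) t.+1%:R *: (psum K (t - k) N * psum K k.+1 N
     * ev N (pder t F))).
    apply: eq_bigr => r _; rewrite mulr_suml scaler_sumr pderE.
    by apply: eq_bigr.
  rewrite (sum_triangle D (fun t k => t.+1%:R *: (psum K (t - k) N * psum K k.+1 N
     * ev N (pder t F)))).
  apply: eq_bigr => r _; rewrite big_mkcond ev_sum; apply: eq_bigr => s _ /=.
  rewrite evZ !evM !evX; case: ltnP => rsD; first by rewrite subSn ?leq_addl // addnK.
  by rewrite pder_ge // ev0 mulr0 scaler0.
rewrite /jackop !evD !evZ !scalerDr !scalerA mulrA divff // mul1r mulrBr mulr1 divff //.
by rewrite -!mul_mpolyC mpolyCB mpolyC1; ring.
Qed.

End JackOperatorEval.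

(** * Setting the last variable to zero, and coefficients of powers of p_1 *)

Lemma mcoeffXm (K : comNzRingType) n (k m : 'X_{1..n}) (p : {mpoly K[n]}) :
  ('X_[k] * p)@_m = if (k <= m)%MM then p@_(m - k) else 0.
Proof.
case: ifPn => [km|]; first by rewrite mulrC -{1}(submK km) addmC mcoeffMX.
move=> km; rewrite mcoeffM big1 // => -[k1 k2] /eqP E /=; rewrite mcoeffX.
case: eqP => [Ek|]; last by rewrite mul0r.
by case/negP: km; rewrite (E : m = _) /= Ek lem_addr.
Qed.

Definition ones n : 'X_{1..n} := [multinom 1%N | i < n].

Lemma prodXE (K : fieldType) n : prodX K n = 'X_[ones n].
Proof.
rewrite /prodX mprodXE; congr mpolyX; apply/mnmP => i.
rewrite mnm_sumE mnmE (bigD1 i) //= mnm1E eqxx big1 // => j /negPf ji.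
by rewrite mnm1E ji.
Qed.

Lemma lift_max_widen n (j : 'I_n) : lift ord_max j = widen_ord (leqnSn n) j.
Proof. by apply: val_inj; exact: lift_max. Qed.

Section Restriction.
Variables (K : fieldType) (n : nat).

Fact restr_key : unit. Proof. exact: tt. Qed.
(** The substitution x_(n+1) = 0: [insub] fails exactly on the last index. *)
Definition restr (p : {mpoly K[n.+1]}) : {mpoly K[n]} := locked_with restr_key
  (comp_mpoly [tuple oapp (fun j : 'I_n => 'X_j) 0 (insub (val i)) | i < n.+1]) p.

Lemma mcoeff_restr p m : (restr p)@_m = p@_(mnmwiden m).
Proof.
rewrite /restr unlock comp_mpolyEX raddf_sum /= [p in RHS]mpolyE raddf_sum /=.
apply: eq_bigr => k _; rewrite !mcoeffZ mcoeffX comp_mpolyX big_ord_recr /=.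
rewrite tnth_mktuple /= insubF ?ltnn //= (eq_bigr (fun i : 'I_n => 'X_i ^+ [multinom
  k (widen_ord (leqnSn n) i) | i < n] i)); last first.
  by move=> i _; rewrite tnth_mktuple mnmE /= valK.
rewrite -mpolyXE_id; congr (_ * _).
case: (posnP (k ord_max)) => [k0|kp].
  rewrite k0 expr0 mulr1 mcoeffX; congr ((nat_of_bool _)%:R); apply/eqP/eqP => [<-|->].
    apply/mnmP => i; case: (unliftP ord_max i) => [j ->|->]; last first.
      by rewrite mnmwiden_ordmax.
    rewrite lift_max_widen.
    by rewrite mnmwiden_widen mnmE.
  by apply/mnmP => i; rewrite mnmE mnmwiden_widen.
rewrite expr0n eqn0Ngt kp mulr0 mcoeff0; case: eqP kp => // ->.
by rewrite mnmwiden_ordmax.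
Qed.

Lemma restrD p q : restr (p + q) = restr p + restr q.
Proof. by apply/mpolyP => m; rewrite mcoeffD !mcoeff_restr mcoeffD. Qed.

Lemma restrM p q : restr (p * q) = restr p * restr q.
Proof. by rewrite /restr unlock rmorphM. Qed.

Lemma restrZ c p : restr (c *: p) = c *: restr p.
Proof. by apply/mpolyP => m; rewrite mcoeffZ !mcoeff_restr mcoeffZ. Qed.

Lemma restrC c : restr c%:MP = c%:MP.
Proof. by rewrite /restr unlock comp_mpolyC. Qed.

Lemma restrXmax : restr 'X_ord_max = 0.
Proof. by rewrite /restr unlock comp_mpolyXU -tnth_nth tnth_mktuple insubF ?ltnn. Qed.

Lemma restr_sum (I : Type) (s : seq I) (P : pred I) (E : I -> {mpoly K[n.+1]}) :
  restr (\sum_(i <- s | P i) E i) = \sum_(i <- s | P i) restr (E i).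
Proof.
elim/big_rec2: _ => [|i x F _ <-]; last by rewrite restrD.
by apply/mpolyP => m; rewrite mcoeff_restr !mcoeff0.
Qed.

Lemma restrXn p k : restr (p ^+ k) = restr p ^+ k.
Proof. by rewrite /restr unlock rmorphXn. Qed.

Lemma restr_psum r : restr (psum K r.+1 n.+1) = psum K r.+1 n.
Proof.
rewrite /psum restr_sum big_ord_recr /= restrXn restrXmax expr0n addr0.
apply: eq_bigr => i _; rewrite restrXn /restr unlock comp_mpolyXU -tnth_nth tnth_mktuple.
by rewrite /= valK.
Qed.

Lemma restr_ev D (F : {mpoly K[D]}) : restr (ev n.+1 F) = ev n F.
Proof.
elim/mpolyind: F => [|c m F _ _ IH].
  by rewrite !ev0; apply/mpolyP => m; rewrite mcoeff_restr !mcoeff0.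
rewrite !evD !evZ restrD restrZ IH; congr (_ *: _ + _) => {c F IH}.
elim/mnm_rec: m => [|i m IH]; first by rewrite mpolyX0 -mpolyC1 !evC restrC.
by rewrite mpolyXD !evM restrM IH !evX restr_psum.
Qed.

(** In the chain rule the powers x_(n+1)^r vanish at x_(n+1) = 0, except for r = 0, which carries
    d/dp_1. *)
Lemma restr_deriv_ev D (F : {mpoly K[D.+1]}) :
  restr (ev n.+1 F)^`M(ord_max) = ev n F^`M(ord0).
Proof.
rewrite ev_deriv restr_sum big_ord_recl big1 /= => [|i _].
  by rewrite expr0 scale1r mul1r restr_ev addr0.
by rewrite restrZ restrM restrXn restrXmax expr0n mul0r scaler0.
Qed.

Lemma restr_deriv_prodX (p : {mpoly K[n.+1]}) :
  restr (prodX K n.+1 * p)^`M(ord_max) = prodX K n * restr p.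
Proof.
rewrite mderivM restrD !restrM.
have E : restr (prodX K n.+1)^`M(ord_max) = prodX K n.
  rewrite !prodXE; apply/mpolyP => k; rewrite mcoeff_restr mcoeff_deriv mnmwiden_ordmax mulr1n.
  rewrite !mcoeffX; congr ((nat_of_bool _)%:R); apply/eqP/eqP => [E|<-].
    apply/mnmP => i; have := congr1 (fun u : 'X_{1.._} => u (widen_ord (leqnSn n) i)) E.
    rewrite mnmDE mnmwiden_widen mnm1E -(inj_eq val_inj) /= gtn_eqF // addn0 => <-.
    by rewrite !mnmE.
  apply/mnmP => i; case: (unliftP ord_max i) => [j ->|->]; last first.
    by rewrite mnmDE mnmwiden_ordmax mnm1E eqxx !mnmE.
  rewrite lift_max_widen.
  by rewrite mnmDE mnmwiden_widen mnm1E -(inj_eq val_inj) /= gtn_eqF // addn0 !mnmE.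
rewrite E // /prodX [restr (\prod_(i < _) _)](_ : _ = 0) ?mul0r ?addr0 //.
by rewrite big_ord_recr /= restrM restrXmax mulr0.
Qed.

Lemma mcoeff_ones (p : {mpoly K[n.+1]}) :
  p@_(ones n.+1) = (restr p^`M(ord_max))@_(ones n).
Proof.
rewrite mcoeff_restr mcoeff_deriv mnmwiden_ordmax mulr1n; congr (_@__).
apply/mnmP => i; case: (unliftP ord_max i) => [j ->|->]; last first.
  by rewrite mnmDE mnmwiden_ordmax mnm1E eqxx !mnmE.
rewrite lift_max_widen.
by rewrite mnmDE mnmwiden_widen mnm1E -(inj_eq val_inj) /= gtn_eqF // addn0 !mnmE.
Qed.

End Restriction.

Section PowersOfP1.
Variables (K : fieldType) (alpha : K) (D' : nat).
Local Notation D := D'.+1.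
Implicit Types (F G H : {mpoly K[D]}).

(* The coefficient of p_1^d. *)
Definition theta d F : K := F@_(U_(ord0) *+ d)%MM.

Lemma theta_deriv d F : theta d F^`M(ord0) = d.+1%:R * theta d.+1 F.
Proof.
by rewrite /theta mcoeff_deriv -mulmSr mulmnE mnm1E eqxx mul1n mulr_natl.
Qed.

Lemma theta_X0 d F : theta d.+1 ('X_ord0 * F) = theta d F.
Proof. by rewrite /theta mulmS mulrC mcoeffMX. Qed.

(** A product of power sums with a factor p_r, r > 1, has no squarefree monomial, while p_1^d
    contains x_1 ... x_d with coefficient d!. The induction removes one variable by differentiating
    in it and setting it to 0. *)
Lemma ev_ones d F : (ev d F)@_(ones d) = d`!%:R * theta d F.
Proof.
elim: d F => [|d IH] F; last first.
  by rewrite mcoeff_ones restr_deriv_ev IH theta_deriv factS natrM; ring.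
rewrite mul1r /theta mulm0n.
have -> : ones 0 = 0%MM by apply/mnmP => -[].
elim/mpolyind: F => [|c m F _ _ IH]; first by rewrite ev0 !mcoeff0.
rewrite evD evZ !mcoeffD !mcoeffZ IH; congr (_ * _ + _) => {c F IH}.
rewrite mcoeffX; case: eqP => [->|/eqP m0].
  by rewrite mpolyX0 -mpolyC1 evC mcoeffC eqxx mulr1.
have /existsP[i mi] : [exists i, m i != 0%N].
  apply: contraNT m0 => /existsPn h; apply/eqP/mnmP => i; rewrite mnm0E.
  by apply/eqP; have := h i; rewrite negbK.
have -> : m = (U_(i) + (m - U_(i)))%MM by rewrite addmC submK // lep1mP.
by rewrite mpolyXD evM evX /psum big_ord0 mul0r mcoeff0.
Qed.

Lemma form_X0n d F : form alpha F ('X_ord0 ^+ d) = alpha ^+ d * d`!%:R * theta d F.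
Proof.
rewrite formC mpolyXn form_mnm mulrC /theta /pweight; congr (_ * _).
rewrite (bigD1 ord0) //= mulmnE mnm1E eqxx mul1n mul1r big1 ?mulr1 // => i i0.
by rewrite mulmnE mnm1E eq_sym (negPf i0) mul0n mulr1.
Qed.

(** Only the splitting term r = s = 0 acts on a power of p_1. The coefficient d (d - 1) is 0
    whenever [d.-2] is truncated. *)
Lemma jackop_X0n d : jackop alpha ('X_ord0 ^+ d : {mpoly K[D]})
  = (d * d.-1)%:R *: (pX K D' 1 * 'X_ord0 ^+ d.-2).
Proof.
have dX (r : 'I_D) k : ('X_ord0 ^+ k : {mpoly K[D]})^`M(r)
    = if r == ord0 then k%:R *: 'X_ord0 ^+ k.-1 else 0.
  case: eqP => [->|/eqP r0]; last by rewrite mderivXn_neq // eq_sym.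
  case: k => [|k]; last by rewrite mderivXn.
  by rewrite expr0 -mpolyC1 mderivC scale0r.
have E2 : jackop_diag ('X_ord0 ^+ d : {mpoly K[D]}) = 0.
  rewrite /jackop_diag big1 // => r _; rewrite dX; case: eqP => [->|_].
    by rewrite muln0 scale0r.
  by rewrite mulr0 scaler0.
have E3 : jackop_join ('X_ord0 ^+ d : {mpoly K[D]}) = 0.
  rewrite /jackop_join big1 // => r _; rewrite big1 // => s _.
  rewrite /pder; case: insubP => [i _ iE|_]; last by rewrite mulr0 scaler0.
  by rewrite dX -(inj_eq val_inj) iE /= mulr0 scaler0.
rewrite /jackop E2 E3 !scaler0 !addr0 /jackop_split.
rewrite (bigD1 ord0) //= [X in _ + X]big1 ?addr0 => [|r r0]; last first.
  by rewrite big1 // => s _; rewrite dX (negPf r0) mderiv0 mulr0 scaler0.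
rewrite (bigD1 ord0) //= big1 ?addr0 => [|s s0].
  by rewrite dX eqxx mderivZ dX eqxx scalerA -scalerAr scalerA -natrM mul1r mulnC.
by rewrite dX eqxx mderivZ dX (negPf s0) scaler0 mulr0 scaler0.
Qed.

End PowersOfP1.

(** At the point (1, ..., 1) the operators d_i and x_i d_i have the same value. *)
Lemma translation_one (K : fieldType) n d (p : {mpoly K[n]}) : p \is d.-homog ->
  (translation p).@[fun _ => 1] = d%:R * p.@[fun _ => 1].
Proof.
move=> hp; rewrite -mevalZ -(euler_dhomog hp) /translation /euler !raddf_sum /=.
by apply: eq_bigr => i _; rewrite /eul mevalM mevalXU mul1r.
Qed.

(** * Partitions *)

Section Partitions.
Implicit Types (la mu nu : intpart) (n d : nat).

Lemma pnth_noninc la i j : (i <= j)%N -> (nth 0 la j <= nth 0 la i)%N.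
Proof.
have /andP[srt _] := valP la.
move=> ij; case: (ltnP j (size la)) => jl; last by rewrite nth_default.
have := @sorted_leq_nth _ geq geq_trans (fun x => leqnn x) 0%N _ srt i j.
by apply; rewrite // inE ?(leq_ltn_trans ij).
Qed.

Lemma pnth_gt0 la i : (0 < nth 0 la i)%N = (i < size la)%N.
Proof.
have /andP[_ n0] := valP la.
case: (ltnP i (size la)) => il; last by rewrite nth_default.
by rewrite lt0n; apply: contraNneq n0 => <-; rewrite mem_nth.
Qed.

Lemma intpart_eq la mu : (forall i, nth 0%N la i = nth 0%N mu i) -> la = mu.
Proof.
move=> E; apply: val_inj; apply: (@eq_from_nth _ 0%N) => //.
have lt i : (i < size la)%N = (i < size mu)%N by rewrite -!pnth_gt0 E.
apply/eqP; rewrite eqn_leq; apply/andP; split; rewrite leqNgt; apply/negP.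
  by rewrite lt ltnn.
by rewrite -lt ltnn.
Qed.

Lemma addcol_subproof n nu : is_intpart (mkseq (fun i => (nth 0%N nu i).+1) n).
Proof.
apply/andP; split; last by apply/mapP => -[].
rewrite sorted_pairwise; last exact: geq_trans.
apply/(pairwiseP 0%N) => i j; rewrite !inE size_mkseq => i_n j_n ij.
by rewrite !nth_mkseq //= ltnS pnth_noninc // ltnW.
Qed.

(* Meaningful only when plength nu <= n. *)
Definition addcol n nu := IntPart (addcol_subproof n nu).

Lemma rmcol_subproof la : is_intpart [seq k.-1 | k <- la & (1 < k)%N].
Proof.
have /andP[srt _] := valP la; apply/andP; split; last first.
  by apply/mapP => -[k]; rewrite mem_filter; case: k => [|[|k]].
rewrite sorted_map; apply: sub_sorted (sorted_filter geq_trans _ srt).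
by move=> x y /=; lia.
Qed.

Definition rmcol la := IntPart (rmcol_subproof la).

Lemma nth_addcol n nu i : nth 0%N (addcol n nu) i = if (i < n)%N then (nth 0%N nu i).+1 else 0%N.
Proof.
case: ltnP => i_n; first by rewrite /= nth_mkseq.
by rewrite nth_default //= size_mkseq.
Qed.

Lemma nth_rmcol la i : nth 0%N (rmcol la) i = (nth 0%N la i).-1.
Proof.
case: la i => s /= /andP[srt _]; elim: s srt => [|x s IH] srt i; first by rewrite !nth_nil.
have ss := path_sorted srt.
case: (ltnP 1 x) => x1 /=; first by rewrite x1 /=; case: i => //= i; rewrite IH.
rewrite ltnNge x1 /=.
have all1 : all (fun k => k <= 1)%N (x :: s).
  rewrite /= x1; have := order_path_min geq_trans srt.
  by apply: sub_all => k /= kx; exact: leq_trans kx x1.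
have -> : [seq k <- s | (1 < k)%N] = [::].
  case/andP: all1 => _ all1; apply/eqP; rewrite -size_eq0 size_filter eqn0Ngt -has_count.
  by rewrite -all_predC; apply: sub_all all1 => k /=; rewrite -leqNgt.
rewrite nth_nil; case: (ltnP i (size (x :: s))) => il; last by rewrite nth_default.
by have := all_nthP 0%N all1 i il; case: nth => [|[]].
Qed.

Lemma addcolK n nu : (plength nu <= n)%N -> rmcol (addcol n nu) = nu.
Proof.
move=> nn; apply: intpart_eq => i; rewrite nth_rmcol nth_addcol; case: ltnP => //= ni.
by rewrite nth_default // (leq_trans nn).
Qed.

Lemma rmcolK la : addcol (plength la) (rmcol la) = la.
Proof.
apply: intpart_eq => i; rewrite nth_addcol nth_rmcol /plength; case: ltnP => il.
  by rewrite prednK // pnth_gt0.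
by rewrite nth_default.
Qed.

Lemma plength_addcol n nu : plength (addcol n nu) = n.
Proof. by rewrite /plength /= size_mkseq. Qed.

Lemma plength_le la n : (forall i, (n <= i)%N -> nth 0%N la i = 0%N) -> (plength la <= n)%N.
Proof. by move=> h; rewrite leqNgt; apply/negP; rewrite /plength -pnth_gt0 h. Qed.

Lemma plength_rmcol la : (plength (rmcol la) <= plength la)%N.
Proof. by apply: plength_le => i il; rewrite nth_rmcol nth_default. Qed.

Lemma psizeE la n : (plength la <= n)%N -> psize la = (\sum_(i < n) nth 0 la i)%N.
Proof.
move=> ln; rewrite /psize sumnE (big_nth 0%N) big_mkord.
rewrite (big_ord_widen _ (fun i => nth 0%N la i) ln) big_mkcond; apply: eq_bigr => i _.
by case: ltnP => // il; rewrite nth_default.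
Qed.

Lemma psize_addcol n nu : (plength nu <= n)%N -> psize (addcol n nu) = (n + psize nu)%N.
Proof.
move=> nn; rewrite (psizeE nn) (@psizeE _ n) ?plength_addcol //.
rewrite (eq_bigr (fun i : 'I_n => (1 + nth 0 nu i)%N)) => [|i _]; last first.
  by rewrite nth_addcol ltn_ord.
by rewrite big_split /= sum_nat_const card_ord muln1.
Qed.

Lemma psize_rmcol la : psize la = (plength la + psize (rmcol la))%N.
Proof. by rewrite -{1}(rmcolK la) psize_addcol // plength_rmcol. Qed.

Lemma plength_le_psize la : (plength la <= psize la)%N.
Proof. by rewrite psize_rmcol leq_addr. Qed.

Lemma mem_partitions_of d la : (la \in partitions_of d) = (psize la == d).
Proof.
rewrite /partitions_of mem_parts andb_idl // => /eqP <-; exact: plength_le_psize.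
Qed.

Lemma sum_addcol (V : nmodType) n d (f : intpart -> V) :
  \sum_(la <- partitions_of (n + d) | plength la == n) f la
    = \sum_(nu <- partitions_of d | (plength nu <= n)%N) f (addcol n nu).
Proof.
rewrite -[LHS]big_filter -[RHS]big_filter -[RHS](big_map (addcol n) xpredT f).
apply: perm_big; apply: uniq_perm.
- exact: filter_uniq (parts_uniq _ _).
- rewrite map_inj_in_uniq; first exact: filter_uniq (parts_uniq _ _).
  move=> x y; rewrite !mem_filter => /andP[xn _] /andP[yn _] E.
  by rewrite -(addcolK xn) E addcolK.
move=> la; rewrite mem_filter mem_partitions_of; apply/andP/mapP.
  move=> [/eqP ln /eqP ld]; exists (rmcol la); last by rewrite -ln rmcolK.
  rewrite mem_filter mem_partitions_of -ln plength_rmcol /=.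
  by rewrite -(eqn_add2l n) -ld -{1}ln -psize_rmcol.
move=> [nu]; rewrite mem_filter mem_partitions_of => /andP[nn /eqP nd] ->.
by rewrite plength_addcol psize_addcol // nd.
Qed.

Lemma empty_subproof : is_intpart [::]. Proof. by []. Qed.
Definition pempty := IntPart empty_subproof.

Lemma psize_eq0 la : psize la = 0%N -> la = pempty.
Proof.
move=> z; apply: val_inj; apply/eqP; rewrite -size_eq0 -leqn0 -z; exact: plength_le_psize.
Qed.

Lemma plength_eq0 la : plength la = 0%N -> la = pempty.
Proof. by move=> z; apply: val_inj; apply/eqP; rewrite -size_eq0 -/(plength la) z. Qed.

Lemma rmcol_lt la : (0 < psize la)%N -> (psize (rmcol la) < psize la)%N.
Proof.
move=> h; rewrite [X in (_ < X)%N]psize_rmcol -{1}[psize (rmcol la)]add0n ltn_add2r lt0n.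
by apply: contraTneq h => /plength_eq0 ->.
Qed.

Definition mono n la : 'X_{1..n} := [multinom nth 0%N la i | i < n].

Lemma mdeg_mono n la : (plength la <= n)%N -> mdeg (mono n la) = psize la.
Proof. by move=> ln; rewrite mdegE (psizeE ln); apply: eq_bigr => i _; rewrite mnmE. Qed.

Lemma mono_inj n la mu : (plength la <= n)%N -> (plength mu <= n)%N ->
  mono n la = mono n mu -> la = mu.
Proof.
move=> ln mn E; apply: intpart_eq => i; case: (ltnP i n) => i_n; last first.
  by rewrite !nth_default ?(leq_trans ln) ?(leq_trans mn).
by have := congr1 (fun m : 'X_{1..n} => m (Ordinal i_n)) E; rewrite !mnmE.
Qed.

Lemma sorted_mono n (m : 'X_{1..n}) : (forall i j : 'I_n, (i <= j)%N -> (m j <= m i)%N) ->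
  exists2 la : intpart, (plength la <= n)%N & m = mono n la.
Proof.
move=> h; have srt : sorted geq m.
  rewrite (sorted_pairwise geq_trans); apply/(pairwiseP 0%N) => i j.
  rewrite !inE size_tuple => i_n j_n ij; rewrite -!(mnm_nth 0%N m (Ordinal _)).
  by have := h (Ordinal i_n) (Ordinal j_n) (ltnW ij); rewrite !(mnm_nth 0%N).
have p : is_intpart [seq k <- m | (0 < k)%N].
  by rewrite /is_intpart (sorted_filter geq_trans) // mem_filter.
exists (IntPart p); first by rewrite /plength /= size_filter (leq_trans (count_size _ _)) ?size_tuple.
apply/mnmP => i; rewrite mnmE (mnm_nth 0%N) {1}(sorted_geq_filter_pos srt) nth_cat.
by case: ltnP => // ?; rewrite nth_nseq nth_default //; case: ifP.
Qed.

End Partitions.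

(** * Content sums and products over the boxes *)

Section ContentSum.
Variables (K : fieldType) (alpha : K).
Hypothesis alpha_neq0 : alpha != 0.
Implicit Types (la mu nu : intpart) (n d : nat).

(* The sum over the boxes (i, j) of la of the contents j - 1 - (i - 1)/alpha. *)
Definition ctsum la : K := (\sum_(i < plength la) 'C(nth 0 la i, 2))%:R
  - (\sum_(i < plength la) i * nth 0 la i)%:R / alpha.

Lemma sum_widen n la (f : nat -> nat -> nat) : (plength la <= n)%N ->
  (forall i, f i 0 = 0)%N ->
  (\sum_(i < plength la) f i (nth 0 la i) = \sum_(i < n) f i (nth 0 la i))%N.
Proof.
move=> ln f0; rewrite (big_ord_widen _ (fun i => f i (nth 0%N la i)) ln) big_mkcond.
by apply: eq_bigr => i _; case: ltnP => // il; rewrite nth_default // f0.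
Qed.

Lemma ctsumE n la : (plength la <= n)%N -> ctsum la =
  (\sum_(i < n) 'C(nth 0 la i, 2))%:R - (\sum_(i < n) i * nth 0 la i)%:R / alpha.
Proof.
move=> ln; rewrite /ctsum (sum_widen (f := fun _ x => 'C(x, 2)) ln) //.
by rewrite (sum_widen (f := fun i x => i * x)%N ln) // => i; rewrite muln0.
Qed.

(** Moving nu one step to the right raises each content by 1; the new first column contributes the
    contents -i / alpha. *)
Lemma ctsum_addcol n nu : (plength nu <= n)%N ->
  ctsum (addcol n nu) = ctsum nu + (psize nu)%:R - (\sum_(i < n) i)%:R / alpha.
Proof.
move=> nn; rewrite (ctsumE nn) (@ctsumE n) ?plength_addcol // (psizeE nn).
rewrite (eq_bigr (fun i : 'I_n => 'C(nth 0 nu i, 2) + nth 0 nu i)%N); last first.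
  by move=> i _; rewrite nth_addcol ltn_ord binS bin1.
rewrite [in X in _ - X / _](eq_bigr (fun i : 'I_n => i + i * nth 0 nu i)%N); last first.
  by move=> i _; rewrite nth_addcol ltn_ord mulnS.
by rewrite !big_split /= !natrD; field.
Qed.

Lemma sum_gt_const (V : zmodType) n (i : 'I_n) (x : V) :
  \sum_(j < n | (i < j)%N) x = x *+ (n - i.+1).
Proof.
rewrite sumr_const; congr (_ *+ _).
have -> : #|[pred j : 'I_n | (i < j)%N]| = #|predC [pred j : 'I_n | (j < i.+1)%N]|.
  by apply: eq_card => j; rewrite !inE ltnS -ltnNge.
have := cardC [pred j : 'I_n | (j < i.+1)%N].
rewrite card_ord => E; rewrite -{}[X in (X - _)%N]E.
have -> : #|[pred j : 'I_n | (j < i.+1)%N]| = i.+1; last by rewrite addKn.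
rewrite -sum1_card (eq_bigl (fun j : 'I_n => (j < i.+1)%N)) //.
by rewrite (big_ord_narrow (ltn_ord i)) sum1_card card_ord.
Qed.

Lemma sum_lt_const (V : zmodType) n (i : 'I_n) (x : V) :
  \sum_(j < n | (j < i)%N) x = x *+ i.
Proof.
rewrite (big_ord_narrow (ltnW (ltn_ord i))) sumr_const card_ord //.
Qed.

Lemma lbeigE n (m : 'X_{1..n}) : lbeig alpha m =
  alpha * (\sum_(i < n) (m i * (m i).-1)%N)%:R + (n%:R - 1) * (mdeg m)%:R
   - 2%:R * (\sum_(i < n) i * m i)%:R.
Proof.
rewrite /lbeig -addrA; congr (_ + _).
under eq_bigr do rewrite sumrB.
rewrite sumrB [X in _ - X](exchange_big_dep xpredT) //= mdegE !natr_sum !mulr_sumr.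
rewrite -!sumrB; apply: eq_bigr => i _; rewrite sum_gt_const sum_lt_const.
by rewrite -![(m i)%:R *+ _]mulr_natr natrB // -natr1 natrM; ring.
Qed.

Lemma lbeig_mono n la : (plength la <= n)%N ->
  lbeig alpha (mono n la) = alpha * (2%:R * ctsum la + alpha^-1 * (n%:R - 1) * (psize la)%:R).
Proof.
move=> ln; rewrite lbeigE (ctsumE ln) mdeg_mono //.
rewrite (eq_bigr (fun i : 'I_n => 2 * 'C(nth 0 la i, 2))%N); last first.
  by move=> i _; rewrite mnmE bin2 mul2n -[RHS](odd_double_half _) doubleK
     /= odd_double add0n -{1}(odd_double_half (_ * _)) oddM; case: nth => // k; rewrite /= andNb.
rewrite -big_distrr natrM [in X in _ - _ * X](eq_bigr (fun i : 'I_n => i * nth 0 la i)%N).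
  by field.
by move=> i _; rewrite mnmE.
Qed.

End ContentSum.

Section Products.
Variables (K : fieldType) (alpha : K).
Implicit Types (la mu nu : intpart) (n d : nat).

Lemma gpochE n a la : (plength la <= n)%N -> gpoch alpha a la =
  \prod_(i < n) \prod_(j < nth 0%N la i) (a + j%:R - i%:R / alpha).
Proof.
move=> ln; rewrite /gpoch big_add1 /= big_mkord.
rewrite (big_ord_widen _ (fun i => \prod_(1 <= j < (ppart la i.+1).+1)
  (a + (j - 1)%:R - (i.+1 - 1)%:R / alpha)) ln) big_mkcond.
apply: eq_bigr => i _; rewrite big_add1 /= big_mkord /ppart /=.
under [in RHS]eq_bigr do rewrite -[X in _ + X%:R - _](subn1 _.+1) -[X in _ - X%:R / _](subn1 _.+1).
by case: ltnP => // il; rewrite nth_default // big_ord0.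
Qed.

(** Here the boxes of nu stay in place and the added boxes are the ends of the n rows. *)
Lemma gpoch_addcol_right n a nu : (plength nu <= n)%N ->
  gpoch alpha a (addcol n nu) =
    gpoch alpha a nu * \prod_(i < n) (a + (nth 0%N nu i)%:R - i%:R / alpha).
Proof.
move=> nn; rewrite (gpochE a nn) (@gpochE n) ?plength_addcol // -big_split /=.
by apply: eq_bigr => i _; rewrite nth_addcol ltn_ord big_ord_recr.
Qed.

(** Here nu is moved one step to the right, which turns a into a + 1, and the added boxes form the
    first column. *)
Lemma gpoch_addcol_left n a nu : (plength nu <= n)%N ->
  gpoch alpha a (addcol n nu) =
    gpoch alpha (a + 1) nu * \prod_(i < n) (a - i%:R / alpha).
Proof.
move=> nn; rewrite (gpochE (a + 1) nn) (@gpochE n) ?plength_addcol // -big_split /=.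
apply: eq_bigr => i _; rewrite nth_addcol ltn_ord big_ord_recl mulrC addr0.
by congr (_ * _); apply: eq_bigr => j _; rewrite lift0 -natr1 addrA addrAC.
Qed.

Lemma gpoch_empty a : gpoch alpha a pempty = 1.
Proof. by rewrite (@gpochE 0) // big_ord0. Qed.

Lemma pconj_addcol0 n nu : pconj (addcol n nu) 1 = n.
Proof.
have : all (leq 1) (addcol n nu) by apply/allP => x /mapP[i _ ->].
by rewrite all_count size_mkseq /pconj => /eqP.
Qed.

Lemma pconj_addcolS n nu j : (plength nu <= n)%N ->
  pconj (addcol n nu) j.+2 = pconj nu j.+1.
Proof.
move=> nn; rewrite /pconj /addcol /= count_map.
rewrite (eq_count (a2 := fun i => (j.+1 <= nth 0 nu i)%N)); last by move=> i /=; rewrite ltnS.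
rewrite -[in RHS](mkseq_nth 0%N nu) count_map -(subnKC nn) iotaD count_cat /=.
rewrite -[RHS]addn0; congr (_ + _)%N.
apply/eqP; rewrite eqn0Ngt -has_count -all_predC; apply/allP => i; rewrite mem_iota => /andP[ni _] /=.
by rewrite nth_default.
Qed.

(** The boxes of nu, moved to the right, keep their arms and legs. The first column box of row i,
    counted from 0, has arm nu_i and leg n - i - 1. *)
Lemma jnorm_addcol n nu : (plength nu <= n)%N -> jnorm alpha (addcol n nu) =
  jnorm alpha nu * \prod_(i < n)
    (((nth 0%N nu i)%:R * alpha + (n - i)%:R) * ((nth 0%N nu i).+1%:R * alpha + (n - i.+1)%:R)).
Proof.
move=> nn; pose f i := \prod_(1 <= j < (ppart nu i.+1).+1)
   (((ppart nu i.+1 - j)%:R * alpha + (pconj nu j - i.+1 + 1)%:R) *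
     ((ppart nu i.+1 - j + 1)%:R * alpha + (pconj nu j - i.+1)%:R)).
have -> : jnorm alpha nu = \prod_(i < n) f i.
  rewrite /jnorm big_add1 /= big_mkord (big_ord_widen _ f nn) big_mkcond.
  apply: eq_bigr => i _; case: ltnP => // il.
  by rewrite /f /ppart /= nth_default // big_geq.
rewrite -big_split /jnorm big_add1 /= big_mkord plength_addcol.
apply: eq_bigr => i _; have i_n := ltn_ord i.
rewrite /f /ppart /= nth_mkseq // !big_add1 /= !big_mkord big_ord_recl /= mulrC.
rewrite pconj_addcol0 subn1 /= !addn1 -subSn // subSS; congr (_ * _).
by apply: eq_bigr => j _; rewrite /bump /= add1n pconj_addcolS // !subSS.
Qed.

Lemma jnorm_empty : jnorm alpha pempty = 1.
Proof. by rewrite /jnorm big_geq. Qed.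

End Products.

(** Independence of alpha and 1 over the naturals. It contains alpha <> 0 and characteristic 0, see
    [linfree_neq0] and [linfree_char0]. *)
Definition linfree (K : fieldType) (alpha : K) := forall a b a' b' : nat,
  a%:R * alpha + b%:R = a'%:R * alpha + b'%:R -> a = a' /\ b = b'.

(** * Dominance order, sorted exponents and power sum monomials *)

Section Dominance.
Variable n : nat.
Implicit Types (e : 'X_{1..n}) (la mu : intpart).

Definition pre e k := (\sum_(i < n | i < k) e i)%N.

Lemma pre_sumn e k : pre e k = sumn (take k e).
Proof.
rewrite sumnE (big_nth 0%N) big_mkord size_take size_tuple /pre.
case: (ltnP k n) => kn.
  rewrite (big_ord_narrow (ltnW kn)); apply: eq_bigr => i _.
  by rewrite nth_take // (mnm_nth 0%N).
rewrite (eq_bigl xpredT) => [|i]; last by rewrite (leq_trans (ltn_ord i) kn).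
by apply: eq_bigr => i _; rewrite take_oversize ?size_tuple // (mnm_nth 0%N).
Qed.

Lemma preS e (i : 'I_n) : pre e i.+1 = (pre e i + e i)%N.
Proof.
rewrite /pre (bigD1 i) //= addnC; congr (_ + _)%N; apply: eq_bigl => j.
by rewrite -(inj_eq val_inj) /=; lia.
Qed.

Lemma pre_inj e1 e2 : (forall k, pre e1 k = pre e2 k) -> e1 = e2.
Proof.
move=> E; apply/mnmP => i; have := preS e1 i.
by rewrite !E preS => /eqP; rewrite eqn_add2l => /eqP.
Qed.

Lemma pre_le_mnm e1 e2 : mdeg e1 = mdeg e2 -> (forall k, (pre e1 k <= pre e2 k)%N) ->
  (e1 <= e2)%O.
Proof.
move=> de le; rewrite leNgt; apply/negP => /(ltmcP (esym de))[i lti eqi].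
have := le i.+1; rewrite !preS leqNgt => /negP; apply.
by rewrite /pre (eq_bigr (fun j : 'I_n => e1 j)) ?ltn_add2l // => j ji; rewrite lti.
Qed.

(** Summation by parts. *)
Lemma sum_pre e : (\sum_(k < n) pre e k.+1 + \sum_(i < n) i * e i = n * mdeg e)%N.
Proof.
rewrite /pre (exchange_big_dep xpredT) //= -big_split mdegE big_distrr /=.
apply: eq_bigr => i _; rewrite (eq_bigl (fun k : 'I_n => ~~ (k < i)%N)) => [|k]; last by rewrite ltnS leqNgt.
have : (\sum_(k < n) e i = \sum_(k < n | (k < i)%N) e i + \sum_(k < n | ~~ (k < i)%N) e i)%N.
  by rewrite (bigID (fun k : 'I_n => (k < i)%N)).
rewrite sum_nat_const card_ord => ->; rewrite addnC; congr (_ + _)%N.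
by rewrite (big_ord_narrow (ltnW (ltn_ord i))) sum_nat_const card_ord.
Qed.

Variables (K : fieldType) (alpha : K).
Hypothesis alpha_free : linfree alpha.

(** By independence, the part of the eigenvalue free of alpha determines the sum of the i e_i, hence
    by [sum_pre] the total of the partial sums. Partial sums that are termwise comparable and have
    the same total are equal. *)
Lemma lbeig_dom_inj e1 e2 : mdeg e1 = mdeg e2 -> (forall k, (pre e1 k <= pre e2 k)%N) ->
  lbeig alpha e1 = lbeig alpha e2 -> e1 = e2.
Proof.
move=> de le; rewrite !lbeigE de.
set A1 := (\sum_(i < n) _ * _.-1)%N; set B1 := (\sum_(i < n) _ * e1 _)%N.
set A2 := (\sum_(i < n) _ * _.-1)%N; set B2 := (\sum_(i < n) _ * e2 _)%N.
set X := _ * (mdeg e2)%:R => E.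
have /alpha_free[_ /eqP] : A1%:R * alpha + (2 * B2)%:R = A2%:R * alpha + (2 * B1)%:R.
  rewrite !natrM ![_ * alpha]mulrC; apply: (addIr (X - 2%:R * B1%:R - 2%:R * B2%:R)).
  transitivity (alpha * A1%:R + X - 2%:R * B1%:R); first by ring.
  by rewrite E; ring.
rewrite eqn_pmul2l // => /eqP BB.
have Epre : (\sum_(k < n) pre e1 k.+1 = \sum_(k < n) pre e2 k.+1)%N.
  by apply/eqP; rewrite -(eqn_add2r B2) {1}BB !sum_pre de.
have E1 (k : 'I_n) : pre e1 k.+1 = pre e2 k.+1.
  apply/eqP; rewrite eqn_leq le /= leqNgt; apply/negP => lt.
  have : (\sum_(k < n) pre e1 k.+1 < \sum_(k < n) pre e2 k.+1)%N.
    rewrite (bigD1 k) //= [X in (_ < X)%N](bigD1 k) //= -addSn leq_add //.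
    by apply: leq_sum => i _.
  by rewrite Epre ltnn.
have En e : pre e n = mdeg e.
  by rewrite mdegE /pre; apply: eq_bigl => i; rewrite ltn_ord.
apply: pre_inj => -[|k]; first by rewrite /pre !big_pred0.
case: (ltnP k n) => kn; first exact: (E1 (Ordinal kn)).
have Eg e : pre e k.+1 = mdeg e.
  by rewrite mdegE /pre; apply: eq_bigl => i; rewrite (leq_trans (ltn_ord i)) // ltnW.
by rewrite !Eg.
Qed.

End Dominance.

Section SortedExponents.
Implicit Types (la mu : intpart).

Lemma psort_subproof (s : seq nat) : is_intpart (sort geq [seq k <- s | (0 < k)%N]).
Proof.
rewrite /is_intpart mem_sort mem_filter /= andbT.
by apply: sort_sorted => x y /=; exact: leq_total.
Qed.

Definition psort (s : seq nat) := IntPart (psort_subproof s).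

Lemma psortP (s : seq nat) mu : perm_eq [seq k <- s | (0 < k)%N] mu = (mu == psort s).
Proof.
apply/idP/eqP => [p|->]; last by rewrite perm_sym perm_sort.
apply: val_inj; apply: (sorted_eq geq_trans) => //.
- by move=> x y /= /andP[]; lia.
- by case: mu {p} => /= s' /andP[].
- by apply: sort_sorted; move=> x y /=; exact: leq_total.
by rewrite perm_sym; apply: perm_trans p; rewrite perm_sort.
Qed.

Lemma psort_perm (s t : seq nat) : perm_eq s t -> psort s = psort t.
Proof.
move=> st; apply/eqP; rewrite -psortP perm_sym perm_sort.
by rewrite perm_sym perm_filter // perm_sym.
Qed.

Lemma psort_cat0 (s : seq nat) k : psort (s ++ nseq k 0%N) = psort s.
Proof.
apply: val_inj; rewrite /= filter_cat [X in _ ++ X](_ : _ = [::]) ?cats0 //.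
by elim: k.
Qed.

Lemma psort_id la : psort la = la.
Proof.
apply/esym/eqP; rewrite -psortP.
suff /all_filterP -> : all (ltn 0) la by [].
apply/allP => x xl; have /andP[_ n0] := valP la.
by rewrite /= lt0n; apply: contraNneq n0 => <-.
Qed.

Lemma psize_psort (s : seq nat) : psize (psort s) = sumn s.
Proof.
rewrite /psize /= (perm_sumn (_ : perm_eq _ [seq k <- s | (0 < k)%N])) ?perm_sort //.
exact: sumn_filter_pos.
Qed.

Lemma plength_psort (s : seq nat) : (plength (psort s) <= size s)%N.
Proof. by rewrite /plength /= size_sort size_filter count_size. Qed.

(** Let v be the entry that follows the k largest ones. Any k entries sum to at most k v plus the
    total of the truncated excesses x - v over all entries, and the k largest attain this bound. *)
Lemma sumn_take_psort k (s : seq nat) : (sumn (take k s) <= sumn (take k (psort s)))%N.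
Proof.
set t := psort s; case: (ltnP k (size t)) => kt; last first.
  rewrite (take_oversize kt) -/(psize t) psize_psort -{2}(cat_take_drop k s) sumn_cat leq_addr //.
pose v := nth 0%N t k.
have Esum (r : seq nat) : (sumn r <= size r * v + sumn [seq (x - v)%N | x <- r])%N.
  elim: r => //= x r IH; rewrite mulSn addnACA leq_add //; lia.
have Eall (r : seq nat) : all (fun x => v <= x)%N r ->
    sumn r = (size r * v + sumn [seq (x - v)%N | x <- r])%N.
  by elim: r => //= x r IH /andP[vx /IH ->]; lia.
have Et : sumn (take k t) = (k * v + sumn [seq (x - v)%N | x <- take k t])%N.
  have : all (fun x => v <= x)%N (take k t).
    apply/(all_nthP 0%N) => i; rewrite size_take kt => ik; rewrite nth_take //.
    by rewrite pnth_noninc // ltnW.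
  by move/Eall; rewrite size_take kt.
have Etail : sumn [seq (x - v)%N | x <- drop k t] = 0%N.
  apply/eqP; rewrite sumnE big_map big_seq big1 // => x /(nthP 0%N)[i]; rewrite size_drop => i_k <-.
  by rewrite nth_drop; apply/eqP; rewrite subn_eq0 pnth_noninc // leq_addr.
have Etot : sumn [seq (x - v)%N | x <- t] = sumn [seq (x - v)%N | x <- s].
  have pt : perm_eq t [seq k <- s | (0 < k)%N] by rewrite perm_sort.
  rewrite (perm_sumn (perm_map _ pt)); elim: (s) => //= -[|x] s' IH /=; last by rewrite IH.
  by rewrite sub0n.
rewrite Et -[X in (_ <= _ + X)%N]addn0 -Etail -sumn_cat -map_cat cat_take_drop Etot.
apply: leq_trans (Esum _) _; rewrite leq_add //.
  by rewrite leq_mul2r size_take; case: ifP; rewrite ?leqnn ?orbT // => /negbT; rewrite -leqNgt => ->; rewrite orbT.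
by rewrite -{2}(cat_take_drop k s) map_cat sumn_cat leq_addr.
Qed.

Lemma mono_cat n la : (plength la <= n)%N -> mono n la = la ++ nseq (n - plength la) 0%N :> seq nat.
Proof.
move=> ln; apply: (@eq_from_nth _ 0%N).
  by rewrite size_tuple size_cat size_nseq subnKC.
rewrite size_tuple => i i_n; rewrite -[LHS](mnm_nth 0%N _ (Ordinal i_n)) mnmE /= nth_cat.
by case: ltnP => // il; rewrite nth_nseq nth_default //; case: ifP.
Qed.

Lemma psort_mono n la : (plength la <= n)%N -> psort (mono n la) = la.
Proof. by move=> ln; rewrite mono_cat // psort_cat0 psort_id. Qed.

Lemma sumn_mdeg n (e : 'X_{1..n}) : sumn e = mdeg e.
Proof. by rewrite sumnE. Qed.

Lemma mcoeff_m_fun (R : comNzRingType) mu n (e : 'X_{1..n}) :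
  (m_fun R mu n)@_e = (mu == psort e)%:R.
Proof.
rewrite /m_fun raddf_sum /= -psortP.
case: (boolP (perm_eq [seq k <- e | (0 < k)%N] mu)) => p; last first.
  rewrite big1 // => f pf; rewrite mcoeffX; case: eqP => // E.
  by move: p; rewrite -E pf.
have de : (mdeg e < (psize mu).+1)%N.
  by rewrite ltnS -sumn_mdeg -sumn_filter_pos (perm_sumn p).
rewrite (bigD1 (BMultinom de)) //= mcoeffX eqxx big1 ?addr0 // => f /andP[_ fe].
rewrite mcoeffX; case: eqP => // E; case/eqP: fe; apply: val_inj; exact: E.
Qed.

End SortedExponents.

Section PartitionMonomials.
Variable D : nat.
Implicit Types (la mu rho : intpart).

Definition mnmp rho : 'X_{1..D} := [multinom pmult rho i.+1 | i < D].

Lemma big_counts (R : comPzSemiRingType) (s : seq nat) (f : nat -> R) :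
  {in s, forall r, (0 < r <= D)%N} ->
  \prod_(r <- s) f r = \prod_(i < D) f i.+1 ^+ count_mem i.+1 s.
Proof.
elim: s => [_|x s IH H]; first by rewrite big_nil big1.
rewrite big_cons IH; last by move=> r rs; apply: H; rewrite inE rs orbT.
have /andP[x0 xD] := H x (mem_head _ _).
have xE : (x.-1 < D)%N by rewrite prednK.
rewrite /= [RHS](eq_bigr (fun i : 'I_D => f i.+1 ^+ (x == i.+1) * f i.+1 ^+ count_mem i.+1 s)).
  rewrite big_split [X in _ = X * _](bigD1 (Ordinal xE)) //= prednK // eqxx expr1.
  rewrite [X in _ = _ * X * _]big1 ?mulr1 // => i; rewrite -(inj_eq val_inj) /= => ix; case: eqP => // E.
  by move: ix; rewrite E /= eqxx.
by move=> i _; rewrite exprD.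
Qed.

Lemma part_le rho r : r \in (rho : seq nat) -> (0 < r <= psize rho)%N.
Proof.
have /andP[_ n0] := valP rho => rr; rewrite lt0n; apply/andP; split.
  by apply: contraNneq n0 => <-.
by rewrite /psize (perm_sumn (perm_to_rem rr)) leq_addr.
Qed.

Lemma part_leD rho : (psize rho <= D)%N -> {in (rho : seq nat), forall r, (0 < r <= D)%N}.
Proof. by move=> rD r /part_le/andP[-> /leq_trans->]. Qed.

Lemma psizeE_mnmwgt rho : (psize rho <= D)%N -> mnmwgt (mnmp rho) = psize rho.
Proof.
move=> rD; rewrite /mnmwgt /psize; have := part_leD rD.
rewrite /mnmp (eq_bigr (fun i : 'I_D => count_mem i.+1 rho * i.+1)%N); last first.
  by move=> i _; rewrite mnmE.
elim: (rho : seq nat) => [_|x s IH H]; first by rewrite big1.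
rewrite /= -IH; last by move=> r rs; apply: H; rewrite inE rs orbT.
have /andP[x0 xD] := H x (mem_head _ _).
have xE : (x.-1 < D)%N by rewrite prednK.
under eq_bigr do rewrite mulnDl.
rewrite big_split (bigD1 (Ordinal xE)) //= prednK // eqxx mul1n big1 ?addn0 //.
move=> i; rewrite -(inj_eq val_inj) /= => ix; case: eqP => // E.
by move: ix; rewrite E /= eqxx.
Qed.

Lemma mnmp_inj rho rho' : (psize rho <= D)%N -> (psize rho' <= D)%N ->
  mnmp rho = mnmp rho' -> rho = rho'.
Proof.
move=> rD rD' E; apply: val_inj; apply: (sorted_eq geq_trans).
- by move=> x y /= /andP[]; lia.
- by case/andP: (valP rho).
- by case/andP: (valP rho').
apply/allP => x _ /=; apply/eqP.
case: (boolP (0 < x <= D)%N) => [/andP[x0 xD]|nx].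
  have xE : (x.-1 < D)%N by rewrite prednK.
  have := congr1 (fun m : 'X_{1..D} => m (Ordinal xE)) E.
  by rewrite !mnmE /= prednK.
by rewrite !(count_memPn _) //; apply: contra nx; exact: part_leD.
Qed.

Lemma ev_mnmp (K : fieldType) N rho : (psize rho <= D)%N ->
  ev N ('X_[mnmp rho] : {mpoly K[D]}) = p_fun K rho N.
Proof.
move=> rD; rewrite evE comp_mpolyX /p_fun (big_counts (fun r => psum K r N) (part_leD rD)).
by apply: eq_bigr => i _; rewrite tnth_mktuple mnmE.
Qed.

Lemma pweight_mnmp (K : fieldType) (alpha : K) rho : (psize rho <= D)%N ->
  \prod_(i < D) ((i.+1%:R * alpha) ^+ mnmp rho i * ((mnmp rho i)`!)%:R)
   = (zpart rho)%:R * alpha ^+ plength rho.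
Proof.
move=> rD; rewrite (eq_bigr (fun i : 'I_D => (i.+1 ^ pmult rho i.+1 * (pmult rho i.+1)`!)%:R
   * alpha ^+ count_mem i.+1 rho)); last first.
  by move=> i _; rewrite mnmE exprMn natrM natrX /pmult; ring.
rewrite big_split -(big_counts (fun=> alpha) (part_leD rD)) /=; congr (_ * _); last first.
  by rewrite big_const_seq count_predT iter_mulr_1.
rewrite -natr_prod; congr (_%:R); rewrite /zpart.
rewrite -(big_mkord xpredT (fun i => i.+1 ^ pmult rho i.+1 * (pmult rho i.+1)`!)%N).
rewrite -(big_add1 _ _ 0%N D.+1 xpredT (fun i => i ^ pmult rho i * (pmult rho i)`!)%N).
rewrite (bigID (fun i => i \in (rho : seq nat))) /= [X in (_ * X)%N]big1 ?muln1; last first.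
  by move=> i /count_memPn; rewrite /pmult => ->.
rewrite -big_filter; apply: perm_big; apply: uniq_perm; rewrite ?undup_uniq //.
  by rewrite filter_uniq // iota_uniq.
move=> x; rewrite mem_filter mem_undup mem_index_iota ltnS.
by apply: andb_idr; exact: part_leD.
Qed.

End PartitionMonomials.

(** * Jack polynomials *)

Section JackCoefficients.
Variables (K : fieldType) (alpha : K) (J : intpart -> symfun K).
Hypothesis hJ : is_jack_family alpha J.
Implicit Types (la mu nu rho : intpart).

(** The coefficient of m_mu in J_la, read off at x^mu in |mu| variables, which is enough for every
    partition of that size. *)
Definition jcoef la mu : K := (J la (psize mu))@_(mono (psize mu) mu).

Lemma jcoefP la : [/\ forall mu, jcoef la mu != 0 -> dominated mu la,
   forall N e, (J la N)@_e = if mdeg e == psize la then jcoef la (psort e) else 0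
   & jcoef la (pcol (psize la)) = ((psize la)`!)%:R].
Proof.
have [_ /(_ la)[u [H1 H2 H3]]] := hJ.
have JE N e : (J la N)@_e = if mdeg e == psize la then u (psort e) else 0.
  rewrite H2 raddf_sum /=; case: eqP => [de|/eqP de].
    rewrite (bigD1_seq (psort e)) ?parts_uniq //=; last first.
      by rewrite mem_partitions_of psize_psort sumn_mdeg de.
    rewrite mcoeffZ mcoeff_m_fun eqxx mulr1 big1 ?addr0 // => mu /negPf me.
    by rewrite mcoeffZ mcoeff_m_fun me mulr0.
  rewrite big_seq big1 // => mu; rewrite mem_partitions_of mcoeffZ mcoeff_m_fun => /eqP sm.
  case: eqP => [E|_]; last by rewrite mulr0.
  by move: de; rewrite -sm E psize_psort sumn_mdeg eqxx.
have jE mu : psize mu = psize la -> jcoef la mu = u mu.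
  move=> sm; rewrite /jcoef JE mdeg_mono ?plength_le_psize // sm eqxx.
  by rewrite psort_mono // -sm plength_le_psize.
have j0 mu : psize mu <> psize la -> jcoef la mu = 0.
  by move=> /eqP sm; rewrite /jcoef JE mdeg_mono ?plength_le_psize // (negPf sm).
split.
- move=> mu; case: (eqVneq (psize mu) (psize la)) => [/jE -> /H1 //|/eqP/j0 ->].
  by rewrite eqxx.
- move=> N e; rewrite JE; case: eqP => // de; rewrite jE //.
  by rewrite psize_psort sumn_mdeg.
by rewrite jE // /psize /= sumn_nseq mul1n.
Qed.

Lemma mcoeffJ la N e :
  (J la N)@_e = if mdeg e == psize la then jcoef la (psort e) else 0.
Proof. by have [_ H _] := jcoefP la. Qed.

Lemma J_dhomog la N : J la N \is (psize la).-homog.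
Proof.
apply/dhomogP => m; rewrite mcoeff_msupp mcoeffJ /=; case: (mdeg m =P psize la) => // _.
by rewrite eqxx.
Qed.

Lemma J_support la N (e : 'X_{1..N}) : (J la N)@_e != 0 ->
  mdeg e = psize la /\ forall k, (pre e k <= sumn (take k la))%N.
Proof.
rewrite mcoeffJ; case: (mdeg e =P psize la) => [de h|_]; last by rewrite eqxx.
split=> // k; rewrite pre_sumn.
have [H _ _] := jcoefP la; have [_ /(_ k)] := H _ h; apply: leq_trans.
exact: sumn_take_psort.
Qed.

Lemma pre_mono N la k : (plength la <= N)%N -> pre (mono N la) k = sumn (take k la).
Proof.
move=> lN; rewrite pre_sumn mono_cat // take_cat; case: ltnP => // kl.
rewrite sumn_cat (take_oversize kl) [X in (_ + X)%N](_ : _ = 0%N) ?addn0 //.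
have T a b : sumn (take a (nseq b 0%N)) = 0%N by elim: b a => [|b IH] [|a] //=; rewrite IH.
exact: T.
Qed.

Lemma J_lead la N (m : 'X_{1..N}) : (plength la <= N)%N -> (mono N la < m)%O -> (J la N)@_m = 0.
Proof.
move=> lN lt; apply/eqP/negPn/negP => /J_support[dm le].
have : (m <= mono N la)%O.
  by apply: pre_le_mnm => [|k]; rewrite ?mdeg_mono // pre_mono.
by rewrite leNgt lt.
Qed.

Lemma J_lead_coef la N : (plength la <= N)%N -> (J la N)@_(mono N la) = jcoef la la.
Proof. by move=> lN; rewrite mcoeffJ mdeg_mono // eqxx psort_mono. Qed.

(** A partition dominated by la has at least as many parts as la, so no m_mu occurring in J_la
    survives in fewer variables. *)
Lemma J_few_vars la N : (N < plength la)%N -> J la N = 0.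
Proof.
move=> Nl; apply/mpolyP => e; rewrite mcoeff0; apply/eqP/negPn/negP.
rewrite mcoeffJ; case: (mdeg e =P psize la) => [de h|_]; last by rewrite eqxx.
have [H _ _] := jcoefP la; have [sz /(_ N)] := H _ h.
have le : (plength (psort e) <= N)%N by rewrite (leq_trans (plength_psort _)) ?size_tuple.
rewrite (take_oversize le) -/(psize (psort e)) sz /psize.
rewrite -{1}(cat_take_drop N la) sumn_cat leqNgt -[X in (X < _)%N]addn0 ltn_add2l.
rewrite (drop_nth 0%N) //= addn_gt0.
by rewrite (pnth_gt0 la N) Nl.
Qed.

Lemma p_fun_dhomog rho N : p_fun K rho N \is (psize rho).-homog.
Proof.
rewrite /p_fun /psize; elim: (rho : seq nat) => [|r s IH].
  by rewrite big_nil dhomog1.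
by rewrite big_cons; apply: dhomogM => //; exact: psum_dhomog.
Qed.

Hypothesis char0 : forall k : nat, k.+1%:R != 0 :> K.

(** The given expansion need not be homogeneous. Its component of degree |la| already equals J_la,
    so the other terms sum to 0, and independence of the power sums kills their coefficients. *)
Lemma expand_power_sums la (s : seq intpart) (u : intpart -> K) : uniq s ->
    (forall N, J la N = \sum_(rho <- s) u rho *: p_fun K rho N) ->
  {in s, forall rho, psize rho != psize la -> u rho = 0} /\
  forall D, (psize la <= D)%N -> let F : {mpoly K[D]} :=
      \sum_(rho <- s | psize rho == psize la) u rho *: 'X_[mnmp D rho] in
    F \is (psize la).-homog for mnmwgt /\ forall N, ev N F = J la N.
Proof.
move=> us JE.
have JE' N : J la N = \sum_(rho <- s | psize rho == psize la) u rho *: p_fun K rho N.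
  rewrite -[LHS](pihomog_dE (J_dhomog la N)) JE raddf_sum /= [RHS]big_mkcond.
  apply: eq_bigr => rho _; rewrite linearZ /=; case: eqP => [<-|/eqP ne].
    by rewrite (pihomog_dE (p_fun_dhomog rho N)).
  by rewrite (pihomog_ne0 ne (p_fun_dhomog rho N)) scaler0.
split; last first.
  move=> D lD F; split; first apply: rpred_sum => rho /eqP rl.
    by apply: rpredZ; rewrite dhomogX /= psizeE_mnmwgt ?rl.
  move=> N; rewrite JE' ev_sum; apply: eq_bigr => rho /eqP rl.
  by rewrite evZ ev_mnmp ?rl.
move=> rho rs rl; pose D := \max_(r <- s) psize r.
have sD r : r \in s -> (psize r <= D)%N by move=> h; exact: leq_bigmax_seq.
pose G : {mpoly K[D]} := \sum_(r <- s | psize r != psize la) u r *: 'X_[mnmp D r].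
have G0 : G = 0.
  apply: (ev_inj char0 (leqnn D)); rewrite ev_sum.
  have := JE D; rewrite (bigID (fun r => psize r == psize la)) /= -JE'.
  move/(congr1 (fun z => z - J la D)); rewrite subrr addrAC subrr add0r => E.
  rewrite [RHS]E.
  rewrite big_seq_cond [RHS]big_seq_cond; apply: eq_bigr => r /andP[/sD rD _].
  by rewrite evZ ev_mnmp.
have := congr1 (fun g => g@_(mnmp D rho)) G0; rewrite mcoeff0 raddf_sum /=.
rewrite big_mkcond (bigD1_seq rho) //= rl mcoeffZ mcoeffX eqxx mulr1.
rewrite big_seq_cond big1 ?addr0 // => r /andP[rs' ne]; case: ifP => // _.
rewrite mcoeffZ mcoeffX; case: eqP => [E|_]; last by rewrite mulr0.
by case/eqP: ne; apply: (mnmp_inj _ _ E); exact: sD.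
Qed.

Definition lifts D la (F : {mpoly K[D]}) := forall N, ev N F = J la N.

Lemma lift_exists D la : (psize la <= D)%N ->
  exists2 F : {mpoly K[D]}, F \is (psize la).-homog for mnmwgt & lifts la F.
Proof.
(* Power sum expansions of J_la come with the pairing of two distinct partitions, so an auxiliary mu
   <> la is taken. *)
move=> lD; have [mu ml] : exists mu, la != mu.
  case: (eqVneq la pempty) => [->|ne]; last by exists pempty.
  by exists (pcol 1).
have [/(_ _ _ ml)[s [u [v [us JE _ _]]]] _] := hJ.
by have [_ /(_ D lD)[F1 F2]] := expand_power_sums us JE; eexists; [exact: F1|].
Qed.

(** By [ev_inj] the lifts are the very expansions that witness the pairing, and [form] computes the
    sum attached to them. *)
Lemma lift_orth D' la mu (F G : {mpoly K[D'.+1]}) : psize la = psize mu ->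
    (psize la <= D'.+1)%N -> la != mu -> lifts la F -> lifts mu G ->
  form alpha F G = 0.
Proof.
move=> lm lD ne hF hG.
have [/(_ _ _ ne)[s [u [v [us JE1 JE2 E]]]] _] := hJ.
have [u0 /(_ _ lD)[_ hF']] := expand_power_sums us JE1.
have mD : (psize mu <= D'.+1)%N by rewrite -lm.
have [v0 /(_ _ mD)[_ hG']] := expand_power_sums us JE2.
have inj (P Q : {mpoly K[D'.+1]}) : (forall N, ev N P = ev N Q) -> P = Q.
  move=> PQ; apply/eqP; rewrite -subr_eq0; apply/eqP.
  by apply: (ev_inj char0 (leqnn _)); rewrite evB PQ subrr.
have -> : F = \sum_(rho <- s | psize rho == psize la) u rho *: 'X_[mnmp D'.+1 rho].
  by apply: inj => N; rewrite hF -hF'.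
have -> : G = \sum_(rho <- s | psize rho == psize la) v rho *: 'X_[mnmp D'.+1 rho].
  by apply: inj => N; rewrite hG -hG' lm.
rewrite E form_suml [RHS](bigID (fun rho => psize rho == psize la)) /=.
rewrite [X in _ = _ + X]big_seq_cond [X in _ = _ + X]big1 ?addr0; last first.
  by move=> rho /andP[rs rl]; rewrite u0 // !mul0r.
rewrite big_seq_cond [RHS]big_seq_cond; apply: eq_bigr => rho /andP[rs /eqP rl].
rewrite formZl form_sumr -mulrA -(pweight_mnmp (D := D'.+1)) ?rl //; congr (_ * _).
rewrite big_mkcond (bigD1_seq rho) //= rl eqxx formZr form_mnm mcoeffX eqxx mul1r.
rewrite [X in _ + X]big_seq_cond big1 ?addr0 // => r /andP[rs' ne'].
case: eqP => // rl'; rewrite formZr form_mnm mcoeffX; case: eqP => [E'|_].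
  by case/eqP: ne'; apply: (mnmp_inj _ _ E'); rewrite ?rl' ?rl.
by rewrite mul0r mulr0.
Qed.

End JackCoefficients.

(* This makes the Jack product definite: its weights have the form            *)
(* w * alpha ^+ e. It holds for an indeterminate alpha by evaluation at       *)
(* positive rationals.                                                        *)
Definition anisotropic (K : fieldType) (alpha : K) :=
  forall (I : eqType) (s : seq I) (f : I -> K) (w e : I -> nat),
    (forall i, 0 < w i)%N -> \sum_(i <- s) f i ^+ 2 * ((w i)%:R * alpha ^+ e i) = 0 ->
  {in s, forall i, f i = 0}.

Section Transcendence.
Variables (K : fieldType) (alpha : K).
Hypothesis alpha_free : linfree alpha.

Lemma linfree_neq0 : alpha != 0.
Proof.
by apply/eqP => a0; have /(_ _)[|] := @alpha_free 1 0 0 0; rewrite ?a0 ?mulr0 ?mul0r.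
Qed.

Lemma linfree_char0 k : k.+1%:R != 0 :> K.
Proof.
by apply/eqP => a0; have /(_ _)[|] := @alpha_free 0 k.+1 0 0; rewrite ?a0 ?mul0r.
Qed.

Lemma linfree_comb a b : a%:R * alpha + b%:R = 0 -> a = 0%N /\ b = 0%N.
Proof. by move=> E; apply: alpha_free; rewrite E mul0r addr0. Qed.

End Transcendence.

(** * Jack polynomials as eigenvectors and as an orthogonal basis *)

Section Eigenfunctions.
Variables (K : fieldType) (alpha : K) (J : intpart -> symfun K) (D' : nat).
Hypothesis hJ : is_jack_family alpha J.
Hypothesis alpha_free : linfree alpha.
Hypothesis aniso : anisotropic alpha.
Local Notation D := D'.+1.
Implicit Types (la mu nu rho : intpart) (F G H : {mpoly K[D]}).
Local Notation "d .-wgt" := (d.-homog for mnmwgt) (at level 1).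
Let char0 := linfree_char0 alpha_free.
Let alpha_neq0 := linfree_neq0 alpha_free.

Lemma form_eq0 F : form alpha F F = 0 -> F = 0.
Proof.
move=> F0; apply/mpolyP => m; rewrite mcoeff0.
case: (boolP (m \in msupp F)) => [mF|/memN_msupp_eq0 //].
have := aniso (w := fun m : 'X_{1..D} => \prod_(i < D) (i.+1 ^ m i * (m i)`!)%N)
  (e := mdeg) (s := msupp F) (f := fun m => F@_m); apply => // [m'|].
  by rewrite prodn_gt0 // => i; rewrite muln_gt0 expn_gt0 fact_gt0.
rewrite -[RHS]F0 /form; apply: eq_bigr => m' _; rewrite expr2 /pweight; congr (_ * _).
rewrite natr_prod mdegE -prodrXr -big_split /=; apply: eq_bigr => i _.
by rewrite exprMn natrM natrX; ring.
Qed.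

Lemma jl_exists la : (psize la <= D)%N ->
  exists F : {mpoly K[D]}, (F \is (psize la).-wgt) && (ev D F == J la D).
Proof.
move=> /(lift_exists hJ char0)[F F1 F2]; exists F; rewrite F1 /=; apply/eqP; exact: F2.
Qed.

(* J_la in the power sums p_1, ..., p_D; junk when D < psize la. *)
Definition jl la : {mpoly K[D]} :=
  if @idP (psize la <= D)%N is ReflectT h then xchoose (jl_exists h) else 0.

Lemma jlP la : (psize la <= D)%N -> jl la \is (psize la).-wgt /\ lifts J la (jl la).
Proof.
rewrite /jl; case: {-}_ / idP => // h _; have /andP[W /eqP E] := xchooseP (jl_exists h).
split=> //; have [F F1 F2] := lift_exists hJ char0 h.
suff -> : xchoose (jl_exists h) = F by [].
apply/eqP; rewrite -subr_eq0; apply/eqP; apply: (ev_inj char0 (leqnn D)).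
by rewrite evB E F2 subrr.
Qed.

Lemma jl_wgt la : (psize la <= D)%N -> jl la \is (psize la).-wgt.
Proof. by case/jlP. Qed.

Lemma ev_jl la N : (psize la <= D)%N -> ev N (jl la) = J la N.
Proof. by case/jlP=> _; exact. Qed.

Lemma jl_orth la mu : psize la = psize mu -> (psize la <= D)%N -> la != mu ->
  form alpha (jl la) (jl mu) = 0.
Proof.
move=> lm lD ne; apply: (lift_orth hJ char0 lm lD ne) => N; rewrite ev_jl //.
by rewrite -lm.
Qed.

Lemma ev_mlead d F : F \is d.-wgt -> (d <= D)%N -> F != 0 ->
  exists2 mu, psize mu = d & mlead (ev D F) = mono D mu.
Proof.
move=> hF dD F0; have E0 : ev D F != 0.
  by apply: contraNneq F0 => /(ev_inj char0 (leqnn D)) ->.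
have [mu muD E] := sorted_mono (mlead_msym_sorted (ev_sym D F)).
exists mu => //; rewrite -(mdeg_mono muD) -E.
exact: (dhomog_mf (ev_dhomog D hF) (mlead_supp E0)).
Qed.

(** A nonzero symmetric H has a leading monomial of the form [mono D mu], which a multiple of
    [jl mu] removes as long as [jcoef J mu mu] is nonzero. The induction follows the leading
    monomial. *)
Lemma form_orth_extend d b G : (d <= D)%N ->
    (forall mu, psize mu = d -> (mono D mu < b)%O ->
       jcoef J mu mu != 0 /\ form alpha G (jl mu) = 0) ->
  forall H, H \is d.-wgt -> (forall m, (b <= m)%O -> (ev D H)@_m = 0) ->
  form alpha G H = 0.
Proof.
move=> dD; elim/(@ltmwf D): b => b IH hmu H hH Hb.
case: (eqVneq H 0) => [->|H0]; first by rewrite form0r.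
have [mu md E] := ev_mlead hH dD H0.
have E0 : (ev D H)@_(mono D mu) != 0.
  rewrite -E mleadc_eq0; apply: contraNneq H0 => /(ev_inj char0 (leqnn D)) -> //.
have mb : (mono D mu < b)%O.
  by rewrite ltNge; apply: contraNN E0 => /Hb ->.
have [c0 f0] := hmu mu md mb.
have muD : (psize mu <= D)%N by rewrite md.
set c := (ev D H)@_(mono D mu) / jcoef J mu mu.
have -> : H = (H - c *: jl mu) + c *: jl mu by rewrite subrK.
rewrite formDr formZr f0 mulr0 addr0; apply: (IH (mono D mu) mb).
- by move=> nu nd nm; apply: hmu => //; exact: lt_trans nm mb.
- by apply: rpredB => //; apply: rpredZ; rewrite -md jl_wgt.
have lm : (plength mu <= D)%N by apply: leq_trans muD; exact: plength_le_psize.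
move=> m; rewrite le_eqVlt => /orP[/eqP <-|lt].
  rewrite evB evZ ev_jl // mcoeffB mcoeffZ (J_lead_coef hJ) // /c.
  by rewrite divfK ?subrr.
rewrite evB evZ ev_jl // mcoeffB mcoeffZ (J_lead hJ lm lt) mulr0 subr0.
by apply: mcoeff_gt_mlead; rewrite E.
Qed.

Lemma psort_ones d : psort (ones d) = pcol d.
Proof.
have -> : ones d = mono d (pcol d).
  apply/mnmP => i; rewrite !mnmE nth_nseq ltn_ord //.
by rewrite psort_mono // /plength size_nseq.
Qed.

(** By [ev_ones] the prescribed coefficient |la|! of x_1 ... x_|la| is |la|! times the coefficient
    of p_1^|la|. *)
Lemma theta_jl la : (psize la <= D)%N -> theta (psize la) (jl la) = 1.
Proof.
move=> lD; have := ev_ones (psize la) (jl la); rewrite ev_jl //.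
rewrite (mcoeffJ hJ) // -sumn_mdeg.
have -> : sumn (ones (psize la)) = psize la.
  by rewrite sumn_mdeg mdegE (eq_bigr (fun=> 1%N)) => [|i _]; rewrite ?sum1_card ?card_ord ?mnmE.
rewrite eqxx psort_ones; have [_ _ ->] := jcoefP hJ la => E.
have f0 : ((psize la)`!)%:R != 0 :> K by rewrite -(prednK (fact_gt0 _)) char0.
by apply: (mulfI f0); rewrite mulr1.
Qed.

Lemma jl_neq0 la : (psize la <= D)%N -> jl la != 0.
Proof.
move=> lD; apply: contra_eqN (theta_jl lD) => /eqP ->.
by rewrite /theta mcoeff0 eq_sym oner_eq0.
Qed.

(** Induction on the leading monomial. If the diagonal coefficient were 0, J_la would lie in the
    span of the lower Jack polynomials, to which it is orthogonal; it would be orthogonal to itself,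
    hence 0. The defect R of the eigenvalue equation is orthogonal to the lower ones by
    self-adjointness, and its monomials are all lower by triangularity, so R is orthogonal to itself
    as well. *)
Lemma jack_eigen la : (psize la <= D)%N ->
  jcoef J la la != 0 /\ jackop alpha (jl la) = (2%:R * ctsum alpha la) *: jl la.
Proof.
have [b] : exists b, b = mono D la by exists (mono D la).
elim/(@ltmwf D): b la => b IH la E lD; have lm := leq_trans (plength_le_psize la) lD.
have hmu mu : psize mu = psize la -> (mono D mu < b)%O ->
    jcoef J mu mu != 0 /\ jackop alpha (jl mu) = (2%:R * ctsum alpha mu) *: jl mu.
  by move=> ml lt; apply: (IH _ lt) => //; rewrite ml.
have orth mu : psize mu = psize la -> (mono D mu < b)%O -> form alpha (jl la) (jl mu) = 0.
  move=> ml lt; apply: jl_orth => //; apply: contraTneq lt => <-.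
  by rewrite E ltxx.
have c0 : jcoef J la la != 0.
  apply/eqP => c0; have := jl_neq0 lD; case/eqP; apply: form_eq0.
  apply: (form_orth_extend (b := b) lD _ (jl_wgt lD)).
    by move=> mu ml lt; have [] := hmu mu ml lt; split=> //; exact: orth.
  move=> m; rewrite ev_jl // le_eqVlt E => /orP[/eqP <-|]; first by rewrite (J_lead_coef hJ).
  exact: (J_lead hJ).
split=> //; apply/eqP; rewrite -subr_eq0; apply/eqP; set R := _ - _.
have RW : R \is (psize la).-wgt.
  by apply: rpredB; [apply: jackop_wgt => //|apply: rpredZ]; exact: (jl_wgt lD).
have lb := lbrel_ev alpha_neq0 D (jl_wgt lD) lD.
rewrite ev_jl // (euler_dhomog (J_dhomog hJ la D)) scalerA in lb.
have [above top] := lbrel_lead lb (fun m => @J_lead _ _ _ hJ la D m lm).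
apply: form_eq0; apply: (form_orth_extend (b := b) lD _ RW).
  move=> mu ml lt; have [-> JJ] := hmu mu ml lt; split=> //.
  rewrite /R -scaleN1r scalerA formDl formZl jackop_selfadj // JJ formZr orth //.
  by rewrite !mulr0 addr0.
have ER m : (ev D R)@_m = (ev D (jackop alpha (jl la)))@_m - 2%:R * ctsum alpha la * (J la D)@_m.
  by rewrite evB evZ mcoeffB mcoeffZ ev_jl.
move=> m; rewrite le_eqVlt E => /orP[/eqP <-|lt].
  apply: (mulfI alpha_neq0); rewrite mulr0 ER.
  move: top; rewrite mcoeffD mcoeffZ lbeig_mono // => top.
  transitivity (alpha * ((ev D (jackop alpha (jl la)))@_(mono D la) +
    alpha^-1 * (D%:R - 1) * (psize la)%:R * (J la D)@_(mono D la))
    - alpha * (2 * ctsum alpha la + alpha^-1 * (D%:R - 1) * (psize la)%:R) *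
      (J la D)@_(mono D la)); first by ring.
  by rewrite top subrr.
rewrite ER (J_lead hJ lm lt) mulr0 subr0; apply: (mulfI alpha_neq0); rewrite mulr0.
by rewrite -(above _ lt) mcoeffD mcoeffZ (J_lead hJ lm lt) mulr0 addr0.
Qed.

Definition nrm la : K := form alpha (jl la) (jl la).

Lemma nrm_neq0 la : (psize la <= D)%N -> nrm la != 0.
Proof. by move=> lD; apply: contraNneq (jl_neq0 lD) => /form_eq0 ->. Qed.

Lemma jack_expand d F : F \is d.-wgt -> (d <= D)%N ->
  F = \sum_(la <- partitions_of d) (form alpha F (jl la) / nrm la) *: jl la.
Proof.
move=> hF dD; apply/eqP; rewrite -subr_eq0; apply/eqP; set H := _ - _.
have hH : H \is d.-wgt.
  apply: rpredB => //; rewrite big_seq; apply: rpred_sum => la.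
  by rewrite mem_partitions_of => /eqP ld; apply: rpredZ; rewrite -ld jl_wgt ?ld.
(* x_1^(d+1) exceeds every monomial of degree d, so H satisfies the bound on its monomials for
   free. *)
apply: form_eq0; apply: (form_orth_extend (b := (U_(ord0) *+ d.+1)%MM) dD _ hH); last first.
  move=> m /lemc_mdeg; rewrite mdegMn mdeg1 mul1n => dm.
  apply: (dhomog_nemf_coeff (ev_dhomog D hH)); by rewrite /= gtn_eqF.
move=> mu md _; have mD : (psize mu <= D)%N by rewrite md.
split; first by case: (jack_eigen mD).
rewrite /H -scaleN1r formDl formZl form_suml.
rewrite (bigD1_seq mu) ?parts_uniq ?mem_partitions_of ?md //= formZl -/(nrm mu).
rewrite divfK ?nrm_neq0 // big_seq_cond big1 ?addr0.
  by rewrite mulN1r subrr.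
move=> la /andP[]; rewrite mem_partitions_of => /eqP ld ne; by rewrite formZl jl_orth ?mulr0 ?ld.
Qed.

End Eigenfunctions.

(** * Stripping the first column, and the coefficients kappa and g *)

Lemma preD n (m1 m2 : 'X_{1..n}) k : pre (m1 + m2)%MM k = (pre m1 k + pre m2 k)%N.
Proof. by rewrite /pre -big_split; apply: eq_bigr => i _; rewrite mnmDE. Qed.

Lemma mono_addcol n nu : mono n (addcol n nu) = (ones n + mono n nu)%MM.
Proof.
by apply/mnmP => i; rewrite mnmDE /mono mnmE nth_addcol ltn_ord !mnmE.
Qed.

Lemma gauss_sum (K : comNzRingType) n : 2%:R * (\sum_(i < n) i)%:R = n%:R * (n%:R - 1) :> K.
Proof.
elim: n => [|n IH]; first by rewrite big_ord0 mulr0 mul0r.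
by rewrite big_ord_recr /= natrD mulrDr IH -natr1; ring.
Qed.

Lemma seq_max (T : eqType) (n : nat) (f : T -> 'X_{1..n}) (s : seq T) : s != [::] ->
  exists2 x, x \in s & {in s, forall y, (f y <= f x)%O}.
Proof.
elim: s => // x s IH _; case: (eqVneq s [::]) => [->|/IH[y ys ymax]].
  by exists x; rewrite ?mem_head // => y; rewrite inE => /eqP ->.
case: (leP (f x) (f y)) => xy.
  exists y; first by rewrite inE ys orbT.
  by move=> z; rewrite inE => /orP[/eqP ->|/ymax].
exists x; first exact: mem_head.
move=> z; rewrite inE => /orP[/eqP ->//|/ymax zy].
exact: le_trans zy (ltW xy).
Qed.

Section Pieri.
Variables (K : fieldType) (alpha : K) (J : intpart -> symfun K) (D' : nat).
Hypothesis hJ : is_jack_family alpha J.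
Hypothesis alpha_free : linfree alpha.
Hypothesis aniso : anisotropic alpha.
Local Notation D := D'.+1.
Implicit Types (la mu nu rho : intpart) (F G H : {mpoly K[D]}).
Let alpha_neq0 := linfree_neq0 alpha_free.
Local Notation jl := (jl D' hJ alpha_free).
Local Notation nrm := (nrm D' hJ alpha_free).
Local Notation ctsum := (ctsum alpha).
Local Notation jc la := (jcoef J la la).

Let jc_neq0 la : (psize la <= D)%N -> jc la != 0.
Proof. by move=> lD; case: (jack_eigen hJ alpha_free aniso lD). Qed.

Lemma jack_lbrel la N : (psize la <= D)%N -> lbrel alpha (J la N)
  ((2%:R * ctsum la + alpha^-1 * (N%:R - 1) * (psize la)%:R) *: J la N).
Proof.
move=> lD; have := lbrel_ev alpha_neq0 N (jl_wgt hJ alpha_free lD) lD.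
rewrite ev_jl // (euler_dhomog (J_dhomog hJ la N)).
have [_ ->] := jack_eigen hJ alpha_free aniso lD.
by rewrite evZ ev_jl // scalerA -scalerDl.
Qed.

(* The ratio between J_la and x_1 ... x_n J_nu in n = plength la variables,   *)
(* where nu is la without its first column.                                   *)
Definition stripc la : K := jc la / jc (rmcol la).

Lemma stripc_neq0 la : (psize la <= D)%N -> stripc la != 0.
Proof.
move=> lD; rewrite mulf_neq0 ?invr_eq0 ?jc_neq0 //.
by apply: leq_trans lD; rewrite (psize_rmcol la) leq_addl.
Qed.

Lemma rmcol_empty : rmcol pempty = pempty.
Proof. exact: val_inj. Qed.

Lemma stripc_empty : stripc pempty = 1.
Proof.
rewrite /stripc rmcol_empty divff //.
by have [] := jack_eigen hJ alpha_free aniso (leq0n D : psize pempty <= _)%N.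
Qed.

(** By [lbrel_prodX] both sides are eigenvectors in n variables with the same eigenvalue. A nonzero
    difference would have a leading monomial dominated by that of J_la and with the same eigenvalue,
    hence equal to it by [lbeig_dom_inj]; but [stripc] cancels that coefficient. *)
Lemma jack_strip la : (psize la <= D)%N ->
  J la (plength la) =
    stripc la *: (prodX K (plength la) * J (rmcol la) (plength la)).
Proof.
move=> lD; set n := plength la; set nu := rmcol la.
have nn : (plength nu <= n)%N by exact: plength_rmcol.
have laE : la = addcol n nu by rewrite rmcolK.
have szE : psize la = (n + psize nu)%N by exact: psize_rmcol.
have nD : (psize nu <= D)%N by rewrite (leq_trans _ lD) // szE leq_addl.
apply/eqP; rewrite -subr_eq0; apply/negPn/negP => f0; set f := _ - _ in f0.
pose ep := 2%:R * ctsum la + alpha^-1 * (n%:R - 1) * (psize la)%:R.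
have lb : lbrel alpha f (ep *: f).
  rewrite /f scalerBr -scaleNr -[X in _ + X]scaleN1r -/ep.
  have -> : - ep *: (stripc la *: (prodX K n * J nu n))
     = -1 *: (stripc la *: (ep *: (prodX K n * J nu n))).
    by rewrite !scalerA; congr (_ *: _); ring.
  apply: lbrelD; first exact: jack_lbrel.
  rewrite scaleN1r -scaleN1r; do 2 apply: lbrelZ.
  have := lbrel_prodX (jack_lbrel n nD).
  rewrite (euler_dhomog (J_dhomog hJ nu n)) scalerA -scalerDl -scalerAr.
  congr (lbrel _ _ (_ *: _)).
  have -> : ep = 2%:R * ctsum nu + 2%:R * (psize nu)%:R
      - (2%:R * (\sum_(i < n) i)%:R) / alpha + alpha^-1 * (n%:R - 1) * (psize la)%:R.
    by rewrite /ep {1}laE ctsum_addcol //; ring.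
  by rewrite gauss_sum szE natrD; field.
have sup m : f@_m != 0 -> mdeg m = psize la /\ forall k, (pre m k <= pre (mono n la) k)%N.
  move=> fm; case: (eqVneq ((J la n)@_m) 0) => [z|/(J_support hJ)[-> H]]; last first.
    by split=> // k; rewrite pre_mono.
  move: fm; rewrite mcoeffB z sub0r oppr_eq0 mcoeffZ mulf_eq0 negb_or => /andP[_].
  rewrite prodXE mcoeffXm; case: ifPn => [le|]; last by rewrite eqxx.
  move=> /(J_support hJ)[dm pm]; rewrite -(submK le) addmC mdegD dm szE.
  have -> : mdeg (ones n) = n.
    by rewrite mdegE (eq_bigr (fun=> 1%N)) => [|i _]; rewrite ?sum1_card ?card_ord ?mnmE.
  split=> // k; rewrite laE mono_addcol !preD leq_add2l.
  by rewrite [X in (_ <= X)%N]pre_mono.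
have [_ top] := lbrel_lead lb (@mcoeff_gt_mlead _ _ f).
have fl : f@_(mlead f) != 0 by rewrite mleadc_eq0.
have [dl pl] := sup _ fl.
have E : mlead f = mono n la.
  apply: (lbeig_dom_inj alpha_free _ pl); first by rewrite dl mdeg_mono.
  rewrite lbeig_mono //; apply: (mulIf fl).
  by rewrite -top mcoeffZ mulrA.
case/eqP: fl; rewrite E mcoeffB mcoeffZ (J_lead_coef hJ) //.
rewrite {1}(_ : mono n la = (ones n + mono n nu)%MM); last by rewrite {1}laE mono_addcol.
rewrite prodXE [_ * J nu n]mulrC mcoeffMX (J_lead_coef hJ) //.
by rewrite /stripc divfK ?subrr // jc_neq0.
Qed.

Lemma jack_indep n d (a : intpart -> K) : (d <= D)%N ->
  \sum_(la <- partitions_of d) a la *: J la n = 0 ->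
  forall la, psize la = d -> (plength la <= n)%N -> a la = 0.
Proof.
move=> dD S0 la ld ln; apply/eqP/negPn/negP => ala.
pose s := [seq mu <- partitions_of d | (plength mu <= n)%N && (a mu != 0)].
have s0 : s != [::].
  have : la \in s by rewrite mem_filter ln ala mem_partitions_of ld eqxx.
  by case: s.
have [mu] := seq_max (mono n) s0.
rewrite mem_filter mem_partitions_of => /andP[/andP[mn am] /eqP md] mmax.
have := congr1 (fun p => p@_(mono n mu)) S0.
rewrite mcoeff0 raddf_sum (bigD1_seq mu) ?parts_uniq ?mem_partitions_of ?md //=.
rewrite mcoeffZ (J_lead_coef hJ) // big_seq_cond big1 ?addr0 => [/eqP|nu /andP[]].
  by rewrite mulf_eq0 (negPf am) /= (negPf (jc_neq0 _)) // md.
rewrite mem_partitions_of => /eqP nd ne; rewrite mcoeffZ.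
case: (leqP (plength nu) n) => nn; last by rewrite (J_few_vars hJ nn) mcoeff0 mulr0.
case: (eqVneq (a nu) 0) => [->|an]; first by rewrite mul0r.
have le : (mono n nu <= mono n mu)%O.
  by apply: mmax; rewrite mem_filter nn an mem_partitions_of nd eqxx.
rewrite (J_lead hJ nn) ?mulr0 // lt_neqAle le andbT.
by apply: contraNneq ne => /(mono_inj nn mn) ->.
Qed.

(* The coefficients of J_la in p_1 J_mu and of J_mu in d/dp_1 J_la. *)
Definition kap la mu : K := form alpha ('X_ord0 * jl mu) (jl la) / nrm la.
Definition gdn la mu : K := form alpha (jl la)^`M(ord0) (jl mu) / nrm mu.

Lemma kap_expand mu : (psize mu < D)%N -> 'X_ord0 * jl mu =
  \sum_(la <- partitions_of (psize mu).+1) kap la mu *: jl la.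
Proof.
move=> mD; apply: (jack_expand hJ alpha_free aniso) => //.
by rewrite -(add1n (psize mu)); apply: dhomogM; [exact: X_wgt|apply: jl_wgt; exact: ltnW].
Qed.

Lemma gdn_expand la d : psize la = d.+1 -> (psize la <= D)%N -> (jl la)^`M(ord0) =
  \sum_(mu <- partitions_of d) gdn la mu *: jl mu.
Proof.
move=> ld lD; apply: (jack_expand hJ alpha_free aniso); last by rewrite ltnW -?ld.
by apply: (deriv_wgt (r := ord0)); have := jl_wgt hJ alpha_free lD; rewrite ld.
Qed.

(** Multiplication by p_1 is adjoint to alpha d/dp_1. *)
Lemma kap_gdn la mu : (psize la <= D)%N -> (psize mu <= D)%N ->
  kap la mu * nrm la = alpha * gdn la mu * nrm mu.
Proof.
move=> lD mD; rewrite /kap /gdn divfK ?nrm_neq0 // mulrA divfK ?nrm_neq0 //.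
by rewrite form_adj mul1r formC.
Qed.

Lemma kap_eq0 la mu : (psize la <= D)%N -> (psize mu <= D)%N ->
  (kap la mu == 0) = (gdn la mu == 0).
Proof.
move=> lD mD; have E := kap_gdn lD mD.
have nl := nrm_neq0 hJ alpha_free aniso lD; have nm := nrm_neq0 hJ alpha_free aniso mD.
apply/eqP/eqP => Z.
  move/eqP: E; rewrite Z mul0r eq_sym mulf_eq0 (negPf nm) orbF mulf_eq0 (negPf alpha_neq0).
  by move=> /eqP.
by move/eqP: E; rewrite Z mulr0 mul0r mulf_eq0 (negPf nl) orbF => /eqP.
Qed.

Lemma jack_pieri mu n : (psize mu < D)%N -> psum K 1 n * J mu n =
  \sum_(la <- partitions_of (psize mu).+1) kap la mu *: J la n.
Proof.
move=> mD; rewrite -(ev_jl hJ alpha_free n (ltnW mD)) -[psum K 1 n](evX K n (ord0 : 'I_D)) -evM.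
rewrite kap_expand // ev_sum big_seq [RHS]big_seq; apply: eq_bigr => la.
by rewrite mem_partitions_of => /eqP ld; rewrite evZ ev_jl ?ld.
Qed.

(** Expand p_1 J_mu in n = l(mu) variables twice: directly, and after taking out x_1 ... x_n and
    expanding p_1 J_nu, where nu is mu without its first column. [jack_indep] compares the
    coefficients. *)
Lemma kap_strip la mu : psize la = (psize mu).+1 -> (psize la <= D)%N ->
    (plength la <= plength mu)%N ->
  kap la mu = if plength la == plength mu
    then kap (rmcol la) (rmcol mu) * stripc mu / stripc la else 0.
Proof.
move=> lm lD; set n := plength mu => ln.
have mD : (psize mu < D)%N by rewrite -lm.
set nu := rmcol mu.
have szE : psize mu = (n + psize nu)%N by exact: psize_rmcol.
have nD : (psize nu < D)%N by apply: leq_ltn_trans mD; rewrite szE leq_addl.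
have E : psum K 1 n * J mu n = \sum_(la <- partitions_of (psize mu).+1)
    (if plength la == n then kap (rmcol la) nu * stripc mu / stripc la else 0) *: J la n.
  rewrite (jack_strip (ltnW mD)) -/n -/nu -scalerAr mulrCA jack_pieri // szE.
  rewrite -addnS [RHS](eq_bigr (fun la => if plength la == n then
     (kap (rmcol la) nu * stripc mu / stripc la) *: J la n else 0)); last first.
    by move=> rho _; case: ifP => _ //; rewrite scale0r.
  rewrite -big_mkcond sum_addcol.
  rewrite mulr_sumr scaler_sumr (bigID (fun rho => (plength rho <= n)%N)) /=.
  rewrite [X in _ + X]big1 ?addr0 => [|rho]; last first.
    by rewrite -ltnNge => rn; rewrite (J_few_vars hJ rn) scaler0 mulr0 scaler0.
  rewrite big_seq_cond [RHS]big_seq_cond; apply: eq_bigr => rho /andP[].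
  rewrite mem_partitions_of => /eqP rd rn.
  have aD : (psize (addcol n rho) <= D)%N by rewrite psize_addcol // rd addnS -szE.
  have := jack_strip aD; rewrite plength_addcol addcolK // => ->.
  rewrite scalerA divfK ?stripc_neq0 // -scalerAr scalerA mulrC //.
have := jack_pieri n mD; rewrite E => /eqP; rewrite -subr_eq0 -sumrB.
under eq_bigr do rewrite -scalerBl.
move=> /eqP /(jack_indep _)/(_ la lm ln)/eqP; rewrite subr_eq0 => H.
by apply/esym/eqP; apply: H.
Qed.

(** In n variables d/dp_1 J_la is the derivative of J_la in x_(n+1) at x_(n+1) = 0. By [jack_strip]
    this is a multiple of x_1 ... x_n J_nu, hence of a single Jack polynomial, or 0 when nu still
    has n + 1 rows. *)
Lemma gdn_strip la mu n : plength la = n.+1 -> psize la = (psize mu).+1 ->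
    (psize la <= D)%N -> (plength mu <= n)%N ->
  gdn la mu = if (plength (rmcol la) <= n)%N && (mu == addcol n (rmcol la))
    then stripc la / stripc mu else 0.
Proof.
move=> ln lm lD mn; set nu := rmcol la.
have szE : psize la = (n.+1 + psize nu)%N by rewrite -ln; exact: psize_rmcol.
have nD : (psize nu <= D)%N by apply: leq_trans lD; rewrite szE leq_addl.
have E : ev n (jl la)^`M(ord0) = stripc la *: (prodX K n * J nu n).
  have := jack_strip lD; rewrite ln => Jn.
  rewrite -restr_deriv_ev ev_jl // Jn mderivZ restrZ.
  by rewrite restr_deriv_prodX -(ev_jl hJ alpha_free n.+1 nD) restr_ev ev_jl.
have E1 : \sum_(mu <- partitions_of (psize mu)) gdn la mu *: J mu n
    = stripc la *: (prodX K n * J nu n).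
  rewrite -E (gdn_expand lm lD) ev_sum big_seq [RHS]big_seq; apply: eq_bigr => rho.
  by rewrite mem_partitions_of => /eqP rd; rewrite evZ ev_jl // rd ltnW // -lm.
case: (leqP (plength nu) n) => nn /=; last first.
  move: E1; rewrite (J_few_vars hJ nn) mulr0 scaler0 => /(jack_indep _); apply => //.
  by rewrite ltnW // -lm.
set mu0 := addcol n nu.
have m0d : psize mu0 = psize mu.
  by apply: succn_inj; rewrite -lm szE psize_addcol.
have m0D : (psize mu0 <= D)%N by rewrite m0d ltnW // -lm.
have E2 : \sum_(rho <- partitions_of (psize mu))
     (gdn la rho - (if rho == mu0 then stripc la / stripc mu0 else 0)) *: J rho n = 0.
  under eq_bigr do rewrite scalerBl.
  rewrite sumrB E1 (bigD1_seq mu0) ?parts_uniq ?mem_partitions_of ?m0d //= eqxx.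
  rewrite [X in _ - (_ + X)]big1 ?addr0 => [|rho /negPf ->]; last by rewrite scale0r.
  have := jack_strip m0D; rewrite plength_addcol addcolK // => ->.
  by rewrite scalerA divfK ?stripc_neq0 // subrr.
have mD : (psize mu <= D)%N by rewrite -m0d.
have := jack_indep mD E2 erefl mn; move/eqP; rewrite subr_eq0 => /eqP ->.
by case: eqP => // ->.
Qed.

Lemma kap_plength la mu : psize la = (psize mu).+1 -> (psize la <= D)%N ->
  kap la mu != 0 -> (plength mu <= plength la)%N.
Proof.
move=> lm lD; apply: contraNT; rewrite -ltnNge => lt.
by rewrite kap_strip // ?ltn_eqF // ltnW.
Qed.

(** [kap] and [gdn] vanish together, and [gdn_strip] leaves only one mu shorter than la. *)
Lemma kap_newrow la mu : psize la = (psize mu).+1 -> (psize la <= D)%N ->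
  kap la mu != 0 -> (plength mu < plength la)%N ->
  plength la = (plength mu).+1 /\ rmcol la = rmcol mu.
Proof.
move=> lm lD k0 lt; have mD : (psize mu <= D)%N by rewrite ltnW // -lm.
move: k0; rewrite kap_eq0 //.
case E : (plength la) lt => [//|n]; rewrite ltnS => mn.
rewrite (gdn_strip E) //; case: ifP => [/andP[rn /eqP mE] _|]; last by rewrite eqxx.
by rewrite mE plength_addcol addcolK.
Qed.

Lemma kap_newrow_ct la mu : psize la = (psize mu).+1 -> (psize la <= D)%N ->
  kap la mu != 0 -> (plength mu < plength la)%N ->
  ctsum la - ctsum mu = - (plength mu)%:R / alpha.
Proof.
move=> lm lD k0 lt; have [ll rr] := kap_newrow lm lD k0 lt.
have := ctsum_addcol alpha_neq0 (plength_rmcol mu); rewrite rmcolK => ->.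
have := ctsum_addcol alpha_neq0 (plength_rmcol la); rewrite rmcolK => ->.
by rewrite ll rr big_ord_recr /= natrD; field.
Qed.

Lemma strip_ct la mu : plength la = plength mu -> psize la = (psize mu).+1 ->
  ctsum la - ctsum mu = ctsum (rmcol la) - ctsum (rmcol mu) + 1.
Proof.
move=> ll lm.
have := ctsum_addcol alpha_neq0 (plength_rmcol mu); rewrite rmcolK => ->.
have := ctsum_addcol alpha_neq0 (plength_rmcol la); rewrite rmcolK => ->.
have : psize (rmcol la) = (psize (rmcol mu)).+1.
  by move: lm; rewrite (psize_rmcol la) (psize_rmcol mu) ll -addnS => /addnI.
by rewrite ll => ->; rewrite -natr1; ring.
Qed.

(* A trace of the fact that la is mu plus a box of content ctsum la - ctsum mu. *)
Lemma kap_gpoch_ext (R : fieldType) (iota : {rmorphism K -> R}) la mu (a : R) :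
    psize la = (psize mu).+1 -> (psize la <= D)%N -> kap la mu != 0 ->
  gpoch (iota alpha) a la = gpoch (iota alpha) a mu * (a + iota (ctsum la - ctsum mu)).
Proof.
have [k] := ubnP (psize mu); elim: k la mu a => // k IH la mu a mk lm lD k0.
case: (ltnP (plength mu) (plength la)) => [lt|le].
  have [ll rr] := kap_newrow lm lD k0 lt; rewrite (kap_newrow_ct lm lD k0 lt).
  rewrite -(rmcolK la) ll -{2}(rmcolK mu) rr !gpoch_addcol_left ?plength_rmcol //.
    by rewrite big_ord_recr /= mulrA mulNr rmorphN fmorph_div rmorph_nat.
  by rewrite (leq_trans (plength_rmcol mu)).
have ll : plength la = plength mu by apply/eqP; rewrite eqn_leq le kap_plength.
move: k0; rewrite kap_strip // ll eqxx mulf_eq0 negb_or mulf_eq0 negb_or => /andP[/andP[k0 _] _].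
have lm' : psize (rmcol la) = (psize (rmcol mu)).+1.
  by move: lm; rewrite (psize_rmcol la) (psize_rmcol mu) ll -addnS => /addnI.
have lD' : (psize (rmcol la) <= D)%N by apply: leq_trans lD; rewrite (psize_rmcol la) leq_addl.
have mu0 : (0 < psize mu)%N.
  rewrite lt0n; apply: contra_eqN lm => /eqP m0; rewrite m0.
  move: ll; rewrite (psize_eq0 m0) => /plength_eq0 ->.
  by [].
have mk' : (psize (rmcol mu) < k)%N by apply: leq_trans (rmcol_lt mu0) _.
have := gpoch_addcol_left (iota alpha) a (plength_rmcol la); rewrite rmcolK => ->.
have := gpoch_addcol_left (iota alpha) a (plength_rmcol mu); rewrite rmcolK => ->.
by rewrite (IH _ _ _ mk' lm' lD' k0) ll (strip_ct ll lm) [iota (_ + 1)]rmorphD (rmorph1 iota); ring.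
Qed.

Lemma kap_gpoch la mu a : psize la = (psize mu).+1 -> (psize la <= D)%N ->
  kap la mu != 0 ->
  gpoch alpha a la = gpoch alpha a mu * (a + (ctsum la - ctsum mu)).
Proof. exact: (kap_gpoch_ext idfun). Qed.

End Pieri.

(** * Sum rules, evaluation at (1, ..., 1), and the recursion for the moments *)

Section Moments.
Variables (K : fieldType) (alpha : K) (J : intpart -> symfun K) (D' : nat).
Hypothesis hJ : is_jack_family alpha J.
Hypothesis alpha_free : linfree alpha.
Hypothesis aniso : anisotropic alpha.
Local Notation D := D'.+1.
Implicit Types (la mu nu rho : intpart) (F G H : {mpoly K[D]}).
Let char0 := linfree_char0 alpha_free.
Let alpha_neq0 := linfree_neq0 alpha_free.
Local Notation jl := (jl D' hJ alpha_free).
Local Notation ctsum := (ctsum alpha).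
Local Notation kap := (kap D' hJ alpha_free).
Local Notation gdn := (gdn D' hJ alpha_free).
Local Notation stripc := (stripc J).

Let theta_sum d (a : intpart -> K) k : (d <= D)%N ->
  theta k (\sum_(la <- partitions_of d) a la *: jl la)
   = \sum_(la <- partitions_of d) a la * theta k (jl la).
Proof.
by move=> _; rewrite /theta raddf_sum; apply: eq_bigr => la _; rewrite /= mcoeffZ.
Qed.

(** Compare the coefficients of p_1^(|mu|+1): each Jack polynomial of that degree has coefficient
    1. *)
Lemma sum_kap mu : (psize mu < D)%N ->
  \sum_(la <- partitions_of (psize mu).+1) kap la mu = 1.
Proof.
move=> mD; have := theta_jl hJ alpha_free (ltnW mD).
rewrite -theta_X0 kap_expand // theta_sum // => E; rewrite -[RHS]E.
rewrite big_seq [RHS]big_seq; apply: eq_bigr => la; rewrite mem_partitions_of => /eqP ld.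
by rewrite -ld theta_jl ?mulr1 // ld.
Qed.

Lemma sum_gdn la d : psize la = d.+1 -> (psize la <= D)%N ->
  \sum_(mu <- partitions_of d) gdn la mu = d.+1%:R.
Proof.
move=> ld lD; have := theta_deriv d (jl la); rewrite -{2}ld theta_jl // mulr1.
rewrite (gdn_expand hJ alpha_free aniso ld lD) theta_sum; last by rewrite ltnW -?ld.
move=> <-.
rewrite big_seq [RHS]big_seq; apply: eq_bigr => mu; rewrite mem_partitions_of => /eqP md.
by rewrite -md theta_jl ?mulr1 // md ltnW -?ld.
Qed.

(** [lowerop] is alpha / 2 times the commutator of d/dp_1 with [jackop], whose eigenvalues at la and
    mu differ by twice the difference of the content sums. *)
Lemma lowerop_jl la d : psize la = d.+1 -> (psize la <= D)%N ->
  lowerop (jl la) = \sum_(mu <- partitions_of d)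
    (alpha * (ctsum la - ctsum mu) * gdn la mu) *: jl mu.
Proof.
move=> ld lD; have dD : (d <= D)%N by rewrite ltnW -?ld.
have := mderiv_jackop alpha (jl la).
have [_ ->] := jack_eigen hJ alpha_free aniso lD.
rewrite mderivZ (gdn_expand hJ alpha_free aniso ld lD) jackop_sum.
move/(congr1 (fun z => (alpha / 2%:R) *: (z - \sum_(mu <- partitions_of d)
   jackop alpha (gdn la mu *: jl mu)))).
have c2 : 2%:R != 0 :> K by exact: char0.
rewrite addrAC subrr add0r scalerA mulrA divfK // divff // scale1r => <-.
rewrite scaler_sumr -sumrB scaler_sumr big_seq [RHS]big_seq; apply: eq_bigr => mu.
rewrite mem_partitions_of => /eqP md; have mD : (psize mu <= D)%N by rewrite md.
have [_ Em] := jack_eigen hJ alpha_free aniso mD.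
rewrite jackopZ Em !scalerA -scalerBl scalerA; congr (_ *: _).
by field.
Qed.

(** Pair the expansion of [lowerop (jl la)] with p_1^d, against which every J_mu gives the same
    value. Writing [lowerop] as a commutator and moving [jackop] onto powers of p_1 makes the other
    side a multiple of T, the product of J_la with p_2 p_1^(d-1), and the eigenvalue equation ties T
    to ct(la). *)
Lemma sum_gdn_ct la d : psize la = d.+1 -> (psize la <= D)%N ->
  \sum_(mu <- partitions_of d) gdn la mu * (ctsum la - ctsum mu) = 2%:R * ctsum la.
Proof.
move=> ld lD; have dD : (d <= D)%N by rewrite ltnW -?ld.
have c2 : 2%:R != 0 :> K by exact: char0.
pose T := form alpha (jl la) (pX K D' 1 * 'X_ord0 ^+ d.-1).
have [_ Ej] := jack_eigen hJ alpha_free aniso lD.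
have th : theta d.+1 (jl la) = 1 by rewrite -ld theta_jl.
have E1 : (d.+1 * d)%:R * T = 2%:R * ctsum la * (alpha ^+ d.+1 * (d.+1)`!%:R).
  have := form_X0n alpha d.+1 (jl la); rewrite th mulr1 => <-.
  by rewrite -[RHS]formZl -Ej jackop_selfadj // jackop_X0n formZr.
have E2 : form alpha (lowerop (jl la)) ('X_ord0 ^+ d) = d%:R * T.
  have -> : lowerop (jl la) = (alpha / 2%:R) *: (jackop alpha (jl la))^`M(ord0)
      + (- (alpha / 2%:R)) *: jackop alpha (jl la)^`M(ord0).
    rewrite mderiv_jackop scalerDr scaleNr addrAC subrr add0r scalerA mulrA divfK //.
    by rewrite divff // scale1r.
  have adj F : form alpha F^`M(ord0) ('X_ord0 ^+ d) = form alpha F ('X_ord0 ^+ d.+1) / alpha.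
    rewrite formC exprS [form _ _ ('X_ord0 * _)]formC form_adj formC mul1r.
    by rewrite mulrC mulKf.
  have adj2 : form alpha (jl la)^`M(ord0) (jackop alpha ('X_ord0 ^+ d)) =
      (d * d.-1)%:R * (T / alpha).
    rewrite jackop_X0n formZr /T; case: (d) => [|[|e]]; rewrite ?mul0n ?muln0 ?mul0r //=.
    have -> : pX K D' 1 * 'X_ord0 ^+ e.+1 = 'X_ord0 * (pX K D' 1 * 'X_ord0 ^+ e).
      by rewrite exprS mulrCA.
    rewrite [form _ (jl la) _]formC form_adj mul1r [form alpha _ (jl la)^`M(ord0)]formC.
    by rewrite [_ / alpha]mulrC mulKf.
  rewrite formDl !formZl adj [form _ (jackop _ (jl la)) _]jackop_selfadj //.
  rewrite [form _ (jackop _ (jl la)^`M(ord0)) _]jackop_selfadj // adj2.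
  rewrite jackop_X0n formZr /= -/T.
  case: (d) => [|e] /=; first by rewrite muln0 !mul0r !mulr0 addr0.
  by rewrite !natrM -[e.+2%:R]natr1 -[e.+1%:R]natr1; field; rewrite alpha_neq0 c2.
have := congr1 (fun z => form alpha z ('X_ord0 ^+ d)) (lowerop_jl ld lD).
rewrite E2 form_suml => E3.
have E4 : d%:R * T = (alpha * (alpha ^+ d * d`!%:R)) *
    \sum_(mu <- partitions_of d) gdn la mu * (ctsum la - ctsum mu).
  rewrite E3 mulr_sumr big_seq [RHS]big_seq; apply: eq_bigr => mu.
  rewrite mem_partitions_of => /eqP md; rewrite formZl form_X0n.
  have -> : theta d (jl mu) = 1 by rewrite -{1}md theta_jl // md.
  by rewrite mulr1; ring.
have a0 : alpha * (alpha ^+ d * d`!%:R) != 0.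
  by rewrite !mulf_neq0 ?expf_neq0 // -(prednK (fact_gt0 d)) char0.
apply: (mulfI a0); rewrite -E4; apply: (mulfI (char0 d)).
transitivity ((d.+1 * d)%:R * T); first by rewrite natrM mulrA.
by rewrite E1 exprS factS natrM; ring.
Qed.

Lemma translation_jack la d n : psize la = d.+1 -> (psize la <= D)%N ->
  translation (J la n) = \sum_(mu <- partitions_of d)
    ((n%:R + alpha * (ctsum la - ctsum mu)) * gdn la mu) *: J mu n.
Proof.
move=> ld lD; rewrite -(ev_jl hJ alpha_free n lD) translation_ev.
rewrite (gdn_expand hJ alpha_free aniso ld lD) (lowerop_jl ld lD) -evZ -evD.
rewrite scaler_sumr -big_split ev_sum /= big_seq [RHS]big_seq; apply: eq_bigr => mu.
rewrite mem_partitions_of => /eqP md; rewrite scalerA -scalerDl evZ -mulrDl.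
by rewrite ev_jl // md ltnW -?ld.
Qed.

Lemma jack_empty n : J pempty n = 1.
Proof.
apply/mpolyP => e; rewrite (mcoeffJ hJ) mcoeff1 /=.
have [_ _ c1] := jcoefP hJ pempty; rewrite -[_ == 0%MM]mdeg_eq0.
have -> : psize pempty = 0%N by [].
case: eqP => // e0; rewrite (_ : psort e = pcol 0) //.
by rewrite (@psize_eq0 (psort e)) ?psize_psort ?sumn_mdeg //; apply: val_inj.
Qed.

Lemma kap_gpoch_gdn la mu a : psize la = (psize mu).+1 -> (psize la <= D)%N ->
  gdn la mu * gpoch alpha a la = gdn la mu * (gpoch alpha a mu * (a + (ctsum la - ctsum mu))).
Proof.
move=> lm lD; case: (eqVneq (gdn la mu) 0) => [->|g0]; first by rewrite !mul0r.
have k0 : kap la mu != 0 by rewrite (kap_eq0 hJ alpha_free aniso) // ltnW // -lm.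
by rewrite (kap_gpoch aniso a lm lD k0).
Qed.

(** At (1, ..., 1) the translation operator multiplies by the degree, so [translation_jack] is a
    recursion on |la|. Its factor n + alpha x is alpha times the factor of the added box in the
    Pochhammer symbol at n / alpha, and [sum_gdn] adds up the weights. *)
Lemma jack_one la n : (psize la <= D)%N ->
  (J la n).@[fun _ => 1] = alpha ^+ psize la * gpoch alpha (n%:R / alpha) la.
Proof.
have [d] : exists d, psize la = d by exists (psize la).
elim: d la => [|d IH] la ld lD.
  by rewrite (psize_eq0 ld) jack_empty /= meval1 gpoch_empty mulr1.
apply: (mulfI (char0 d)); rewrite -(translation_one (d := d.+1)); last first.
  by rewrite -ld; exact: (J_dhomog hJ).
rewrite (translation_jack n ld lD) raddf_sum /= -(sum_gdn ld lD) mulr_suml.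
rewrite big_seq [RHS]big_seq; apply: eq_bigr => mu; rewrite mem_partitions_of => /eqP md.
have lm : psize la = (psize mu).+1 by rewrite md.
rewrite mevalZ IH // ?md; last by rewrite ltnW -?ld.
rewrite ld exprS.
transitivity (alpha ^+ d * (alpha * (gdn la mu * gpoch alpha (n%:R / alpha) la))); last by ring.
by rewrite kap_gpoch_gdn //; field.
Qed.

(** [jack_strip] evaluated at (1, ..., 1). *)
Lemma stripc_gpoch la : (psize la <= D)%N -> let n := plength la in
  stripc la * gpoch alpha (n%:R / alpha) (rmcol la)
    = alpha ^+ n * gpoch alpha (n%:R / alpha) la.
Proof.
move=> lD n; have nD : (psize (rmcol la) <= D)%N.
  by apply: leq_trans lD; rewrite (psize_rmcol la) leq_addl.
have := congr1 (meval (fun _ => 1)) (jack_strip hJ alpha_free aniso lD).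
rewrite -/n mevalZ mevalM !jack_one // (psize_rmcol la) -/n exprD.
have -> : (prodX K n).@[fun _ => 1] = 1.
  by rewrite /prodX rmorph_prod big1 // => i _; rewrite /= mevalXU.
rewrite mul1r => E; have a0 : alpha ^+ psize (rmcol la) != 0 by rewrite expf_neq0.
by apply: (mulfI a0); rewrite mulrCA -E; ring.
Qed.

Lemma gpoch_neq0 (p q : nat) la : (plength la <= q)%N || (0 < p)%N && (plength la <= q.+1)%N ->
  gpoch alpha (p%:R + q%:R / alpha) la != 0.
Proof.
move=> h; rewrite (@gpochE _ _ (plength la)) //; apply/prodf_neq0 => i _.
apply/prodf_neq0 => j _; have il := ltn_ord i.
have iq : (i <= q)%N by move: h il; lia.
have -> : p%:R + q%:R / alpha + j%:R - i%:R / alpha = ((p + j)%:R * alpha + (q - i)%:R) / alpha.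
  by rewrite natrB // natrD; field.
rewrite mulf_neq0 ?invr_eq0 //; apply/eqP => /(linfree_comb alpha_free)[].
by move: h il; lia.
Qed.

(** By [stripc_gpoch] the ratio of the factors [stripc] in [kap_strip] is a ratio of Pochhammer
    symbols at n / alpha, in which only the added box survives. *)
Lemma kap_strip_ct la mu : psize la = (psize mu).+1 -> (psize la <= D)%N ->
    plength la = plength mu -> let n := plength mu in
  let c := ctsum la - ctsum mu in let c' := ctsum (rmcol la) - ctsum (rmcol mu) in
  kap la mu * (c + n%:R / alpha) = kap (rmcol la) (rmcol mu) * (c' + n%:R / alpha).
Proof.
move=> lm lD ll n c c'; have mD : (psize mu <= D)%N by rewrite ltnW // -lm.
have lm' : psize (rmcol la) = (psize (rmcol mu)).+1.
  by move: lm; rewrite (psize_rmcol la) (psize_rmcol mu) ll -addnS => /addnI.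
have lD' : (psize (rmcol la) <= D)%N by apply: leq_trans lD; rewrite (psize_rmcol la) leq_addl.
have kE := kap_strip hJ alpha_free aniso lm lD (eq_leq ll); rewrite ll eqxx /= in kE.
case: (eqVneq (kap (rmcol la) (rmcol mu)) 0) => [k0|k0].
  by rewrite kE k0 !mul0r.
have sl := stripc_neq0 hJ alpha_free aniso lD.
have sm := stripc_neq0 hJ alpha_free aniso mD.
have k1 : kap la mu != 0 by rewrite kE mulf_neq0 ?invr_eq0 // mulf_neq0.
have Sl := stripc_gpoch lD; have Sm := stripc_gpoch mD; rewrite /= ll -/n in Sl Sm.
have G1 := kap_gpoch aniso (n%:R / alpha) lm lD k1.
have G2 := kap_gpoch aniso (n%:R / alpha) lm' lD' k0.
have gn rho : (plength rho <= n)%N -> gpoch alpha (n%:R / alpha) rho != 0.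
  by move=> h; have := @gpoch_neq0 0 n rho; rewrite add0r h; apply.
have g1 := gn (rmcol mu) (plength_rmcol mu); have g2 := gn mu (leqnn n).
have an0 : alpha ^+ n != 0 by rewrite expf_neq0.
have E : stripc la * (c' + n%:R / alpha) = stripc mu * (c + n%:R / alpha).
  apply: (mulIf g1); apply: (mulIf (mulf_neq0 an0 g2)).
  transitivity (stripc la * (gpoch alpha (n%:R / alpha) (rmcol mu) * (n%:R / alpha + c'))
     * (alpha ^+ n * gpoch alpha (n%:R / alpha) mu)); first by ring.
  transitivity (alpha ^+ n * gpoch alpha (n%:R / alpha) mu
     * (stripc mu * gpoch alpha (n%:R / alpha) (rmcol mu)) * (n%:R / alpha + c)).
    by rewrite -G2 Sl G1 Sm -/c; ring.
  by ring.
by rewrite kE; apply: (mulIf sl); rewrite mulrAC divfK // -mulrA -E; ring.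
Qed.

(** The factor x + n / alpha vanishes for la with a new row and, on the right, for rho with more
    than n rows. The remaining partitions correspond under removal of the first column and are
    matched by [kap_strip_ct]; removal lowers the content of the added box by 1, whence the shift in
    h. *)
Lemma moment_strip mu (h : K -> K) : (psize mu < D)%N ->
  let n := plength mu in let nu := rmcol mu in
  \sum_(la <- partitions_of (psize mu).+1)
      kap la mu * (h (ctsum la - ctsum mu) * (ctsum la - ctsum mu + n%:R / alpha))
  = \sum_(rho <- partitions_of (psize nu).+1)
      kap rho nu * (h (ctsum rho - ctsum nu + 1) * (ctsum rho - ctsum nu + n%:R / alpha)).
Proof.
move=> mD n nu; have szE : psize mu = (n + psize nu)%N by exact: psize_rmcol.
rewrite (bigID (fun la => plength la == n)) /= addrC big_seq_cond big1 ?add0r; last first.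
  move=> la /andP[]; rewrite mem_partitions_of => /eqP ld ne.
  have lD : (psize la <= D)%N by rewrite ld.
  case: (eqVneq (kap la mu) 0) => [->|k0]; first by rewrite mul0r.
  have lt : (plength mu < plength la)%N.
    by rewrite ltn_neqAle eq_sym ne (kap_plength aniso ld lD k0).
  rewrite (kap_newrow_ct aniso ld lD k0 lt) mulNr addNr.
  by rewrite !mulr0.
rewrite szE -addnS sum_addcol.
rewrite [RHS](bigID (fun rho => (plength rho <= n)%N)) /= addrC.
rewrite [X in _ = X + _]big_seq_cond [X in _ = X + _]big1 ?add0r; last first.
  move=> rho /andP[]; rewrite mem_partitions_of -ltnNge => /eqP rd rn.
  have rD : (psize rho <= D)%N by rewrite rd; move: mD; rewrite szE; lia.
  case: (eqVneq (kap rho nu) 0) => [->|k0]; first by rewrite mul0r.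
  have nn : (plength nu <= n)%N by exact: plength_rmcol.
  have lt : (plength nu < plength rho)%N by exact: leq_ltn_trans nn rn.
  have [ln _] := kap_newrow aniso rd rD k0 lt.
  rewrite (kap_newrow_ct aniso rd rD k0 lt).
  have -> : plength nu = n by apply/eqP; rewrite eqn_leq nn /= -ltnS -ln.
  by rewrite mulNr addNr !mulr0.
rewrite big_seq_cond [RHS]big_seq_cond; apply: eq_bigr => rho /andP[].
rewrite mem_partitions_of => /eqP rd rn.
have ld : psize (addcol n rho) = (psize mu).+1 by rewrite psize_addcol // rd addnS -szE.
have lD : (psize (addcol n rho) <= D)%N by rewrite ld.
have ll : plength (addcol n rho) = plength mu by rewrite plength_addcol.
have := kap_strip_ct ld lD ll; rewrite /= addcolK // -/nu -/n => kE.
rewrite (strip_ct alpha_free ll ld) addcolK // in kE *.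
by rewrite mulrCA kE mulrCA.
Qed.

End Moments.

(** * Moments of order at most three, and the recursion for the norm *)

Section Norm.
Variables (K : fieldType) (alpha : K) (J : intpart -> symfun K) (D' : nat).
Hypothesis hJ : is_jack_family alpha J.
Hypothesis alpha_free : linfree alpha.
Hypothesis aniso : anisotropic alpha.
Local Notation D := D'.+1.
Implicit Types (la mu nu rho : intpart) (F G H : {mpoly K[D]}).
Let alpha_neq0 := linfree_neq0 alpha_free.
Local Notation jl := (jl D' hJ alpha_free).
Local Notation nrm := (nrm D' hJ alpha_free).
Local Notation ctsum := (ctsum alpha).
Local Notation kap := (kap D' hJ alpha_free).
Local Notation gdn := (gdn D' hJ alpha_free).
Local Notation stripc := (stripc J).

Definition moment mu k := \sum_(la <- partitions_of (psize mu).+1)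
  kap la mu * (ctsum la - ctsum mu) ^+ k.

Lemma moment0 mu : (psize mu < D)%N -> moment mu 0 = 1.
Proof.
move=> mD; rewrite -(sum_kap hJ alpha_free aniso mD).
by apply: eq_bigr => la _; rewrite expr0 mulr1.
Qed.

Lemma ctsum_rmcol mu : let n := plength mu in
  ctsum mu = ctsum (rmcol mu) + (psize (rmcol mu))%:R - (\sum_(i < n) i)%:R / alpha.
Proof.
by move=> n; rewrite -{1}(rmcolK mu) ctsum_addcol // plength_rmcol.
Qed.

(** In [moment_strip], h = 1, x and x^2 express the moments of order 1, 2 and 3 of mu through lower
    ones and those of mu without its first column. For empty mu the only box has content 0. *)
Lemma kap_moments mu : (psize mu < D)%N ->
  [/\ moment mu 1 = 0, moment mu 2 = (psize mu)%:R / alpha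
    & moment mu 3 = (2%:R * ctsum mu + (1 - alpha^-1) * (psize mu)%:R) / alpha].
Proof.
have [k] := ubnP (psize mu); elim: k mu => // k IH mu mk mD.
case: (posnP (psize mu)) => [m0|mp].
  have E0 : mu = pempty by exact: psize_eq0.
  have z j : moment mu j.+1 = 0.
    rewrite /moment big_seq big1 // => la; rewrite mem_partitions_of => /eqP ld.
    case: (eqVneq (kap la mu) 0) => [->|k0]; first by rewrite mul0r.
    have lD : (psize la <= D)%N by rewrite ld.
    have lt : (plength mu < plength la)%N.
      rewrite {1}E0 lt0n; apply: contra_eqN ld => /eqP/plength_eq0 ->.
      by [].
    rewrite (kap_newrow_ct aniso ld lD k0 lt) E0 oppr0 mul0r expr0n mulr0 //.
  rewrite !z m0 mul0r mulr0 addr0 E0 (ctsumE alpha (la := pempty) (leqnn 0%N)).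
  rewrite !big_ord0 mul0r subr0 mulr0 mul0r.
  by [].
set n := plength mu; set nu := rmcol mu.
have szE : psize mu = (n + psize nu)%N by exact: psize_rmcol.
have ltn : (psize nu < psize mu)%N by exact: rmcol_lt.
have nD : (psize nu < D)%N by exact: ltn_trans ltn mD.
have [n1 n2 n3] := IH nu (leq_trans ltn mk) nD.
have n0 := moment0 nD; have m0 := moment0 mD.
have rec := fun h => moment_strip hJ alpha_free aniso h mD.
pose x := n%:R / alpha.
have r1 : moment mu 1 + x * moment mu 0 = moment nu 1 + x * moment nu 0.
  have := rec (fun=> 1); rewrite /= -/n -/nu -/x => E.
  rewrite /moment !mulr_sumr -!big_split /=; apply: etrans (etrans E _);
  by apply: eq_bigr => la _; ring.
have r2 : moment mu 2 + x * moment mu 1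
    = moment nu 2 + (1 + x) * moment nu 1 + x * moment nu 0.
  have := rec (fun c => c); rewrite /= -/n -/nu -/x => E.
  rewrite /moment !mulr_sumr -!big_split /=; apply: etrans (etrans E _);
  by apply: eq_bigr => la _; ring.
have r3 : moment mu 3 + x * moment mu 2
    = moment nu 3 + (2%:R + x) * moment nu 2 + (1 + 2%:R * x) * moment nu 1 + x * moment nu 0.
  have := rec (fun c => c ^+ 2); rewrite /= -/n -/nu -/x => E.
  rewrite /moment !mulr_sumr -!big_split /=; apply: etrans (etrans E _);
  by apply: eq_bigr => la _; ring.
have e1 : moment mu 1 = 0.
  by move: r1; rewrite m0 n0 n1 => /addIr.
have e2 : moment mu 2 = (psize mu)%:R / alpha.
  rewrite e1 n1 n2 n0 !mulr0 !addr0 mulr1 in r2; rewrite r2 /x szE natrD.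
  by field.
split=> //; rewrite e2 n1 n2 n3 n0 in r3.
rewrite -[LHS](addrK (x * ((psize mu)%:R / alpha))) r3.
have gs := gauss_sum K n.
transitivity ((2%:R * (ctsum nu + (psize nu)%:R) + n%:R - n%:R * n%:R / alpha
   + (1 - alpha^-1) * (psize nu)%:R) / alpha).
  by rewrite /x szE natrD; field.
rewrite (ctsum_rmcol mu) -/n -/nu szE natrD.
have -> : 2%:R * (ctsum nu + (psize nu)%:R - (\sum_(i < n) i)%:R / alpha)
  = 2%:R * (ctsum nu + (psize nu)%:R) - (2%:R * (\sum_(i < n) i)%:R) / alpha by ring.
by rewrite gs; field.
Qed.

(* The factors of jnorm in the first column of la, of which the other half    *)
(* is stripc la.                                                              *)
Definition hookc la : K :=
  \prod_(i < plength la) ((nth 0%N la i)%:R * alpha + (plength la - i.+1)%:R).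

(** The added row ends at 1 + (n - 1) / alpha give exactly [hookc], up to alpha^n. So [hookc] obeys
    the relation of [stripc_gpoch], at another point. *)
Lemma hookc_gpoch la : let n := plength la in let x := 1 + (n.-1)%:R / alpha in
  hookc la * gpoch alpha x (rmcol la) = alpha ^+ n * gpoch alpha x la.
Proof.
move=> n x; have := gpoch_addcol_right alpha x (plength_rmcol la).
rewrite rmcolK => ->; rewrite -/n mulrCA mulrC; congr (_ * _).
rewrite /hookc -/n.
have -> : alpha ^+ n = \prod_(i < n) alpha by rewrite prodr_const card_ord.
rewrite -big_split /=; apply: eq_bigr => i _; rewrite nth_rmcol.
have il : (i < plength la)%N := ltn_ord i.
rewrite -[in LHS](prednK (_ : 0 < nth 0 la i)%N) ?pnth_gt0 // /x.
have -> : (n - i.+1 = n.-1 - i)%N by rewrite -subn1 -subnDA add1n.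
rewrite natrB; last by rewrite -ltnS prednK // (leq_ltn_trans _ il).
by rewrite -natr1; field.
Qed.

Lemma hookc_neq0 la : hookc la != 0.
Proof.
apply/prodf_neq0 => i _; apply/eqP => /(linfree_comb alpha_free)[].
by have := ltn_ord i; rewrite -pnth_gt0; case: nth.
Qed.

Lemma nrm_empty : nrm pempty = 1.
Proof.
have h : (1 : {mpoly K[D]}) \is 0.-homog for mnmwgt by exact: dhomog1.
have := jack_expand hJ alpha_free aniso h (leq0n D) => E.
have t0 : theta 0 (jl pempty) = 1 by have := theta_jl hJ alpha_free (leq0n D : psize pempty <= _)%N.
have p0 : \sum_(la <- partitions_of 0) (form alpha 1 (jl la) / nrm la) *: jl la
   = (form alpha 1 (jl pempty) / nrm pempty) *: jl pempty.
  rewrite (bigD1_seq pempty) ?parts_uniq ?mem_partitions_of //= big_seq_cond big1 ?addr0 //.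
  move=> la /andP[]; rewrite mem_partitions_of => /eqP /psize_eq0 ->.
  by rewrite eqxx.
have f1 : form alpha 1 (jl pempty) = 1.
  by rewrite formC -(expr0 'X_ord0) form_X0n t0 expr0 fact0 !mul1r.
have tZ (a : K) F : theta 0 (a *: F) = a * theta 0 F by rewrite /theta mcoeffZ.
have t1 : theta 0 (1 : {mpoly K[D]}) = 1 by rewrite /theta mulm0n mcoeff1 eqxx.
have := congr1 (theta 0) E; rewrite p0 f1 tZ t0 t1 mulr1 mul1r => /(congr1 (fun z => z^-1)).
by rewrite invrK invr1.
Qed.

(** With q = (n - 1) / alpha the weight c(mu) + q vanishes on every mu shorter than la. By the
    hypothesis on smaller partitions, each other term is beta / hookc(la) times the matching term
    for nu, with q + 2 in place of q. Both sums are known from [sum_gdn] and [sum_gdn_ct]; they are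
    equal and nonzero, so beta = hookc(la). *)
Lemma gdn_moment_strip la : (psize la <= D)%N -> (0 < psize (rmcol la))%N ->
    (forall mu, (psize mu < psize la)%N -> nrm mu = nrm (rmcol mu) * stripc mu * hookc mu) ->
  nrm la = nrm (rmcol la) * stripc la * hookc la.
Proof.
move=> lD np IH; set n := plength la; set nu := rmcol la.
have szE : psize la = (n + psize nu)%N by exact: psize_rmcol.
have nD : (psize nu <= D)%N by apply: leq_trans lD; rewrite szE leq_addl.
have n_gt0 : (0 < n)%N.
  rewrite lt0n; apply: contraTneq np => /plength_eq0 E.
  by rewrite E.
case E : (psize nu) => [|e]; first by move: np; rewrite -/nu E.
have ld : psize la = (n + e).+1 by rewrite szE E addnS.
pose q := (n.-1)%:R / alpha.
pose c mu := ctsum la - ctsum mu; pose c' rho := ctsum nu - ctsum rho.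
pose beta := nrm la / (nrm nu * stripc la).
have S1 : \sum_(mu <- partitions_of (n + e)) gdn la mu * (c mu + q)
    = 2%:R * ctsum la + q * (psize la)%:R.
  under eq_bigr do rewrite mulrDr.
  rewrite big_split /= (sum_gdn_ct hJ alpha_free aniso ld lD) -mulr_suml.
  by rewrite (sum_gdn hJ alpha_free aniso ld lD) ld [_ * q]mulrC.
have S2 : \sum_(rho <- partitions_of e) gdn nu rho * (c' rho + (q + 2%:R))
    = 2%:R * ctsum nu + (q + 2%:R) * (psize nu)%:R.
  under eq_bigr do rewrite mulrDr.
  rewrite big_split /= (sum_gdn_ct hJ alpha_free aniso E nD) -mulr_suml.
  by rewrite (sum_gdn hJ alpha_free aniso E nD) E [_ * (q + _)]mulrC.
have S3 : \sum_(mu <- partitions_of (n + e)) gdn la mu * (c mu + q)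
   = (beta / hookc la) * \sum_(rho <- partitions_of e) gdn nu rho * (c' rho + (q + 2%:R)).
  rewrite (bigID (fun mu => plength mu == n)) /= addrC big_seq_cond big1 ?add0r; last first.
    move=> mu /andP[]; rewrite mem_partitions_of => /eqP md ne.
    have lm : psize la = (psize mu).+1 by rewrite md.
    have mD : (psize mu <= D)%N by rewrite ltnW // -lm.
    case: (eqVneq (gdn la mu) 0) => [->|g0]; first by rewrite mul0r.
    have k0 : kap la mu != 0 by rewrite (kap_eq0 hJ alpha_free aniso).
    have lt : (plength mu < plength la)%N.
      by rewrite ltn_neqAle ne (kap_plength aniso lm lD k0).
    have [ln _] := kap_newrow aniso lm lD k0 lt.
    by rewrite /c (kap_newrow_ct aniso lm lD k0 lt) /q /n ln mulNr addNr mulr0.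
  rewrite sum_addcol [in RHS](bigID (fun rho => (plength rho <= n)%N)) /=.
  rewrite [X in _ = _ * (_ + X)]big_seq_cond [X in _ = _ * (_ + X)]big1 ?addr0; last first.
    move=> rho /andP[]; rewrite mem_partitions_of -ltnNge => /eqP rd rn.
    have lm : psize nu = (psize rho).+1 by rewrite rd.
    have rD : (psize rho <= D)%N by rewrite ltnW // -lm.
    case: (eqVneq (gdn nu rho) 0) => [->|g0]; first by rewrite mul0r.
    have k0 : kap nu rho != 0 by rewrite (kap_eq0 hJ alpha_free aniso).
    have := kap_plength aniso lm nD k0; rewrite leqNgt => /negP[].
    exact: leq_ltn_trans (plength_rmcol la) rn.
  rewrite mulr_sumr big_seq_cond [RHS]big_seq_cond; apply: eq_bigr => rho /andP[].
  rewrite mem_partitions_of => /eqP rd rn; set mu := addcol n rho.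
  have md : psize mu = (n + e)%N by rewrite psize_addcol // rd.
  have lm : psize la = (psize mu).+1 by rewrite md.
  have mD : (psize mu <= D)%N by rewrite ltnW // -lm.
  have ll : plength la = plength mu by rewrite plength_addcol.
  have lm' : psize nu = (psize rho).+1 by rewrite rd.
  have rD : (psize rho <= D)%N by rewrite ltnW // -lm'.
  have rmE : rmcol mu = rho by rewrite addcolK.
  have := kap_strip hJ alpha_free aniso lm lD (eq_leq ll); rewrite ll eqxx rmE -/nu => kE.
  have nm : nrm mu = nrm rho * stripc mu * hookc mu by rewrite IH ?rmE // lm.
  have nl0 := nrm_neq0 hJ alpha_free aniso lD.
  have nn0 := nrm_neq0 hJ alpha_free aniso nD.
  have nr0 := nrm_neq0 hJ alpha_free aniso rD.
  have nm0 := nrm_neq0 hJ alpha_free aniso mD.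
  have sl := stripc_neq0 hJ alpha_free aniso lD.
  have sm := stripc_neq0 hJ alpha_free aniso mD.
  have hl := hookc_neq0 la; have hm := hookc_neq0 mu.
  have G1 := kap_gdn hJ alpha_free aniso lD mD.
  have G2 := kap_gdn hJ alpha_free aniso nD rD.
  have gE : gdn la mu * hookc mu = beta * gdn nu rho.
    apply: (mulfI alpha_neq0); apply: (mulIf nr0); apply: (mulIf sm).
    transitivity (alpha * gdn la mu * nrm mu); first by rewrite nm; ring.
    rewrite -G1 kE.
    transitivity (beta * (alpha * gdn nu rho * nrm rho) * stripc mu); last by ring.
    rewrite -G2 /beta; field; by rewrite sl nn0.
  case: (eqVneq (gdn nu rho) 0) => [g0|g0].
    move: gE; rewrite g0 mulr0 mul0r mulr0 => /eqP; rewrite mulf_eq0 (negPf hm) orbF => /eqP ->.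
    by rewrite mul0r.
  have k0' : kap nu rho != 0 by rewrite (kap_eq0 hJ alpha_free aniso).
  have k0 : kap la mu != 0 by rewrite kE mulf_neq0 ?invr_eq0 // mulf_neq0.
  pose x := 1 + q.
  have P1 := kap_gpoch aniso x lm lD k0.
  have P2 := kap_gpoch aniso x lm' nD k0'.
  have H1 := hookc_gpoch la; have H2 := hookc_gpoch mu.
  rewrite /= -ll rmE -/n -/q -/x -/nu in H1 H2.
  have gx rho' : (plength rho' <= n)%N -> gpoch alpha x rho' != 0.
    move=> h; apply: (gpoch_neq0 alpha_free (p := 1)).
    by rewrite /= prednK // h orbT.
  have g1 := gx rho rn; have g2 : gpoch alpha x mu != 0 by rewrite gx // plength_addcol.
  have an0 : alpha ^+ n != 0 by rewrite expf_neq0.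
  have cE : c mu = c' rho + 1.
    by rewrite /c (strip_ct alpha_free ll lm) rmE.
  (* Since c = c' + 1, the added box at x = 1 + q contributes c + q to the stripped pair and c' + q
     + 2 to the pair (la, mu). *)
  have hE : hookc la * (c mu + q) = hookc mu * (c' rho + (q + 2%:R)).
    apply: (mulIf g1); apply: (mulIf (mulf_neq0 an0 g2)).
    transitivity ((hookc la * (gpoch alpha x rho * (x + c' rho))) * (alpha ^+ n * gpoch alpha x mu)).
      by rewrite /x cE; ring.
    rewrite -P2 H1 P1 -/(c mu).
    transitivity (alpha ^+ n * gpoch alpha x mu * (hookc mu * gpoch alpha x rho) * (x + c mu)).
      by rewrite H2; ring.
    by rewrite /x cE; ring.
  apply: (mulIf hm); apply: (mulIf hl).
  transitivity (gdn la mu * hookc mu * (hookc la * (c mu + q))); first by ring.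
  by rewrite gE hE; field.
have eqS : 2%:R * ctsum la + q * (psize la)%:R = 2%:R * ctsum nu + (q + 2%:R) * (psize nu)%:R.
  rewrite (ctsum_rmcol la) -/n -/nu szE natrD.
  have -> : 2%:R * (ctsum nu + (psize nu)%:R - (\sum_(i < n) i)%:R / alpha)
    = 2%:R * (ctsum nu + (psize nu)%:R) - (2%:R * (\sum_(i < n) i)%:R) / alpha by ring.
  by rewrite gauss_sum /q -[in n%:R](prednK n_gt0) -natr1; field.
(* The coefficient 2 A + 2 |nu| of alpha is positive because nu is not empty. *)
have S0 : 2%:R * ctsum nu + (q + 2%:R) * (psize nu)%:R != 0.
  apply/eqP => Z; set A := (\sum_(i < plength nu) 'C(nth 0 nu i, 2))%N.
  set B := (\sum_(i < plength nu) i * nth 0 nu i)%N.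
  have /alpha_free[] : (2 * A + 2 * psize nu)%:R * alpha + (n.-1 * psize nu)%:R
     = 0%:R * alpha + (2 * B)%:R.
    have Z' : ((2 * A + 2 * psize nu)%:R * alpha + (n.-1 * psize nu)%:R - (2 * B)%:R) / alpha = 0.
      by rewrite -[RHS]Z (ctsumE alpha (leqnn (plength nu))) -/A -/B /q !natrD !natrM; field.
    move/eqP: Z'; rewrite mulf_eq0 invr_eq0 (negPf alpha_neq0) orbF subr_eq0 => /eqP ->.
    by rewrite mul0r add0r.
  by rewrite E; lia.
have bE : beta = hookc la.
  move: S3; rewrite S1 S2 eqS => /eqP; rewrite -{1}[_ + _ * _]mul1r => /eqP/(mulIf S0) h.
  by rewrite -[RHS]mul1r h divfK // hookc_neq0.
rewrite -bE /beta mulrC divfK // mulf_neq0 ?(nrm_neq0 hJ alpha_free aniso) //.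
exact: (stripc_neq0 hJ alpha_free aniso).
Qed.

End Norm.

(** * The norm of columns, and of all Jack polynomials *)

Section HookNorm.
Variables (K : fieldType) (alpha : K) (J : intpart -> symfun K) (D' : nat).
Hypothesis hJ : is_jack_family alpha J.
Hypothesis alpha_free : linfree alpha.
Hypothesis aniso : anisotropic alpha.
Local Notation D := D'.+1.
Implicit Types (la mu nu rho : intpart) (F G H : {mpoly K[D]}).
Let alpha_neq0 := linfree_neq0 alpha_free.
Local Notation nrm := (nrm D' hJ alpha_free).
Local Notation ctsum := (ctsum alpha).
Local Notation kap := (kap D' hJ alpha_free).
Local Notation gdn := (gdn D' hJ alpha_free).
Local Notation stripc := (stripc J).

Lemma hookc_empty : hookc alpha pempty = 1.
Proof. by rewrite /hookc big_ord0. Qed.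

Lemma rmcol_addcol_empty k : rmcol (addcol k pempty) = pempty.
Proof. by rewrite addcolK. Qed.

Lemma hookc_column k :
  hookc alpha (addcol k.+1 pempty) = (alpha + k%:R) * hookc alpha (addcol k pempty).
Proof.
have H m : hookc alpha (addcol m pempty) = \prod_(i < m) (alpha + (m - i.+1)%:R).
  rewrite /hookc plength_addcol; apply: eq_bigr => i _.
  by rewrite nth_addcol ltn_ord nth_nil mul1r.
by rewrite !H big_ord_recl subn1.
Qed.

(** The moment of order 0 minus the moment of order 1 is the sum of kap (1 - x). Apart from the
    longer column, the box can only open a second column; then its content is 1 and the term drops
    out. *)
Lemma kap_column k : (k < D)%N ->
  kap (addcol k.+1 pempty) (addcol k pempty) * (1 + k%:R / alpha) = 1.
Proof.
move=> kD; set la := addcol k.+1 _; set mu := addcol k _.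
have md : psize mu = k by rewrite psize_addcol // addn0.
have ld : psize la = (psize mu).+1 by rewrite psize_addcol // addn0 md.
have mD : (psize mu < D)%N by rewrite md.
have lD : (psize la <= D)%N by rewrite ld.
have ctE : ctsum la - ctsum mu = - k%:R / alpha.
  by rewrite !ctsum_addcol // big_ord_recr /= natrD; field.
have [m1 _ _] := kap_moments hJ alpha_free aniso mD.
have m0 := moment0 hJ alpha_free aniso mD.
have : \sum_(rho <- partitions_of (psize mu).+1)
    kap rho mu * (1 - (ctsum rho - ctsum mu)) = 1.
  rewrite -[RHS]subr0 -[X in _ = X - _]m0 -[X in _ = _ - X]m1 /moment -sumrB; apply: eq_bigr => rho _.
  by rewrite expr0 expr1 -mulrBr.
rewrite (bigD1_seq la) ?parts_uniq ?mem_partitions_of ?ld //= ctE big_seq_cond big1 ?addr0.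
  by rewrite mulNr opprK.
move=> rho /andP[]; rewrite mem_partitions_of => /eqP rd ne.
have rD : (psize rho <= D)%N by rewrite rd.
case: (eqVneq (kap rho mu) 0) => [->|k0]; first by rewrite mul0r.
case: (ltnP (plength mu) (plength rho)) => [lt|le].
  have [rl rr] := kap_newrow aniso rd rD k0 lt.
  case/eqP: ne; rewrite -(rmcolK rho) rl rr rmcol_addcol_empty.
  by rewrite plength_addcol.
have ll : plength rho = plength mu.
  by apply/eqP; rewrite eqn_leq le (kap_plength aniso rd rD k0).
have rd' : psize (rmcol rho) = (psize (rmcol mu)).+1.
  by move: rd; rewrite (psize_rmcol rho) (psize_rmcol mu) ll -addnS => /addnI.
have rD' : (psize (rmcol rho) <= D)%N.
  by apply: leq_trans rD; rewrite (psize_rmcol rho) leq_addl.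
have := kap_strip hJ alpha_free aniso rd rD le; rewrite ll eqxx => kE.
have k0' : kap (rmcol rho) (rmcol mu) != 0.
  by apply: contraNneq k0; rewrite kE => ->; rewrite !mul0r.
have lt' : (plength (rmcol mu) < plength (rmcol rho))%N.
  rewrite rmcol_addcol_empty lt0n; apply: contra_eqN rd' => /eqP/plength_eq0 ->.
  by [].
rewrite (strip_ct alpha_free ll rd) (kap_newrow_ct aniso rd' rD' k0' lt').
by rewrite rmcol_addcol_empty oppr0 mul0r add0r subrr mulr0.
Qed.

(** For two consecutive columns [gdn_strip] gives g and [kap_column] gives kappa; by [kap_gdn] their
    quotient gives that of the norms. *)
Lemma nrm_column k : (k <= D)%N -> let la := addcol k pempty in
  nrm la = stripc la * hookc alpha la.
Proof.
elim: k => [_|k IH kD].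
  have -> : addcol 0 pempty = pempty by apply: val_inj.
  by rewrite /= nrm_empty // (stripc_empty D' hJ alpha_free aniso) hookc_empty mulr1.
set la := addcol k.+1 pempty; set mu := addcol k pempty.
have md : psize mu = k by rewrite psize_addcol // addn0.
have ld : psize la = (psize mu).+1 by rewrite psize_addcol // addn0 md.
have mD : (psize mu <= D)%N by rewrite md ltnW.
have lD : (psize la <= D)%N by rewrite ld md.
have nm : nrm mu = stripc mu * hookc alpha mu by rewrite IH // ltnW.
have lE : plength la = k.+1 by rewrite plength_addcol.
have G := gdn_strip hJ alpha_free aniso lE ld lD.
have gE : gdn la mu = stripc la / stripc mu.
  rewrite G; last by rewrite plength_addcol.
  by rewrite rmcol_addcol_empty eqxx.
have kc := kap_column kD; rewrite -/la -/mu in kc.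
have E := kap_gdn hJ alpha_free aniso lD mD; rewrite gE nm in E.
have sm := stripc_neq0 hJ alpha_free aniso mD.
rewrite /= -[nrm la]mul1r -kc mulrAC E hookc_column -/mu.
by field; rewrite sm alpha_neq0.
Qed.

Lemma nrm_strip la : (psize la <= D)%N -> nrm la = nrm (rmcol la) * stripc la * hookc alpha la.
Proof.
have [k] := ubnP (psize la); elim: k la => // k IH la lk lD.
case: (posnP (psize (rmcol la))) => [/psize_eq0 r0|rp].
  have lE : la = addcol (plength la) pempty by rewrite -r0 rmcolK.
  have ln : (plength la <= D)%N by apply: leq_trans lD; exact: plength_le_psize.
  by rewrite r0 nrm_empty // mul1r; have := nrm_column ln; rewrite /= -lE.
apply: (gdn_moment_strip aniso) => // mu ml; apply: IH; first exact: leq_trans ml _.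
exact: leq_trans (ltnW ml) lD.
Qed.

Lemma stripc_prod la : (psize la <= D)%N -> stripc la = \prod_(i < plength la)
  ((nth 0%N (rmcol la) i)%:R * alpha + (plength la - i)%:R).
Proof.
move=> lD; set n := plength la.
have g0 : gpoch alpha (n%:R / alpha) (rmcol la) != 0.
  have := gpoch_neq0 alpha_free (p := 0) (q := n) (la := rmcol la).
  by rewrite add0r plength_rmcol; apply.
apply: (mulIf g0); rewrite (stripc_gpoch hJ alpha_free aniso lD) -/n.
have := gpoch_addcol_right alpha (n%:R / alpha) (plength_rmcol la).
rewrite rmcolK => ->; rewrite -/n mulrCA mulrC; congr (_ * _).
have -> : alpha ^+ n = \prod_(i < n) alpha by rewrite prodr_const card_ord.
rewrite -big_split /=; apply: eq_bigr => i _; rewrite natrB ?(ltnW (ltn_ord i)) //.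
by field.
Qed.

(** One column at a time: [stripc_prod] and [hookc] are the two halves of the factors in
    [jnorm_addcol]. *)
Lemma nrm_jnorm la : (psize la <= D)%N -> nrm la = jnorm alpha la.
Proof.
have [k] := ubnP (psize la); elim: k la => // k IH la lk lD.
case: (posnP (psize la)) => [/psize_eq0 ->|lp]; first by rewrite nrm_empty // jnorm_empty.
rewrite -{2}(rmcolK la) jnorm_addcol ?plength_rmcol // nrm_strip // IH; last 2 first.
- exact: leq_trans (rmcol_lt lp) lk.
- by apply: leq_trans lD; rewrite (psize_rmcol la) leq_addl.
rewrite -mulrA; congr (_ * _); rewrite stripc_prod // /hookc -big_split /=.
apply: eq_bigr => i _; have il : (i < plength la)%N := ltn_ord i.
by rewrite nth_rmcol prednK // pnth_gt0.
Qed.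

End HookNorm.

(** * The Borodin-Olshanski series *)

Lemma mcoeff_hcomp (R : fieldType) n (F : fps R n) d (e : 'X_{1..n}) :
  (fps_hcomp F d)@_e = if mdeg e == d then F e else 0.
Proof.
rewrite /fps_hcomp raddf_sum /=; case: ifP => [/eqP ed|/eqP ed].
  have eb : (mdeg e < d.+1)%N by rewrite ed.
  rewrite (bigD1 (BMultinom eb)) /= ?ed //= mcoeffZ mcoeffX eqxx mulr1.
  rewrite big1 ?addr0 // => f /andP[_ fe]; rewrite mcoeffZ mcoeffX.
  case: (bmnm f =P e) => [E|_]; last by rewrite mulr0.
  by case/negP: fe; apply/eqP/val_inj.
apply: big1 => f /eqP fd; rewrite mcoeffZ mcoeffX.
case: (bmnm f =P e) => [E|_]; last by rewrite mulr0.
by case: ed; rewrite -E.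
Qed.

Lemma eq_hcomp (R : fieldType) n (F G : fps R n) d :
  F =1 G -> fps_hcomp F d = fps_hcomp G d.
Proof. by move=> FG; apply/mpolyP => e; rewrite !mcoeff_hcomp FG. Qed.

Lemma eq_annihilated (R : fieldType) n (alpha a b c : R) (F G : fps R n) :
  F =1 G -> annihilated alpha a b c F -> annihilated alpha a b c G.
Proof. by move=> FG h d; rewrite -!(eq_hcomp _ FG). Qed.

Lemma fps_restrict_id (R : fieldType) n (F : fps R n) : fps_restrict n F =1 F.
Proof.
by move=> e; congr F; apply/mnmP => i; rewrite mnmE (mnm_nth 0%N).
Qed.

Lemma poch_neq0 (R : fieldType) (c : R) k : (forall i : nat, c + i%:R != 0) -> poch c k != 0.
Proof. by move=> c0; rewrite /poch prodf_seq_neq0; apply/allP => i _ /=; exact: c0. Qed.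

(** * Existence and uniqueness over a general field of coefficients *)

Section Assembly.
Variables (K : fieldType) (alpha : K) (J : intpart -> symfun K).
Hypothesis hJ : is_jack_family alpha J.
Hypothesis alpha_free : linfree alpha.
Hypothesis aniso : anisotropic alpha.
Variables (R : fieldType) (iota : {rmorphism K -> R}) (a b c : R).
Hypothesis c_neg : forall k : nat, c + k%:R != 0.
Implicit Types (la mu : intpart) (C : intpart -> R).

Local Notation alpha' := (iota alpha).
Local Notation series := (jack_series iota alpha' J).
Let JR la n : {mpoly R[n]} := map_mpoly iota (J la n).
Let alpha_neq0 := linfree_neq0 alpha_free.

Let alpha'_neq0 : alpha' != 0.
Proof. by rewrite fmorph_eq0 alpha_neq0. Qed.

Lemma jnorm_iota la : jnorm alpha' la = iota (jnorm alpha la).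
Proof.
rewrite /jnorm rmorph_prod; apply: eq_bigr => i _; rewrite rmorph_prod.
apply: eq_bigr => j _; rewrite rmorphM [iota (_ + _)]rmorphD [iota (_ + _)]rmorphD.
by rewrite [iota (_ * alpha)]rmorphM [iota (_ * alpha)]rmorphM !rmorph_nat.
Qed.

(** The sum may run over all partitions of d, whatever n is: the longer ones contribute 0 by
    [J_few_vars]. *)
Lemma hcomp_jack C n d : fps_hcomp (series n C) d =
  \sum_(la <- partitions_of d) (C la * alpha' ^+ d / jnorm alpha' la) *: JR la n.
Proof.
apply/mpolyP => e; rewrite mcoeff_hcomp raddf_sum /=; case: ifP => [/eqP ed|/eqP ed].
  rewrite /jack_series ed.
  have P : perm_eq (parts n d) [seq la <- partitions_of d | (plength la <= n)%N].
    apply: uniq_perm; rewrite ?filter_uniq ?parts_uniq // => la.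
    by rewrite mem_filter mem_partitions_of mem_parts.
  rewrite (perm_big _ P) big_filter big_mkcond /=.
  rewrite [LHS]big_seq [RHS]big_seq; apply: eq_bigr => la; rewrite mem_partitions_of => /eqP ->.
  rewrite mcoeffZ mcoeff_map_mpoly mulrAC; case: leqP => // /(J_few_vars hJ) ->.
  by rewrite mcoeff0 raddf0 mulr0.
rewrite big_seq big1 // => la; rewrite mem_partitions_of => /eqP ld.
rewrite mcoeffZ mcoeff_map_mpoly (mcoeffJ hJ) ld.
by case: eqP => // _; rewrite raddf0 mulr0.
Qed.

Lemma translation_map n (p : {mpoly K[n]}) :
  translation (map_mpoly iota p) = map_mpoly iota (translation p).
Proof.
rewrite /translation raddf_sum; apply: eq_bigr => i _; exact: esym (map_mpoly_deriv iota p i).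
Qed.

Lemma map_mpoly_sumZ n (s : seq intpart) (y : intpart -> K) :
  map_mpoly iota (\sum_(mu <- s) y mu *: J mu n) = \sum_(mu <- s) iota (y mu) *: JR mu n.
Proof.
apply/mpolyP => e; rewrite mcoeff_map_mpoly !raddf_sum /=; apply: eq_bigr => mu _.
by rewrite !mcoeffZ mcoeff_map_mpoly rmorphM.
Qed.

Lemma translation_sumZ n (s : seq intpart) (x : intpart -> R) (f : intpart -> {mpoly R[n]}) :
  translation (\sum_(la <- s) x la *: f la) = \sum_(la <- s) x la *: translation (f la).
Proof.
rewrite /translation; under eq_bigr => i _ do rewrite raddf_sum /=.
rewrite exchange_big /=; apply: eq_bigr => la _; rewrite scaler_sumr.
by apply: eq_bigr => i _; rewrite mderivZ.
Qed.

Lemma hcomp_dhomog n (F : fps R n) d : fps_hcomp F d \is d.-homog.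
Proof.
apply/dhomogP => e; rewrite mcoeff_msupp mcoeff_hcomp.
by case: ifP => [/eqP|_]; rewrite ?eqxx.
Qed.

Lemma kap_gpochs d la mu : psize mu = d -> psize la = d.+1 ->
  gpoch alpha' a la * gpoch alpha' b la * iota (kap d hJ alpha_free la mu) =
  gpoch alpha' a mu * gpoch alpha' b mu * iota (kap d hJ alpha_free la mu) *
  ((a + iota (ctsum alpha la - ctsum alpha mu)) * (b + iota (ctsum alpha la - ctsum alpha mu))).
Proof.
move=> md ld; case: (kap d hJ alpha_free la mu =P 0) => [->|/eqP k0].
  by rewrite rmorph0 !mulr0 mul0r.
have lm : psize la = (psize mu).+1 by rewrite md.
have lD : (psize la <= d.+1)%N by rewrite ld.
by rewrite !(kap_gpoch_ext aniso iota _ lm lD k0); ring.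
Qed.

(** The left side is a cubic in the content of the added box, so its expansion involves only the
    moments of order 0 to 3. *)
Lemma eigenvalue_moments n d mu : psize mu = d ->
  \sum_(la <- partitions_of d.+1) iota (kap d hJ alpha_free la mu) *
    ((a + iota (ctsum alpha la - ctsum alpha mu)) *
     (b + iota (ctsum alpha la - ctsum alpha mu)) *
     (n%:R + alpha' * iota (ctsum alpha la - ctsum alpha mu))) =
  iota (2 * ctsum alpha mu + alpha^-1 * (n%:R - 1) * (psize mu)%:R)
    + (a + b + 1) * d%:R + n%:R * (a * b).
Proof.
move=> md; have mD : (psize mu < d.+1)%N by rewrite md.
have [M1 M2 M3] := kap_moments hJ alpha_free aniso mD.
have M0 := moment0 hJ alpha_free aniso mD.
pose M k := iota (moment d hJ alpha_free mu k).
have -> : \sum_(la <- partitions_of d.+1) iota (kap d hJ alpha_free la mu) *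
    ((a + iota (ctsum alpha la - ctsum alpha mu)) *
     (b + iota (ctsum alpha la - ctsum alpha mu)) *
     (n%:R + alpha' * iota (ctsum alpha la - ctsum alpha mu))) =
  n%:R * (a * b) * M 0%N + (n%:R * (a + b) + alpha' * (a * b)) * M 1%N
  + (n%:R + alpha' * (a + b)) * M 2 + alpha' * M 3.
  rewrite /M /moment md !rmorph_sum !mulr_sumr -!big_split /=; apply: eq_bigr => la _.
  by rewrite ![iota (_ * _ ^+ _)]rmorphM ![iota (_ ^+ _)]rmorphXn; ring.
rewrite /M M0 M1 M2 M3 md rmorph1 rmorph0.
rewrite ![iota (_ / _)]rmorphM !rmorphD !rmorphM !rmorphB !rmorph1 !rmorph_nat fmorphV.
by field.
Qed.

(** Compare the coefficients of J_mu in degree d. The norms, now known to be [jnorm], turn [gdn]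
    into [kap]; the Pochhammer symbols leave (a + x) (b + x), and c + d cancels against the factor
    in [Lop_dhomog]. What remains is [eigenvalue_moments]. *)
Lemma BO_annihilated n : annihilated alpha' a b c
  (series n (fun la => gpoch alpha' a la * gpoch alpha' b la / poch c (psize la))).
Proof.
set C := fun la => _; move=> d; apply/eqP; rewrite subr_eq0; apply/eqP.
rewrite (Lop_dhomog c (hcomp_dhomog _ _)).
have H : lbrel alpha' (fps_hcomp (series n C) d)
  (\sum_(mu <- partitions_of d) (C mu * alpha' ^+ d / jnorm alpha' mu) *:
    map_mpoly iota ((2 * ctsum alpha mu + alpha^-1 * (n%:R - 1) * (psize mu)%:R) *: J mu n)).
  rewrite hcomp_jack; apply: lbrel_sum => mu; rewrite mem_partitions_of => /eqP md.
  (* The power sums up to p_(d+1) suffice for the weights d and d + 1. *)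
  apply/lbrelZ/lbrel_map/(jack_lbrel hJ alpha_free aniso n (D' := d)).
  by rewrite md.
rewrite (Mop_lbrel a b alpha'_neq0 H); congr tofrac.
rewrite (euler_dhomog (hcomp_dhomog _ _)) !hcomp_jack {H}.
rewrite translation_sumZ scaler_sumr big_seq; under eq_bigr => la.
  rewrite mem_partitions_of => /eqP ld.
  have lD : (psize la <= d.+1)%N by rewrite ld.
  rewrite translation_map (translation_jack hJ alpha_free aniso n ld lD) map_mpoly_sumZ.
  rewrite !scaler_sumr.
  over.
rewrite -big_seq exchange_big /= !scaler_sumr -!big_split /= big_seq [RHS]big_seq.
apply: eq_bigr => mu; rewrite mem_partitions_of => /eqP md.
have := map_mpoly_sumZ n [:: mu]
  (fun mu => 2 * ctsum alpha mu + alpha^-1 * (n%:R - 1) * (psize mu)%:R).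
rewrite !big_seq1 => ->; rewrite !scalerA -!scalerDl.
under eq_bigr => la _ do rewrite !scalerA.
rewrite -scaler_suml; congr (_ *: _).
have -> : C mu * alpha' ^+ d / jnorm alpha' mu *
    iota (2 * ctsum alpha mu + alpha^-1 * (n%:R - 1) * (psize mu)%:R) +
    (a + b + 1) * d%:R * (C mu * alpha' ^+ d / jnorm alpha' mu) +
    n%:R * (a * b) * (C mu * alpha' ^+ d / jnorm alpha' mu) =
  C mu * alpha' ^+ d / jnorm alpha' mu *
  (iota (2 * ctsum alpha mu + alpha^-1 * (n%:R - 1) * (psize mu)%:R)
    + (a + b + 1) * d%:R + n%:R * (a * b)) by ring.
rewrite -(eigenvalue_moments n md) mulr_sumr big_seq [RHS]big_seq.
apply: eq_bigr => la; rewrite mem_partitions_of => /eqP ld.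
have mD : (psize mu <= d.+1)%N by rewrite md.
have lD : (psize la <= d.+1)%N by rewrite ld.
have jm := nrm_neq0 hJ alpha_free aniso mD.
have jl := nrm_neq0 hJ alpha_free aniso lD.
have gE : gdn d hJ alpha_free la mu =
    kap d hJ alpha_free la mu * jnorm alpha la / (alpha * jnorm alpha mu).
  rewrite -(nrm_jnorm hJ alpha_free aniso mD) -(nrm_jnorm hJ alpha_free aniso lD).
  rewrite (kap_gdn hJ alpha_free aniso lD mD).
  by field; rewrite jm alpha_neq0.
rewrite gE /C ld md !jnorm_iota.
have cE : poch c d.+1 = poch c d * (c + d%:R) by rewrite /poch big_nat_recr.
rewrite (nrm_jnorm hJ alpha_free aniso mD) in jm; rewrite (nrm_jnorm hJ alpha_free aniso lD) in jl.
have jm' : iota (jnorm alpha mu) != 0 by rewrite fmorph_eq0.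
have jl' : iota (jnorm alpha la) != 0 by rewrite fmorph_eq0.
have pc := poch_neq0 d c_neg; have cd := c_neg d.
have G := kap_gpochs md ld.
move: G cE.
set k := kap _ _ _ _ _; set x := ctsum _ _ - _; move: k => k.
rewrite [iota (_ * (_ / _))]rmorphM [iota (_ + _ * x)]rmorphD.
rewrite [iota (_ * x)]rmorphM rmorph_nat [iota (_ / _)]rmorphM fmorphV [iota (alpha * _)]rmorphM
  [iota (k * _)]rmorphM.
set ga := gpoch _ a la; set gb := gpoch _ b la => G ->.
transitivity (ga * gb * iota k *
  ((n%:R + alpha' * iota x) / poch c d * alpha' ^+ d / iota (jnorm alpha mu))).
  by rewrite exprS; field; rewrite jl' jm' cd pc alpha'_neq0.
by rewrite G; ring.
Qed.

Lemma series_coef C n (e : 'X_{1..n}) : series n C e =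
  \sum_(la <- partitions_of (mdeg e))
    C la * alpha' ^+ mdeg e / jnorm alpha' la * iota (jcoef J la (psort e)).
Proof.
have := congr1 (mcoeff e) (hcomp_jack C n (mdeg e)); rewrite mcoeff_hcomp eqxx => ->.
rewrite raddf_sum /= big_seq [RHS]big_seq; apply: eq_bigr => la.
rewrite mem_partitions_of => /eqP ld.
by rewrite mcoeffZ mcoeff_map_mpoly (mcoeffJ hJ) ld eqxx.
Qed.

Lemma series_sym C n (e e' : 'X_{1..n}) : perm_eq e e' -> series n C e = series n C e'.
Proof.
move=> ee; rewrite !series_coef (psort_perm ee).
by have -> : mdeg e = mdeg e' by rewrite -!sumn_mdeg; apply: perm_sumn.
Qed.

(** The coefficient of x^e depends only on the nonzero exponents, up to order. *)
Lemma series_restrict C m n : (m <= n)%N -> fps_restrict m (series n C) =1 series m C.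
Proof.
move=> mn e; rewrite /fps_restrict !series_coef.
have E := ext_multinomE e mn; set e' := [multinom _ | _ < _] in E *.
have -> : mdeg e' = mdeg e.
  by rewrite -!sumn_mdeg E sumn_cat sumn_nseq mul0n addn0.
by rewrite E psort_cat0.
Qed.

Lemma translation_series m (F : fps R m) d (e : 'X_{1..m}) : mdeg e = d ->
  (translation (fps_hcomp F d.+1))@_e = \sum_(i < m) (e i).+1%:R * F (e + U_(i))%MM.
Proof.
move=> ed; rewrite /translation raddf_sum /=; apply: eq_bigr => i _.
by rewrite mcoeff_deriv mcoeff_hcomp mdegD mdeg1 addn1 ed eqxx mulr_natl.
Qed.

(** Equal components of degree d have equal images under M, hence the next components have equal
    images under L, and c + d <> 0 may be cancelled. *)
Lemma annihilated_step m (F G : fps R m) d :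
    annihilated alpha' a b c F -> annihilated alpha' a b c G ->
    (forall e, mdeg e = d -> F e = G e) ->
  translation (fps_hcomp F d.+1) = translation (fps_hcomp G d.+1).
Proof.
move=> hF hG FG.
have E : fps_hcomp F d = fps_hcomp G d.
  by apply/mpolyP => e; rewrite !mcoeff_hcomp; case: ifP => // /eqP /FG.
have := hF d; rewrite E => /eqP; rewrite subr_eq0 => /eqP hF'.
have := hG d => /eqP; rewrite subr_eq0 -hF' tofrac_eq => /eqP.
rewrite !(Lop_dhomog c (hcomp_dhomog _ _)).
by move/(scalerI (c_neg d)).
Qed.

(** Induction on the degree for the difference: by [annihilated_step] its next component is killed
    by the translation operator in each number of variables from 1 to n, and
    [translation_kernel_deg] applies. *)
Lemma series_unique n C C' :
    (forall m, (1 <= m <= n)%N -> annihilated alpha' a b c (series m C)) ->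
    (forall m, (1 <= m <= n)%N -> annihilated alpha' a b c (series m C')) ->
    series n C 0%MM = series n C' 0%MM ->
  series n C =1 series n C'.
Proof.
move=> hC hC' z e; apply/eqP; rewrite -subr_eq0; apply/eqP.
have [k] := ubnP (mdeg e); elim: k e => // k IH e ek.
case ed : (mdeg e) => [|d].
  by move/eqP: ed; rewrite mdeg_eq0 => /eqP ->; rewrite z subrr.
apply: (translation_kernel_deg (F := fun e => series n C e - series n C' e) _ _ _ ed).
- by move=> j; rewrite -(rmorph_nat iota) fmorph_eq0 (linfree_char0 alpha_free).
- by move=> f f' ff; rewrite !(series_sym _ ff).
move=> m f mn fd; have [_ mn'] := andP mn.
have S D f' : fps_restrict m (series n D) f' = series m D f' by apply: series_restrict.
have : translation (fps_hcomp (series m C) d.+1) = translation (fps_hcomp (series m C') d.+1).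
  apply: annihilated_step; [exact: hC|exact: hC'|move=> g gd].
  have := IH [multinom nth 0%N g i | i < n]; rewrite -sumn_mdeg ext_multinomE //.
  rewrite sumn_cat sumn_nseq mul0n addn0 sumn_mdeg gd => H.
  by apply/eqP; rewrite -subr_eq0 -!S; apply/eqP/H; rewrite -ltnS -ed.
move/(congr1 (mcoeff f)); rewrite !translation_series // => E.
apply/eqP; move/eqP: E; rewrite -subr_eq0 -sumrB; congr (_ == _); apply: eq_bigr => i _.
by rewrite -mulrBr -!S.
Qed.

Lemma series_at0 C n : series n C 0%MM = C pempty.
Proof.
rewrite series_coef mdeg0 expr0.
have P : perm_eq (partitions_of 0) [:: pempty].
  apply: uniq_perm; rewrite ?parts_uniq // => la; rewrite mem_partitions_of inE.
  by apply/eqP/eqP => [/psize_eq0|->].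
rewrite (perm_big _ P) big_seq1 jnorm_empty divr1 mulr1.
have := mcoeffJ hJ pempty (0%MM : 'X_{1..n}).
rewrite (jack_empty hJ) mcoeff1 eqxx mdeg0 /= => E.
by rewrite -[RHS]mulr1 -(rmorph1 iota); congr (_ * iota _); apply/esym.
Qed.

Lemma BO_at0 n : series n (fun la =>
  gpoch alpha' a la * gpoch alpha' b la / poch c (psize la)) 0%MM = 1.
Proof. by rewrite series_at0 !gpoch_empty /poch big_nil invr1 !mulr1. Qed.
End Assembly.

(** * The ground fields, and the theorem *)

Import Num.Theory.

Lemma frac_numden (R : idomainType) (z : {fraction R}) :
  z * (\d_(repr z))%:F = (\n_(repr z))%:F.
Proof.
rewrite -{1}[z]reprK; unlock tofrac; rewrite -[LHS]FracField.pi_mul.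
by apply/eqmodP; rewrite /= FracField.equivfE /FracField.mulf !numden_Ratio ?oner_neq0 //;
  rewrite ?mulr1 1?mulrC ?denom_ratioP.
Qed.

Lemma common_denominator (R : idomainType) (I : eqType) (s : seq I) (f : I -> {fraction R}) :
  exists (D : R) (P : I -> R), D != 0 /\ {in s, forall i, (P i)%:F = f i * D%:F}.
Proof.
exists (\prod_(i <- s) \d_(repr (f i))).
exists (fun i => \n_(repr (f i)) * \prod_(j <- rem i s) \d_(repr (f j))); split.
  by rewrite prodf_seq_neq0; apply/allP => i _; exact: denom_ratioP.
by move=> i si; rewrite [in RHS](big_rem i si) /= !tofracM mulrA frac_numden.
Qed.

Lemma alphaQ_linfree : linfree alphaQ.
Proof.
move=> a b a' b' E.
have toF x y : x%:R * alphaQ + y%:R = (x%:R * 'X + y%:R : {poly rat})%:F.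
  by rewrite tofracD tofracM !rmorph_nat.
move: E; rewrite !toF => /eqP; rewrite tofrac_eq => /eqP E.
have coefs x y : (x%:R * 'X + y%:R : {poly rat})`_1 = x%:R
    /\ (x%:R * 'X + y%:R : {poly rat})`_0 = y%:R.
  by rewrite !coefD !coefMX /= -!polyC_natr !coefC /= addr0 add0r.
have [a1 b1] := coefs a b; have [a2 b2] := coefs a' b'.
have A : a%:R = a'%:R :> rat by rewrite -a1 -a2 E.
have B : b%:R = b'%:R :> rat by rewrite -b1 -b2 E.
by split; apply/eqP; rewrite -(eqr_nat rat) ?A ?B.
Qed.

Lemma poly_rat_eq0 (p : {poly rat}) : (forall t : nat, p.[t.+1%:R] = 0) -> p = 0.
Proof.
move=> p0; apply/eqP/negPn/negP => pn0.
have := @max_poly_roots _ p [seq t.+1%:R | t <- iota 0 (size p)] pn0.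
rewrite size_map size_iota ltnn => H; suff: false by [].
apply: H; first by apply/allP => _ /mapP[t _ ->]; rewrite /root p0.
by rewrite map_inj_uniq ?iota_uniq // => x y /eqP; rewrite eqr_nat eqSS => /eqP.
Qed.

(** After clearing denominators the sum is a polynomial in alpha. At each positive integer its terms
    are nonnegative, so every numerator vanishes at all positive integers. *)
Lemma alphaQ_anisotropic : anisotropic alphaQ.
Proof.
move=> I s f w e w0 fs0.
have [D [P [D0 PE]]] := common_denominator s f.
suff P0 : {in s, forall i, P i = 0}.
  move=> i si; have /eqP := PE i si; rewrite (P0 i si) tofrac0 eq_sym mulf_eq0.
  by rewrite tofrac_eq0 (negbTE D0) orbF => /eqP.
have S0 : \sum_(i <- s) P i ^+ 2 * ((w i)%:R * 'X ^+ e i) = 0.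
  apply/eqP; rewrite -tofrac_eq0; apply/eqP.
  rewrite raddf_sum /= -[RHS](mul0r (D%:F ^+ 2)) -{2}fs0 mulr_suml.
  rewrite big_seq [RHS]big_seq; apply: eq_bigr => i si.
  by rewrite !tofracM !tofracXn rmorph_nat PE // -/alphaQ; ring.
move=> i si; apply: poly_rat_eq0 => t.
have := congr1 (horner_eval t.+1%:R) S0; rewrite raddf_sum /= /horner_eval horner0.
have T0 : 0 < t.+1%:R :> rat by rewrite ltr0n.
have hE j : (P j ^+ 2 * ((w j)%:R * 'X ^+ e j)).[t.+1%:R]
    = (P j).[t.+1%:R] ^+ 2 * ((w j)%:R * t.+1%:R ^+ e j).
  by rewrite !hornerE -polyC_natr hornerC.
move/eqP; rewrite psumr_eq0 => [/allP /(_ i si)|j _]; rewrite hE.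
  rewrite !mulf_eq0 orbb pnatr_eq0 -leqn0 leqNgt w0 /= expf_eq0 (gt_eqF T0) andbF orbF.
  by move/eqP.
by rewrite mulr_ge0 ?sqr_ge0 // mulr_ge0 ?ler0n ?exprn_ge0 ?ler0n.
Qed.

Lemma iotaK_is_zmod_morphism : zmod_morphism iotaK.
Proof. by move=> x y; rewrite /iotaK mpolyCB tofracB. Qed.

Lemma iotaK_is_monoid_morphism : monoid_morphism iotaK.
Proof. by split=> [|x y]; rewrite /iotaK ?mpolyC1 ?tofrac1 // mpolyCM tofracM. Qed.

HB.instance Definition _ := GRing.isZmodMorphism.Build _ _ iotaK iotaK_is_zmod_morphism.
HB.instance Definition _ := GRing.isMonoidMorphism.Build _ _ iotaK iotaK_is_monoid_morphism.

Lemma cK_neg (k : nat) : cK + k%:R != 0.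
Proof.
have -> : cK + k%:R = ('X_(inord 2) + k%:R : {mpoly Qalpha[3]})%:F.
  by rewrite tofracD rmorph_nat.
rewrite tofrac_eq0; apply/eqP => E.
have := congr1 (mcoeff U_(inord 2 : 'I_3)) E; rewrite mcoeffD mcoeffX eqxx mcoeff0.
rewrite -mpolyC_nat mcoeffC mnm1_eq0 mulr0 addr0 => /eqP.
by rewrite oner_eq0.
Qed.

Theorem mainTheorem4 (n : nat) (hn : (1 <= n)%N)
    (J : intpart -> symfun Qalpha) (hJ : is_jack_family alphaQ J) :
  [/\ in_Fx J (BO_series J n),
      BO_system (BO_series J n)
    & forall F : fps Kabc n, in_Fx J F -> BO_system F -> F =1 BO_series J n].
Proof.
pose L := @BO_annihilated _ _ _ hJ alphaQ_linfree alphaQ_anisotropic Kabc iotaK aK bK cK cK_neg.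
have restrC C m : (m <= n)%N ->
    fps_restrict m (jack_series iotaK alphaK J n C) =1 jack_series iotaK alphaK J m C.
  exact: (series_restrict hJ iotaK C).
pose C0 (la : intpart) := gpoch alphaK aK la * gpoch alphaK bK la / poch cK (psize la).
(* The restriction of the series to m variables has the same coefficients C, so the stability
   conditions, with the full equation as the case m = n, become equations for one family of
   series. *)
have system F C : F =1 jack_series iotaK alphaK J n C -> BO_system F ->
    forall m, (1 <= m <= n)%N -> annihilated alphaK aK bK cK (jack_series iotaK alphaK J m C).
  move=> FC [hF _ hFm] m /andP[m1 mn].
  have E : fps_restrict m F =1 jack_series iotaK alphaK J m C.
    by move=> e; rewrite -restrC // /fps_restrict FC.
  apply: (eq_annihilated E); move: mn; rewrite leq_eqVlt => /orP[/eqP mE|mn].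
    by rewrite mE; apply: eq_annihilated hF => e; rewrite fps_restrict_id.
  by apply: hFm => //; rewrite subn1 -ltnS prednK.
split; first by exists C0.
  split; first exact: L.
    exact: (BO_at0 hJ iotaK aK bK cK n).
  move=> m m1 mn; apply: eq_annihilated (L m) => e.
  by rewrite restrC // (leq_trans mn) // leq_subr.
move=> F [C FC] hF e; rewrite FC.
apply: (series_unique hJ alphaQ_linfree cK_neg (iota := iotaK) (a := aK) (b := bK)).
- exact: (system F).
- by move=> m _; apply: L.
rewrite [RHS](BO_at0 hJ iotaK aK bK cK n) -FC.
by have [_ ->] := hF.
Qed.
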